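(* Define, for polynomials $p$ on $\mathbb{R}^m$ and $z\in\mathbb{R}^m$, $$\mathcal V(p)(z):=\frac{1}{(2\pi)^{m/2}}\int_{\mathbb{R}^m}K(iy,z)\,\mathcal F\big(p(\cdot)e^{-|\cdot|^2/2}\big)(y)\,dy,\qquad K(iy,z):=e^{-\Delta_{(y)}/2}E_\kappa(iy,z).$$ Then $\mathcal V(\partial_jp)=T_j\mathcal V(p)$ for every polynomial $p$ and every $j=1,\dots,m$, where $T_j$ acts in the variable $z$.
   Context: Let $G\subset O(m)$ be a finite reflection group with root system $R$, fixed positive subsystem $R_+$, and let $\kappa:R\to[0,\infty)$ be a $G$-invariant multiplicity function. For $\alpha\in R$, $\sigma_\alpha x=x-2\langle x,\alpha\rangle\alpha/\|\alpha\|^2$. The Dunkl operators are $T_jf(x)=\partial_jf(x)+\sum_{\alpha\in R_+}\kappa(\alpha)\alpha_j\frac{f(x)-f(\sigma_\alpha x)}{\langle \alpha,x\rangle}$. The Dunkl kernel $E_\kappa(x,y)$ (holomorphically extended to $\mathbb{C}^m\times\mathbb{C}^m$) is the unique function with $T^{(x)}_jE_\kappa(x,y)=y_jE_\kappa(x,y)$ and $E_\kappa(0,y)=1$. $\Delta_{(y)}$ is the ordinary Laplacian in $y$ and $e^{-\Delta_{(y)}/2}F(y)=\sum_{n\ge0}\frac{(-1)^n}{2^nn!}\Delta_{(y)}^nF(y)$, which converges for $F(y)=E_\kappa(iy,z)$. The Fourier transform is $\mathcal Ff(y)=(2\pi)^{-m/2}\int_{\mathbb{R}^m}e^{-i\langle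 x,y\rangle}f(x)\,dx$. *)

(* Defs.v *)
From HB Require Import structures.
From mathcomp Require Import all_boot all_order all_algebra.
From mathcomp Require Import all_classical all_reals all_analysis.
From mathcomp Require Import complex.
From mathcomp Require mpoly.

Set Implicit Arguments.
Unset Strict Implicit.
Unset Printing Implicit Defensive.

Import Order.TTheory GRing.Theory Num.Theory.
Import numFieldNormedType.Exports.
Local Open Scope classical_set_scope.
Local Open Scope ring_scope.

(* C = complex numbers with their canonical normed-field topology,
   seen as a normed vector space over C itself *)
Definition Cx (R : realType) := (complex R)^o.

Definition RC (R : realType) (x : R) : Cx R := Complex x 0.
Definition IC (R : realType) (x : R) : Cx R := Complex 0 x.
Definition expi (R : realType) (t : R) : Cx R := Complex (cos t) (sin t).

Definition dotv (R : realType) (m : nat) (x y : 'rV[R]_m) : R :=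
  \sum_(i < m) x ord0 i * y ord0 i.

Definition refl (R : realType) (m : nat) (a x : 'rV[R]_m) : 'rV[R]_m :=
  x - (2 * dotv x a / dotv a a) *: a.

Definition ej (R : realType) (m : nat) (j : 'I_m) : 'rV[R]_m :=
  \row_(l < m) (if l == j then 1 else 0).

Definition root_system (R : realType) (m : nat) (Rt : seq 'rV[R]_m) : Prop :=
  [/\ uniq Rt, (0 : 'rV[R]_m) \notin Rt,
      (forall a, a \in Rt -> forall c : R, (c *: a \in Rt) = ((c == 1) || (c == -1)))
    & (forall a b, a \in Rt -> b \in Rt -> refl a b \in Rt)].

Definition act_word (R : realType) (m : nat) (w : seq 'rV[R]_m) (x : 'rV[R]_m) :=
  foldr (fun b y => refl b y) x w.

(* κ is invariant under the reflection group G generated by the σ_α, α ∈ R: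
   every element of G is a finite product of reflections σ_b (b ∈ R). *)
Definition G_invariant (R : realType) (m : nat) (Rt : seq 'rV[R]_m)
    (kappa : 'rV[R]_m -> R) : Prop :=
  forall w : seq 'rV[R]_m, all (fun b => b \in Rt) w ->
    forall a, a \in Rt -> kappa (act_word w a) = kappa a.

Definition regular_vector (R : realType) (m : nat) (Rt : seq 'rV[R]_m) (beta : 'rV[R]_m) :=
  forall a, a \in Rt -> dotv a beta != 0.

Definition Rplus (R : realType) (m : nat) (Rt : seq 'rV[R]_m) (beta : 'rV[R]_m) :=
  [seq a <- Rt | 0 < dotv a beta].

Definition pdquot (R : realType) (m : nat) (f : 'rV[R]_m -> Cx R) (j : 'I_m)
    (x : 'rV[R]_m) (t : R) : Cx R :=
  (RC t)^-1 * (f (x + t *: ej R j) - f x).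

Definition has_pd (R : realType) (m : nat) (f : 'rV[R]_m -> Cx R) (j : 'I_m)
    (x : 'rV[R]_m) : Prop :=
  cvg (pdquot f j x t @[t --> 0^']).

Definition pd (R : realType) (m : nat) (f : 'rV[R]_m -> Cx R) (j : 'I_m) :
    'rV[R]_m -> Cx R :=
  fun x => lim (pdquot f j x t @[t --> 0^']).

Definition lap (R : realType) (m : nat) (f : 'rV[R]_m -> Cx R) : 'rV[R]_m -> Cx R :=
  fun x => \sum_(j < m) pd (pd f j) j x.

(* the Dunkl difference term (f(x) - f(σ_α x)) / <α,x>, extended by continuity
   to the hyperplane <α,x> = 0 *)
Definition dquot0 (R : realType) (m : nat) (f : 'rV[R]_m -> Cx R) (a x : 'rV[R]_m) : Cx R :=
  (f x - f (refl a x)) / RC (dotv a x).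

Definition dquot (R : realType) (m : nat) (f : 'rV[R]_m -> Cx R) (a x : 'rV[R]_m) : Cx R :=
  if dotv a x != 0 then dquot0 f a x
  else lim (dquot0 f a y @[y --> within [set y | dotv a y != 0] (nbhs x)]).

Definition dunkl (R : realType) (m : nat) (Rt : seq 'rV[R]_m) (beta : 'rV[R]_m)
    (kappa : 'rV[R]_m -> R) (j : 'I_m) (f : 'rV[R]_m -> Cx R) : 'rV[R]_m -> Cx R :=
  fun x => pd f j x + \sum_(a <- Rplus Rt beta) RC (kappa a * a ord0 j) * dquot f a x.

(* E : C^m x C^m -> C is the (holomorphically extended) Dunkl kernel:
   it is holomorphic (C-differentiable) on C^m x C^m, and for every y ∈ C^m the
   function x ↦ E(x,y) on R^m satisfies T_j E(.,y) = y_j E(.,y), E(0,y) = 1. *)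
Definition is_Dunkl_kernel (R : realType) (m : nat) (Rt : seq 'rV[R]_m) (beta : 'rV[R]_m)
    (kappa : 'rV[R]_m -> R) (E : 'rV[Cx R]_m -> 'rV[Cx R]_m -> Cx R) : Prop :=
  [/\ (forall v : 'rV[Cx R]_m * 'rV[Cx R]_m,
         differentiable (fun u : 'rV[Cx R]_m * 'rV[Cx R]_m => E u.1 u.2) v),
      (forall y : 'rV[Cx R]_m, E 0 y = 1)
    & (forall (y : 'rV[Cx R]_m) (j : 'I_m) (x : 'rV[R]_m),
         let g := fun x' : 'rV[R]_m => E (map_mx (@RC R) x') y in
         has_pd g j x /\ dunkl Rt beta kappa j g x = y ord0 j * g x)].

Definition heat_op (R : realType) (m : nat) (F : 'rV[R]_m -> Cx R) : 'rV[R]_m -> Cx R :=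
  fun y => limn (fun N => \sum_(n < N)
       RC ((-1) ^+ n / (2 ^+ n * (n`!)%:R)) * iter n (@lap R m) F y).

Definition Kker (R : realType) (m : nat) (E : 'rV[Cx R]_m -> 'rV[Cx R]_m -> Cx R)
    (y z : 'rV[R]_m) : Cx R :=
  heat_op (fun y' : 'rV[R]_m => E (map_mx (@IC R) y') (map_mx (@RC R) z)) y.

Definition updc (R : realType) (m : nat) (x : 'rV[R]_m) (k : nat) (t : R) : 'rV[R]_m :=
  \row_(l < m) (if (l : nat) == k then t else x ord0 l).

Fixpoint iint (R : realType) (m : nat) (k : nat) (h : 'rV[R]_m -> R) (x : 'rV[R]_m) : R :=
  match k with
  | 0 => h x
  | k'.+1 => Rintegral (@lebesgue_measure R) setT (fun t => iint k' h (updc x k' t))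
  end.

Definition rint (R : realType) (m : nat) (h : 'rV[R]_m -> R) : R := iint m h 0.

Definition cint (R : realType) (m : nat) (g : 'rV[R]_m -> Cx R) : Cx R :=
  Complex (rint (fun x => complex.Re (g x))) (rint (fun x => complex.Im (g x))).

Definition fnorm (R : realType) (m : nat) : R := (Num.sqrt (2 * pi)) ^- m.

Definition fourier (R : realType) (m : nat) (f : 'rV[R]_m -> Cx R) : 'rV[R]_m -> Cx R :=
  fun y => RC (fnorm R m) * cint (fun x => expi (- dotv x y) * f x).

Definition peval (R : realType) (m : nat) (p : mpoly.mpoly m R) (x : 'rV[R]_m) : R :=
  mpoly.meval (fun i => x ord0 i) p.

Definition pgauss (R : realType) (m : nat) (p : mpoly.mpoly m R) : 'rV[R]_m -> Cx R :=
  fun x => RC (peval p x * expR (- dotv x x / 2)).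

Definition Vop (R : realType) (m : nat) (E : 'rV[Cx R]_m -> 'rV[Cx R]_m -> Cx R)
    (p : mpoly.mpoly m R) : 'rV[R]_m -> Cx R :=
  fun z => RC (fnorm R m) * cint (fun y => Kker E y z * fourier (pgauss p) y).

(* Main.v *)
Require Import Defs.
From mathcomp Require Import all_boot all_order all_algebra.
From mathcomp Require Import all_classical all_reals all_analysis.
From mathcomp Require Import complex.
From mathcomp Require mpoly ssrcomplements.
From mathcomp Require Import measurable_realfun ring lra.
Import -(notations) mpoly.
Import Order.TTheory GRing.Theory Num.Theory.
Import numFieldNormedType.Exports.
Set Implicit Arguments.
Unset Strict Implicit.
Unset Printing Implicit Defensive.
Local Open Scope classical_set_scope.
Local Open Scope ring_scope.

(** On each homogeneous degree there is a linear map [V] on polynomials determined by the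
    Euler-type recursion
    [(n + gamma) V p - sum_a kappa_a (V p) o sigma_a = sum_j x_j V (d_j p)],
    and a contraction argument shows that its solutions are unique and bounded by
    [|x|^n].  The Taylor coefficients of [s |-> E(s x, y)] satisfy the same recursion, hence
    [E(x, y) = sum_n V(<., y>^n)(x) / n!].  Comparing coefficients in [T_j E = y_j E] and
    polarizing yields [T_j V = V d_j], so it remains to prove that the operator of the theorem
    is [V].

    By symmetry of the coefficients, [E(i y, z)] is the transform [Ft lam] at [y] of the
    functional [lam p = V p (z)], and [K(i y, z) = exp(-Delta/2) (Ft lam) (y)].  For
    [lam] the evaluation at [x] one gets [K = exp(|x|^2/2) exp(i <x, y>)], and Fourier inversion
    for [p(x) exp(-|x|^2/2)] gives [lam p].  Both sides are linear and continuous in [lam] for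
    functionals of geometric growth, and the evaluations determine such maps by uniqueness
    of power series; so the identity holds for all these [lam]. *)

(** * Complex series *)

(** The kernel [E] is given only by complex differentiability and by an equation that contains a
    limit at the points of each reflecting hyperplane, so bounds and expansions must be extracted
    from the equation itself. What makes this possible is that the Euler operator has the diagonal
    coefficient [n + gamma] against reflection terms of total weight [gamma], and that reflections
    preserve Euclidean balls. As [kappa >= 0], the surplus [n] yields existence (through injectivity
    in finite dimension), uniqueness, growth with constant 1 and Lipschitz estimates by one and the
    same supremum argument.

    The Lipschitz estimates matter because [T_j] has to pass through the series of [E], both in the
    partial derivative and in the reflection quotient extended to the hyperplane: they give
    majorants [C D^n / n!] that are uniform along these limits.

    On the Fourier side no expression of [V p (z)] as an average of values of [p] is at hand. The
    bound by [|z|^n] replaces it: it puts [p |-> V p (z)] in a class of functionals in which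
    evaluations determine every continuous linear map. *)

Section ComplexModulus.
Variable R : realType.
Implicit Types (z w : Cx R) (t : R).

Definition cabs z : R := Normc.normc z.

Lemma CxE z w : complex.Re z = complex.Re w -> complex.Im z = complex.Im w -> z = w.
Proof. by case: z w => [a b] [c d] /= -> ->. Qed.

Lemma cabsE z : cabs z = Num.sqrt (complex.Re z ^+ 2 + complex.Im z ^+ 2).
Proof. by case: z. Qed.

Lemma cabs_ge0 z : 0 <= cabs z.
Proof. by rewrite cabsE sqrtr_ge0. Qed.

Lemma cabsM z w : cabs (z * w) = cabs z * cabs w.
Proof. exact: Normc.normcM. Qed.

Lemma cabs0 : cabs 0 = 0. Proof. exact: Normc.normc0. Qed.
Lemma cabs1 : cabs 1 = 1. Proof. exact: Normc.normc1. Qed.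

Lemma cabsV z : cabs z^-1 = (cabs z)^-1.
Proof. exact: Normc.normcV. Qed.

Lemma cabsN z : cabs (- z) = cabs z.
Proof. by case: z => a b; rewrite !cabsE /= !sqrrN. Qed.

Lemma normC_cabs z : `|z| = RC (cabs z).
Proof. by rewrite cabsE /RC; exact: normc_def. Qed.

Lemma cabsD z w : cabs (z + w) <= cabs z + cabs w.
Proof. exact: (@le_normcD R). Qed.

Lemma cabsB z w : cabs (z - w) <= cabs z + cabs w.
Proof. by rewrite (le_trans (cabsD _ _))// cabsN. Qed.

Lemma cabs_eq0 z : cabs z = 0 -> z = 0.
Proof. exact: Normc.eq0_normc. Qed.

Lemma cabsX z n : cabs (z ^+ n) = cabs z ^+ n.
Proof. by elim: n => [|n ih]; rewrite ?expr0 ?cabs1// !exprS cabsM ih. Qed.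

Lemma cabs_sum (I : Type) (r : seq I) (P : pred I) (F : I -> Cx R) :
  cabs (\sum_(i <- r | P i) F i) <= \sum_(i <- r | P i) cabs (F i).
Proof.
elim/big_ind2 : _ => [|x a y b xa yb|//]; first by rewrite cabs0.
by rewrite (le_trans (cabsD _ _))// lerD.
Qed.

Lemma cabs_distC z w : cabs (z - w) = cabs (w - z).
Proof. by rewrite -cabsN opprB. Qed.

Lemma cabsRC t : cabs (RC t) = `|t|.
Proof. by rewrite cabsE /= expr0n addr0 sqrtr_sqr. Qed.

Lemma cabsIC t : cabs (IC t) = `|t|.
Proof. by rewrite cabsE /= expr0n add0r sqrtr_sqr. Qed.

Lemma cabs_expi t : cabs (expi t) = 1.
Proof. by rewrite cabsE /= cos2Dsin2 sqrtr1. Qed.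

Lemma Re_le_cabs z : `|complex.Re z| <= cabs z.
Proof. by rewrite cabsE -sqrtr_sqr ler_wsqrtr// lerDl sqr_ge0. Qed.

Lemma Im_le_cabs z : `|complex.Im z| <= cabs z.
Proof. by rewrite cabsE -sqrtr_sqr ler_wsqrtr// lerDr sqr_ge0. Qed.

Lemma cabs_le_ReIm z : cabs z <= `|complex.Re z| + `|complex.Im z|.
Proof.
have -> : z = RC (complex.Re z) + IC (complex.Im z).
  by case: z => a b; apply: CxE; rewrite /= ?addr0 ?add0r.
by rewrite (le_trans (cabsD _ _))// cabsRC cabsIC /= addr0 add0r.
Qed.

Lemma ReD z w : complex.Re (z + w) = complex.Re z + complex.Re w.
Proof. by case: z w => [a b] [c d]. Qed.
Lemma ImD z w : complex.Im (z + w) = complex.Im z + complex.Im w.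
Proof. by case: z w => [a b] [c d]. Qed.
Lemma ReN z : complex.Re (- z) = - complex.Re z.
Proof. by case: z. Qed.
Lemma ImN z : complex.Im (- z) = - complex.Im z.
Proof. by case: z. Qed.
Lemma ReM z w : complex.Re (z * w) =
  complex.Re z * complex.Re w - complex.Im z * complex.Im w.
Proof. by case: z w => [a b] [c d]. Qed.
Lemma ImM z w : complex.Im (z * w) =
  complex.Re z * complex.Im w + complex.Im z * complex.Re w.
Proof. by case: z w => [a b] [c d]. Qed.

Lemma Re_sum (I : Type) (r : seq I) (P : pred I) (F : I -> Cx R) :
  complex.Re (\sum_(i <- r | P i) F i) = \sum_(i <- r | P i) complex.Re (F i).
Proof. by apply: (big_morph _ ReD). Qed.
Lemma Im_sum (I : Type) (r : seq I) (P : pred I) (F : I -> Cx R) :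
  complex.Im (\sum_(i <- r | P i) F i) = \sum_(i <- r | P i) complex.Im (F i).
Proof. by apply: (big_morph _ ImD). Qed.

Lemma RCD s t : RC (s + t) = RC s + RC t :> Cx R.
Proof. by apply: CxE => //=; rewrite addr0. Qed.
Lemma RCN t : RC (- t) = - RC t :> Cx R.
Proof. by apply: CxE => //=; rewrite oppr0. Qed.
Lemma RCB s t : RC (s - t) = RC s - RC t :> Cx R.
Proof. by rewrite RCD RCN. Qed.
Lemma RCM s t : RC (s * t) = RC s * RC t :> Cx R.
Proof. by apply: CxE => /=; ring. Qed.
Lemma RC0 : RC 0 = 0 :> Cx R. Proof. by []. Qed.
Lemma RC1 : RC 1 = 1 :> Cx R. Proof. by []. Qed.
Lemma RC_eq0 t : (RC t == 0 :> Cx R) = (t == 0).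
Proof. by rewrite eq_complex /= eqxx andbT. Qed.
Lemma RCV t : RC t^-1 = (RC t)^-1 :> Cx R.
Proof.
have [->|t0] := eqVneq t 0; first by rewrite invr0 RC0 invr0.
apply: (mulfI (_ : RC t != 0)); first by rewrite RC_eq0.
by rewrite -RCM !divff ?RC_eq0.
Qed.
Lemma RCX t n : RC (t ^+ n) = RC t ^+ n :> Cx R.
Proof. by elim: n => [//|n ih]; rewrite !exprS RCM ih. Qed.
Lemma RC_sum (I : Type) (r : seq I) (P : pred I) (F : I -> R) :
  RC (\sum_(i <- r | P i) F i) = \sum_(i <- r | P i) RC (F i) :> Cx R.
Proof. by apply: (big_morph _ RCD). Qed.
Lemma RC_prod (I : Type) (r : seq I) (P : pred I) (F : I -> R) :
  RC (\prod_(i <- r | P i) F i) = \prod_(i <- r | P i) RC (F i) :> Cx R.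
Proof. by apply: (big_morph _ RCM). Qed.
Lemma RC_inj : injective (@RC R). Proof. by move=> s t [->]. Qed.
Lemma ICE t : IC t = IC 1 * RC t :> Cx R.
Proof. by apply: CxE => /=; ring. Qed.
Lemma sqrIC1 : IC 1 * IC 1 = -1 :> Cx R.
Proof. by apply: CxE => /=; ring. Qed.

Lemma expi0 : expi 0 = 1 :> Cx R.
Proof. by apply: CxE; rewrite /= ?cos0 ?sin0. Qed.
Lemma expiD s t : expi (s + t) = expi s * expi t :> Cx R.
Proof. by apply: CxE => /=; rewrite ?cosD ?sinD; ring. Qed.
Lemma expi_sum (I : Type) (r : seq I) (P : pred I) (F : I -> R) :
  expi (\sum_(i <- r | P i) F i) = \prod_(i <- r | P i) expi (F i) :> Cx R.
Proof. by apply: (big_morph _ expiD); rewrite expi0. Qed.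
Lemma expiMn t n : expi (t *+ n) = expi t ^+ n :> Cx R.
Proof. by elim: n => [|n ih]; rewrite ?expi0// mulrS expiD ih exprS. Qed.

(** The norm of [Cx R] takes its values in [Cx R], whose positive elements are the positive reals.
    Passing to [cabs] turns convergence into a statement on real numbers, where squeezing
    applies. *)
Lemma cvgC_cabs (T : Type) (F : set_system T) {FF : Filter F} (f : T -> Cx R) l :
  (f @ F --> l) <-> (cabs (f t - l) @[t --> F] --> (0 : R)).
Proof.
split.
- move=> /cvgrPdist_lt h; apply/cvgrPdist_lt => e e0.
  have e0' : 0 < RC e :> R[i] by rewrite ltcR.
  have := h _ e0'; apply: filterS => t H.
  rewrite sub0r normrN ger0_norm ?cabs_ge0// cabs_distC.
  have : RC (cabs (l - f t)) < RC e :> R[i] by rewrite -normC_cabs.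
  by rewrite ltcR.
- move=> /cvgrPdist_lt h; apply/cvgrPdist_lt => e e0.
  have eE : e = RC (complex.Re e).
    by have /complex_realP[k ->] := gtr0_real e0.
  have e0' : 0 < complex.Re e by rewrite eE in e0; rewrite ltcR in e0.
  have := h _ e0'; apply: filterS => t.
  rewrite sub0r normrN ger0_norm ?cabs_ge0// => H.
  by rewrite eE normC_cabs ltcR cabs_distC.
Qed.

End ComplexModulus.

Section ComplexSeries.
Variable R : realType.
Implicit Types (z : Cx R) (u v a : nat -> Cx R) (w : nat -> R).

Lemma cvgC_lim (T : Type) (F : set_system T) {FF : ProperFilter F} (f : T -> Cx R) (l : Cx R) :
  f @ F --> l -> lim (f @ F) = l.
Proof. exact: (cvg_lim (@norm_hausdorff _ (Cx R))). Qed.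

Lemma cvgC_unique (T : Type) (F : set_system T) {FF : ProperFilter F}
    (f : T -> Cx R) (k l : Cx R) : f @ F --> k -> f @ F --> l -> k = l.
Proof. by move=> /cvgC_lim <- /cvgC_lim <-. Qed.

Lemma cvgC_ReIm (T : Type) (F : set_system T) {FF : Filter F} (f : T -> Cx R) (l : Cx R) :
  complex.Re (f t) @[t --> F] --> complex.Re l ->
  complex.Im (f t) @[t --> F] --> complex.Im l -> f @ F --> l.
Proof.
move=> fr fi; apply/cvgC_cabs.
apply: (@squeeze_cvgr _ _ _ _ (fun=> 0) (fun t => `|complex.Re (f t) - complex.Re l|
   + `|complex.Im (f t) - complex.Im l|)).
- apply: nearW => t; rewrite cabs_ge0/= (le_trans (cabs_le_ReIm _))//.
  by rewrite !ReD !ImD !ReN !ImN.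
- exact: cvg_cst.
- rewrite -[X in _ --> X]addr0; apply: cvgD; apply/norm_cvg0P/subr_cvg0.
  + exact: fr.
  + exact: fi.
Qed.

Lemma cvgC_Re (T : Type) (F : set_system T) {FF : Filter F} (f : T -> Cx R) (l : Cx R) :
  f @ F --> l -> complex.Re (f t) @[t --> F] --> complex.Re l.
Proof.
move=> /cvgC_cabs fl; apply/subr_cvg0/norm_cvg0P.
apply: (@squeeze_cvgr _ _ _ _ (fun=> 0) _ _ _ _ _ fl); last exact: cvg_cst.
apply: nearW => t; rewrite normr_ge0/= (le_trans _ (Re_le_cabs _))//.
by rewrite ReD ReN.
Qed.

Lemma cvgC_Im (T : Type) (F : set_system T) {FF : Filter F} (f : T -> Cx R) (l : Cx R) :
  f @ F --> l -> complex.Im (f t) @[t --> F] --> complex.Im l.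
Proof.
move=> /cvgC_cabs fl; apply/subr_cvg0/norm_cvg0P.
apply: (@squeeze_cvgr _ _ _ _ (fun=> 0) _ _ _ _ _ fl); last exact: cvg_cst.
apply: nearW => t; rewrite normr_ge0/= (le_trans _ (Im_le_cabs _))//.
by rewrite ImD ImN.
Qed.

Lemma cvgC_cabs_le (T : Type) (F : set_system T) {FF : ProperFilter F}
    (f : T -> Cx R) (l : Cx R) M :
  f @ F --> l -> (\forall t \near F, cabs (f t) <= M) -> cabs l <= M.
Proof.
move=> /cvgC_cabs fl fM; rewrite -subr_le0.
apply: (cvgr_to_ge fl); apply: filterS fM => t ftM.
rewrite lerBlDl (le_trans _ (lerD ftM (lexx _)))//.
by rewrite -[X in cabs X <= _](subrKC (f t)) (le_trans (cabsD _ _))// lerD2l cabs_distC.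
Qed.

Definition psum u N : Cx R := \sum_(n < N) u n.
Definition csum u : Cx R := limn (psum u).
(** A series is carried together with an explicit real majorant, so that sums, multiples and limits
    of series are handled by tracking majorants. *)
Definition dominated u w := (forall n, cabs (u n) <= w n) /\ cvgn (series w).

Lemma psum_cvg u w : dominated u w -> psum u @ \oo --> csum u.
Proof.
move=> [uw cw].
have w0 n : 0 <= w n by rewrite (le_trans (cabs_ge0 _) (uw n)).
have cv (f : nat -> R) : (forall n, `|f n| <= cabs (u n)) -> cvgn (series f).
  move=> fu; apply: normed_cvg; apply: (@series_le_cvg _ _ w) => // n.
    exact: normr_ge0.
  exact: le_trans (fu n) (uw n).
have /cvg_ex[/= a fa] := cv _ (fun n => Re_le_cabs (u n)).
have /cvg_ex[/= b fb] := cv _ (fun n => Im_le_cabs (u n)).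
suff h : psum u @ \oo --> (Complex a b : Cx R) by rewrite /csum (cvgC_lim h).
apply: cvgC_ReIm => /=.
- rewrite (_ : (fun _ => _) = series (fun n => complex.Re (u n)))//.
  by apply/funext => N; rewrite seriesEord/= Re_sum.
- rewrite (_ : (fun _ => _) = series (fun n => complex.Im (u n)))//.
  by apply/funext => N; rewrite seriesEord/= Im_sum.
Qed.

Lemma csum_eq u l : psum u @ \oo --> l -> csum u = l.
Proof. exact: cvgC_lim. Qed.

Lemma csum_tail u w N : dominated u w ->
  cabs (csum u - psum u N) <= limn (series w) - series w N.
Proof.
move=> uw; have [u_w cw] := uw.
have w0 n : 0 <= w n by rewrite (le_trans (cabs_ge0 _) (u_w n)).
apply: (@cvgC_cabs_le _ \oo _ (fun k => psum u k - psum u N)).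
  by apply: cvgB; [exact: psum_cvg uw|exact: cvg_cst].
near=> k.
have Nk : (N <= k)%N by near: k; exact: nbhs_infty_ge.
apply: (@le_trans _ _ (series w k - series w N)); last first.
  rewrite lerD2r; apply: nondecreasing_cvgn_le => //.
  exact: nondecreasing_series.
rewrite sub_series_geq// /psum -!(big_mkord xpredT u) [in X in cabs X](big_cat_nat (leq0n N) Nk)/=.
rewrite addrAC subrr add0r (le_trans (cabs_sum _ _ _))//.
by apply: ler_sum.
Unshelve. all: by end_near.
Qed.

Lemma cabs_csum u w : dominated u w -> cabs (csum u) <= limn (series w).
Proof.
by move=> /(csum_tail 0); rewrite /psum big_ord0 /series/= big_nil !subr0.
Qed.

Lemma dominatedD u v w1 w2 : dominated u w1 -> dominated v w2 ->
  dominated (fun n => u n + v n) (fun n => w1 n + w2 n).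
Proof.
move=> [uw cw1] [vw cw2]; split; last exact: is_cvg_seriesD.
by move=> n; rewrite (le_trans (cabsD _ _))// lerD.
Qed.

Lemma dominatedZ u w z : dominated u w ->
  dominated (fun n => z * u n) (fun n => cabs z * w n).
Proof.
move=> [uw cw]; split; last exact: (@is_cvg_seriesZ R).
by move=> n; rewrite cabsM ler_wpM2l// cabs_ge0.
Qed.

Lemma csumD u v w1 w2 : dominated u w1 -> dominated v w2 ->
  csum (fun n => u n + v n) = csum u + csum v.
Proof.
move=> uw vw; apply: csum_eq.
rewrite (_ : psum _ = (fun N => psum u N + psum v N)).
  by apply: cvgD; [exact: psum_cvg uw|exact: psum_cvg vw].
by apply/funext => N; rewrite /psum big_split.
Qed.

Lemma csumZ u w z : dominated u w -> csum (fun n => z * u n) = z * csum u.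
Proof.
move=> uw; apply: csum_eq.
rewrite (_ : psum _ = (fun N => z * psum u N)).
  by apply: cvgM; [exact: cvg_cst|exact: psum_cvg uw].
by apply/funext => N; rewrite /psum mulr_sumr.
Qed.

(** Dominated convergence for series: the tails of [w] bound the tails of all the series uniformly
    in [t], and a partial sum of fixed length converges termwise. *)
Lemma tannery (T : Type) (F : set_system T) {FF : ProperFilter F}
    (u : nat -> T -> Cx R) v w :
  (forall n, u n @ F --> v n) ->
  (\forall t \near F, forall n, cabs (u n t) <= w n) -> cvgn (series w) ->
  csum (u ^~ t) @[t --> F] --> csum v.
Proof.
move=> uv uw cw.
have vw : dominated v w.
  by split=> // n; apply: (cvgC_cabs_le (uv n)); apply: filterS uw => t; exact.
apply/cvgC_cabs/cvgrPdist_lt => e e0.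
(* Two tails and one difference of partial sums contribute less than [e / 4] each. *)
have [N _ Ntail] : \forall N \near \oo, `|limn (series w) - series w N| < e / 4.
  by move/cvgrPdist_lt: cw; apply; rewrite divr_gt0.
have tailN := le_lt_trans (ler_norm _) (Ntail _ (leqnn N)).
have /cvgC_cabs/cvgrPdist_lt/(_ (e / 4)) : psum (u ^~ t) N @[t --> F] --> psum v N.
  elim: N {Ntail tailN} => [|N ihN].
    by rewrite /psum big_ord0; under eq_fun do rewrite big_ord0; exact: cvg_cst.
  rewrite /psum big_ord_recr/=; under eq_fun do rewrite big_ord_recr/=.
  by apply: cvgD; [exact: ihN|exact: uv].
rewrite divr_gt0// => /(_ isT) hN.
near=> t.
have tw : dominated (u ^~ t) w by split=> //; near: t.
rewrite sub0r normrN ger0_norm ?cabs_ge0//.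
have h1 := csum_tail N tw; have h2 := csum_tail N vw.
have h3 : cabs (psum (u ^~ t) N - psum v N) < e / 4.
  have : `|0 - cabs (psum (u ^~ t) N - psum v N)| < e / 4 by near: t.
  by rewrite sub0r normrN ger0_norm ?cabs_ge0.
have -> : csum (u ^~ t) - csum v = (csum (u ^~ t) - psum (u ^~ t) N)
  + (psum (u ^~ t) N - psum v N) - (csum v - psum v N) by ring.
have := cabsB ((csum (u ^~ t) - psum (u ^~ t) N) + (psum (u ^~ t) N - psum v N))
  (csum v - psum v N).
have := cabsD (csum (u ^~ t) - psum (u ^~ t) N) (psum (u ^~ t) N - psum v N).
lra.
Unshelve. all: by end_near.
Qed.

(* Letting [s] tend to [0] isolates the first nonzero coefficient. *)
Lemma power_series_eq0 a M : (forall n, cabs (a n) <= M) ->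
  (forall s : R, 0 < s <= 1 / 2 -> csum (fun n => a n * RC s ^+ n) = 0) ->
  forall n, a n = 0.
Proof.
move=> aM a0 n; elim/ltn_ind: n => n ih; apply: cabs_eq0.
have M0 : 0 <= M by rewrite (le_trans (cabs_ge0 _) (aM 0%N)).
apply/eqP; rewrite eq_le cabs_ge0 andbT.
apply/ler_addgt0Pr => e e0; rewrite add0r.
(* Once the lower coefficients vanish, the tail estimate gives [|a n| <= M s / (1 - s)]. This is at
   most [2 M s] for [s <= 1/2], hence at most [e] by the second bound on [s]. *)
pose s := Num.min (1 / 2) (e / (2 * M + 1)).
have s0 : 0 < s by rewrite lt_min !divr_gt0// ltr_wpDl// mulr_ge0.
have s12 : s <= 1 / 2 by rewrite ge_min lexx.
have sM : s * (2 * M + 1) <= e.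
  by rewrite -ler_pdivlMr ?ltr_wpDl ?mulr_ge0// ge_min lexx orbT.
have s1 : `|s| < 1 by rewrite gtr0_norm//; lra.
have dom : dominated (fun n => a n * RC s ^+ n) (geometric M s).
  split; last exact: is_cvg_geometric_series.
  move=> k; rewrite /geometric/= cabsM cabsX cabsRC gtr0_norm//.
  by rewrite ler_wpM2r// exprn_ge0// ltW.
have := csum_tail n.+1 dom; rewrite a0 ?s0//.
have -> : psum (fun n => a n * RC s ^+ n) n.+1 = a n * RC s ^+ n.
  rewrite /psum big_ord_recr/= big1 ?add0r// => i _.
  by rewrite ih// mul0r.
rewrite sub0r cabsN cabsM cabsX cabsRC gtr0_norm//.
have -> : limn (series (geometric M s)) = M / (1 - s).
  by apply/cvg_lim => //; exact: cvg_geometric_series.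
rewrite geometric_seriesE; last by rewrite lt_eqF//; lra.
rewrite /= (_ : _ - _ = M * s / (1 - s) * s ^+ n); last first.
  by rewrite exprS; field; lra.
rewrite ler_pM2r ?exprn_gt0// => /le_trans; apply; apply: le_trans sM.
rewrite ler_pdivrMr; last lra.
have : s * M <= 1 / 2 * M by rewrite ler_wpM2r.
by nra.
Qed.

End ComplexSeries.

(** * Power series expansion of entire functions *)

Section Bisection.
Variable R : realType.

(* Goursat's subdivision argument: a rectangle function that is subadditive under
   cutting into four and of smaller order than the area near each point is null. *)
Lemma goursat_bisection (N : R -> R -> R -> R -> R) :
  (forall a m b c k d : R, a <= m <= b -> c <= k <= d ->
     N a b c d <= N a m c k + N m b c k + N a m k d + N m b k d) ->
  (forall x y e : R, 0 < e -> exists2 r : R, 0 < r & forall a b c d : R,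
     a <= x <= b -> c <= y <= d -> b - a <= r -> d - c <= r ->
     N a b c d <= e * ((b - a) + (d - c)) ^+ 2) ->
  forall a b c d, a <= b -> c <= d -> N a b c d <= 0.
Proof.
move=> Nsub Nloc a b c d ab cd; rewrite leNgt; apply/negP => N0.
pose NN (q : R * R * R * R) := let: (a, b, c, d) := q in N a b c d.
(* The step keeps a quarter that carries at least a fourth of the current value; if the first three
   fail the test, subadditivity forces the last one to pass it. *)
pose step (q : R * R * R * R) := let: (a, b, c, d) := q in
  let m := (a + b) / 2 in let k := (c + d) / 2 in
  if N a b c d <= 4 * N a m c k then (a, m, c, k) else
  if N a b c d <= 4 * N m b c k then (m, b, c, k) else
  if N a b c d <= 4 * N a m k d then (a, m, k, d) else (m, b, k, d).
pose Q n := iter n step (a, b, c, d).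
pose A n := (Q n).1.1.1; pose B n := (Q n).1.1.2.
pose C n := (Q n).1.2; pose D n := (Q n).2.
have QE n : Q n = (A n, B n, C n, D n) by rewrite /A /B /C /D; case: (Q n) => [[[]]].
have step_spec n : [/\ A n <= B n, C n <= D n, A n <= A n.+1, B n.+1 <= B n &
    [/\ C n <= C n.+1, D n.+1 <= D n, B n.+1 - A n.+1 = (B n - A n) / 2,
    D n.+1 - C n.+1 = (D n - C n) / 2 & NN (Q n) <= 4 * NN (Q n.+1)]].
  have h : A n <= B n /\ C n <= D n -> [/\ A n <= B n, C n <= D n, A n <= A n.+1, B n.+1 <= B n &
    [/\ C n <= C n.+1, D n.+1 <= D n, B n.+1 - A n.+1 = (B n - A n) / 2,
    D n.+1 - C n.+1 = (D n - C n) / 2 & NN (Q n) <= 4 * NN (Q n.+1)]].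
    move=> [An Cn].
    have QS : Q n.+1 = step (Q n) by [].
    rewrite /A /B /C /D QS (QE n) /= -/(A n) -/(B n) -/(C n) -/(D n).
    have := Nsub (A n) ((A n + B n) / 2) (B n) (C n) ((C n + D n) / 2) (D n).
    move=> /(_ ltac:(lra) ltac:(lra)).
    case: ifPn => [h1|h1] /=; first by move=> _; do ![split=> //]; lra.
    case: ifPn => [h2|h2] /=; first by move=> _; do ![split=> //]; lra.
    case: ifPn => [h3|h3] /=; first by move=> _; do ![split=> //]; lra.
    by rewrite -!ltNge in h1 h2 h3; move=> hh; do ![split=> //]; lra.
  apply: h; elim: n => [//|n [hA hC]].
  have QS : Q n.+1 = step (Q n) by [].
  rewrite /A /B /C /D QS (QE n) /= -/(A n) -/(B n) -/(C n) -/(D n).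
  by do 3 (case: ifP => _ /=; first by split; lra); split; lra.
have size n : B n - A n = (b - a) / 2 ^+ n /\ D n - C n = (d - c) / 2 ^+ n.
  elim: n => [|n [ih1 ih2]]; first by rewrite expr0 !divr1.
  have [_ _ _ _ [_ _ -> -> _]] := step_spec n.
  by rewrite ih1 ih2 !exprS !invfM -!mulrA [2^-1 * _]mulrC.
have N4 n : N a b c d <= 4 ^+ n * NN (Q n).
  elim: n => [|n ih]; first by rewrite expr0 mul1r.
  have [_ _ _ _ [_ _ _ _ h]] := step_spec n.
  by rewrite exprSr -mulrA (le_trans ih)// ler_wpM2l// exprn_ge0.
have nest (U W : nat -> R) : (forall n, U n <= W n) -> (forall n, U n <= U n.+1) ->
    (forall n, W n.+1 <= W n) -> exists x, forall n, U n <= x <= W n.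
  move=> hUW hU hW.
  have mU i j : (i <= j)%N -> U i <= U j by apply: (@homo_leq _ U (fun x y => x <= y)) => // x y z; exact: le_trans.
  have mW i j : (i <= j)%N -> W j <= W i.
    by apply: (@homo_leq _ W (fun x y => y <= x)) => // x y z xy yz; exact: le_trans xy.
  have ub n : ubound (range U) (W n).
    move=> _ [k _ <-]; rewrite (le_trans (mU _ _ (leq_maxl k n)))//.
    by rewrite (le_trans (hUW _))// mW// leq_maxr.
  exists (sup (range U)) => n; apply/andP; split.
    by apply: ub_le_sup; [exists (W 0%N); exact: ub|exists n].
  by apply: ge_sup; [exists (U 0%N); exists 0%N|exact: ub].
have [x hx] : exists x, forall n, A n <= x <= B n.
  by apply: nest => n; have [] := step_spec n.
have [y hy] : exists x, forall n, C n <= x <= D n.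
  by apply: nest => n; have [? ? ? ? []] := step_spec n.
set H := (b - a) + (d - c).
have H0 : 0 <= H by rewrite /H; lra.
(* The factor [4 ^+ n] lost in the subdivision is compensated by the square of the halved size,
   which leaves [N <= e * H ^+ 2]; this [e] makes the right side smaller than [N]. *)
pose e := N a b c d / (2 * (H ^+ 2 + 1)).
have H21 : 0 < H ^+ 2 + 1 by rewrite ltr_wpDl// sqr_ge0.
have e0 : 0 < e by rewrite divr_gt0// mulr_gt0.
have [r r0 hr] := Nloc x y e e0.
have [n hn] : exists n, H / 2 ^+ n <= r.
  have [n hn] : exists n : nat, H / r <= n%:R.
    exists (Num.truncn (H / r)).+1; apply/ltW.
    by have /truncn_itv/andP[] : 0 <= H / r by rewrite divr_ge0// ltW.
  exists n; rewrite ler_pdivrMr ?exprn_gt0//.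
  rewrite -ler_pdivrMl// mulrC (le_trans hn)// -natrX ler_nat.
  by rewrite ltnW// ltn_expl.
have [s1 s2] := size n.
have hN : NN (Q n) <= e * (H / 2 ^+ n) ^+ 2.
  rewrite (QE n) /= (le_trans (hr _ _ _ _ (hx n) (hy n) _ _))//.
  - by rewrite s1 (le_trans _ hn)// ler_wpM2r ?invr_ge0 ?exprn_ge0// lerDl; lra.
  - by rewrite s2 (le_trans _ hn)// ler_wpM2r ?invr_ge0 ?exprn_ge0// lerDr; lra.
  - by rewrite s1 s2 -mulrDl.
have := N4 n; apply/negP; rewrite -ltNge.
have p4 : 0 < 4 ^+ n :> R by rewrite exprn_gt0.
apply: (@le_lt_trans _ _ (4 ^+ n * (e * (H / 2 ^+ n) ^+ 2))).
  by rewrite ler_pM2l.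
have -> : 4 ^+ n * (e * (H / 2 ^+ n) ^+ 2) = e * H ^+ 2.
  rewrite expr_div_n -exprM mulnC exprM.
  have -> : (2 ^+ 2 : R) = 4 by ring.
  by field; rewrite lt0r_neq0.
have : e * (2 * (H ^+ 2 + 1)) = N a b c d by rewrite mulfVK// lt0r_neq0// mulr_gt0.
have : 0 <= e * H ^+ 2 by rewrite mulr_ge0 ?sqr_ge0// ltW.
lra.
Qed.

End Bisection.

(** * Integrals of complex functions of a real variable *)

Section ComplexIntegral.
Variable R : realType.
Notation mu := (@lebesgue_measure R).
Implicit Types (D : set R) (f g : R -> Cx R).

Definition cintD D f : Cx R :=
  Complex (Rintegral mu D (fun t => complex.Re (f t)))
          (Rintegral mu D (fun t => complex.Im (f t))).

Definition cintegrable D f :=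
  mu.-integrable D (EFin \o (fun t => complex.Re (f t))) /\
  mu.-integrable D (EFin \o (fun t => complex.Im (f t))).

Lemma cintegrableD D f g : measurable D -> cintegrable D f -> cintegrable D g ->
  cintegrable D (fun t => f t + g t).
Proof.
move=> mD [f1 f2] [g1 g2]; split.
- rewrite (_ : EFin \o _ = (EFin \o (fun t => complex.Re (f t))) \+
      (EFin \o (fun t => complex.Re (g t))))%E; first exact: integrableD.
  by apply/funext => t /=; rewrite ReD EFinD.
- rewrite (_ : EFin \o _ = (EFin \o (fun t => complex.Im (f t))) \+
      (EFin \o (fun t => complex.Im (g t))))%E; first exact: integrableD.
  by apply/funext => t /=; rewrite ImD EFinD.
Qed.

Lemma integrable_lin D (p q : R) (u v : R -> R) : measurable D ->
  mu.-integrable D (EFin \o u) -> mu.-integrable D (EFin \o v) ->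
  mu.-integrable D (EFin \o (fun t => p * u t + q * v t)).
Proof.
move=> mD iu iv.
rewrite (_ : EFin \o _ = (fun t => p%:E * (EFin \o u) t) \+
   (fun t => q%:E * (EFin \o v) t))%E; last first.
  by apply/funext => t /=; rewrite EFinD !EFinM.
by apply: integrableD => //; exact: integrableZl.
Qed.

Lemma Rintegral_lin D (p q : R) (u v : R -> R) : measurable D ->
  mu.-integrable D (EFin \o u) -> mu.-integrable D (EFin \o v) ->
  Rintegral mu D (fun t => p * u t + q * v t) =
  p * Rintegral mu D u + q * Rintegral mu D v.
Proof.
move=> mD iu iv; rewrite RintegralD//.
- by rewrite !RintegralZl.
- rewrite (_ : EFin \o _ = (fun t => p%:E * (EFin \o u) t))%E; first exact: integrableZl.
  by apply/funext => t /=; rewrite EFinM.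
- rewrite (_ : EFin \o _ = (fun t => q%:E * (EFin \o v) t))%E; first exact: integrableZl.
  by apply/funext => t /=; rewrite EFinM.
Qed.

Lemma cintegrableZ D f (c : Cx R) : measurable D -> cintegrable D f ->
  cintegrable D (fun t => c * f t).
Proof.
move=> mD [f1 f2]; split.
- rewrite (_ : (fun _ => _) = fun t => complex.Re c * complex.Re (f t) +
    (- complex.Im c) * complex.Im (f t)); first exact: integrable_lin.
  by apply/funext => t; rewrite ReM mulNr.
- rewrite (_ : (fun _ => _) = fun t => complex.Re c * complex.Im (f t) +
    complex.Im c * complex.Re (f t)); first exact: integrable_lin.
  by apply/funext => t; rewrite ImM.
Qed.

Lemma cintDD D f g : measurable D -> cintegrable D f -> cintegrable D g ->
  cintD D (fun t => f t + g t) = cintD D f + cintD D g.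
Proof.
move=> mD [f1 f2] [g1 g2]; apply: CxE; rewrite ?ReD ?ImD /=.
- rewrite -RintegralD//; apply: eq_Rintegral => t _; exact: ReD.
- rewrite -RintegralD//; apply: eq_Rintegral => t _; exact: ImD.
Qed.

Lemma cintDZ D f (c : Cx R) : measurable D -> cintegrable D f ->
  cintD D (fun t => c * f t) = c * cintD D f.
Proof.
move=> mD [f1 f2]; apply: CxE; rewrite ?ReM ?ImM /=.
- rewrite -mulNr -Rintegral_lin//; apply: eq_Rintegral => t _.
  by rewrite ReM mulNr.
- by rewrite -Rintegral_lin//; apply: eq_Rintegral => t _; rewrite ImM.
Qed.

Lemma cintDB D f g : measurable D -> cintegrable D f -> cintegrable D g ->
  cintD D (fun t => f t - g t) = cintD D f - cintD D g.
Proof.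
move=> mD fi gi; rewrite -[- cintD D g]mulN1r -cintDZ// -cintDD//.
  by congr cintD; apply/funext => t; rewrite mulN1r.
exact: cintegrableZ.
Qed.

Lemma cintegrableB D f g : measurable D -> cintegrable D f -> cintegrable D g ->
  cintegrable D (fun t => f t - g t).
Proof.
move=> mD fi gi; rewrite (_ : (fun _ => _) = fun t => f t + (-1) * g t).
  by apply: cintegrableD => //; exact: cintegrableZ.
by apply/funext => t; rewrite mulN1r.
Qed.

Lemma Rintegral_le_abs D (u v : R -> R) : measurable D ->
  mu.-integrable D (EFin \o u) -> mu.-integrable D (EFin \o v) ->
  (forall t, D t -> `|u t| <= v t) -> `|Rintegral mu D u| <= Rintegral mu D v.
Proof.
move=> mD iu iv uv; apply: le_trans; first exact: le_normr_Rintegral.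
apply: le_Rintegral => //.
exact: integrable_abse iu.
Qed.

(** Real and imaginary parts are estimated separately, whence the factor 2. *)
Lemma cabs_cintD D f (v : R -> R) : measurable D -> cintegrable D f ->
  mu.-integrable D (EFin \o v) -> (forall t, D t -> cabs (f t) <= v t) ->
  cabs (cintD D f) <= 2 * Rintegral mu D v.
Proof.
move=> mD [f1 f2] iv fv; rewrite (le_trans (cabs_le_ReIm _))//= mulrDl !mul1r.
apply: lerD; apply: Rintegral_le_abs => // t Dt.
- exact: le_trans (Re_le_cabs _) (fv _ Dt).
- exact: le_trans (Im_le_cabs _) (fv _ Dt).
Qed.

Lemma continuous_ReC (f : R -> Cx R) : continuous f -> continuous (fun t => complex.Re (f t)).
Proof. by move=> cf t; apply: cvgC_Re; exact: cf. Qed.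

Lemma continuous_ImC (f : R -> Cx R) : continuous f -> continuous (fun t => complex.Im (f t)).
Proof. by move=> cf t; apply: cvgC_Im; exact: cf. Qed.

Lemma continuous_itv_integrable (u : R -> R) (a b : R) : continuous u ->
  mu.-integrable `[a, b] (EFin \o u).
Proof.
move=> cu; apply: continuous_compact_integrable; first exact: segment_compact.
exact: continuous_subspaceT.
Qed.

Lemma continuous_itv_cintegrable f (a b : R) : continuous f -> cintegrable `[a, b] f.
Proof.
move=> cf; split; apply: continuous_itv_integrable.
- exact: continuous_ReC.
- exact: continuous_ImC.
Qed.

(* Locked: conversion on integrals is expensive. *)
Fact cI_key : unit. Proof. exact: tt. Qed.
Definition cI := locked_with cI_key (fun (a b : R) f => cintD `[a, b] f).

Lemma cIE (a b : R) f : cI a b f = cintD `[a, b] f.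
Proof. by rewrite /cI unlock. Qed.

Lemma cID f g (a b : R) : continuous f -> continuous g ->
  cI a b (fun t => f t + g t) = cI a b f + cI a b g.
Proof.
by move=> cf cg; rewrite !cIE cintDD//; exact/continuous_itv_cintegrable.
Qed.

Lemma cIB f g (a b : R) : continuous f -> continuous g ->
  cI a b (fun t => f t - g t) = cI a b f - cI a b g.
Proof.
by move=> cf cg; rewrite !cIE cintDB//; exact/continuous_itv_cintegrable.
Qed.

Lemma cIZ f (a b : R) (c : Cx R) : continuous f ->
  cI a b (fun t => c * f t) = c * cI a b f.
Proof.
by move=> cf; rewrite !cIE cintDZ//; exact/continuous_itv_cintegrable.
Qed.

Lemma eq_cI f g (a b : R) : f =1 g -> cI a b f = cI a b g.
Proof. by move=> fg; congr cI; apply/funext. Qed.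

Lemma Rintegral_split (u : R -> R) (a c b : R) : continuous u -> a <= c <= b ->
  Rintegral mu `[a, b] u = Rintegral mu `[a, c] u + Rintegral mu `[c, b] u.
Proof.
move=> cu /andP[ac cb].
have /(@Rintegral_itvB R _ _ _ c) := @continuous_itv_integrable u a b cu.
rewrite !bnd_simp => /(_ ac cb) h.
apply/eqP; rewrite addrC -subr_eq h Rintegral_itv_obnd_cbnd//.
apply: (integrableS _ _ _ (@continuous_itv_integrable u c b cu)) => //.
by apply: subset_itvr; rewrite bnd_simp.
Qed.

Lemma cI_split f (a c b : R) : continuous f -> a <= c <= b -> cI a b f = cI a c f + cI c b f.
Proof.
move=> cf acb; rewrite !cIE; apply: CxE; rewrite ?ReD ?ImD /=; apply: Rintegral_split => //.
- exact: continuous_ReC.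
- exact: continuous_ImC.
Qed.

Lemma Rintegral_itv_cst (a b M : R) : a <= b ->
  Rintegral mu `[a, b] (fun=> M) = M * (b - a).
Proof.
move=> ab; rewrite Rintegral_cst//= lebesgue_measure_itv/= lte_fin.
by have [_||->] := ltgtP a b; rewrite ?subrr//; lra.
Qed.

Lemma cabs_cI f (a b M : R) : a <= b -> continuous f ->
  (forall t, a <= t <= b -> cabs (f t) <= M) -> cabs (cI a b f) <= 2 * M * (b - a).
Proof.
move=> ab cf fM; rewrite -mulrA -Rintegral_itv_cst// cIE.
apply: cabs_cintD => //; first exact: continuous_itv_cintegrable.
by apply: continuous_itv_integrable => ?; exact: cvg_cst.
Qed.

Lemma Rintegral_FTC (F u : R -> R) (a b : R) : a <= b -> continuous u ->
  (forall t : R, is_derive t (1 : R) F (u t)) -> Rintegral mu `[a, b] u = F b - F a.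
Proof.
rewrite le_eqVlt => /predU1P[-> _ _|ab cu Fu].
  by rewrite set_itv1 Rintegral_set1 subrr.
have cF : continuous F.
  by move=> t; apply/differentiable_continuous/derivable1_diffP; exact: ex_derive.
rewrite /Rintegral (@continuous_FTC2 _ u F)//.
- exact: continuous_subspaceT.
- split.
  + by move=> t _; exact: ex_derive.
  + by apply: cvg_at_right_filter; exact: cF.
  + by apply: cvg_at_left_filter; exact: cF.
- by move=> t _; rewrite derive1E; exact: derive_val.
Qed.

Lemma continuous_RC : continuous (@RC R : R -> Cx R).
Proof.
move=> t; apply: cvgC_ReIm => /=; first exact: cvg_id.
exact: cvg_cst.
Qed.

Lemma continuous_expi (c : R) : continuous (fun t => expi (c * t) : Cx R).
Proof.
have cc : continuous (fun t : R => c * t) by move=> t; apply: cvgM; [exact: cvg_cst|exact: cvg_id].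
move=> t; apply: cvgC_ReIm => /=.
- by apply: continuous_comp; [exact: cc|exact: continuous_cos].
- by apply: continuous_comp; [exact: cc|exact: continuous_sin].
Qed.

Lemma is_derive_scale (u : R -> R) (du : R -> R) (c t : R) :
  (forall t : R, is_derive t (1 : R) u (du t)) -> is_derive t (1 : R) (fun t => u (c * t)) (c * du (c * t)).
Proof.
move=> hu; have hc : is_derive t (1 : R) (fun t => c * t) c.
  by have := is_deriveZ c (is_derive_id t (1 : R)); rewrite [c *: _]mulr1.
have := @is_derive1_comp _ u (fun t => c * t) t (du (c * t)) c (hu _) hc.
by rewrite mulrC.
Qed.

Lemma cI_expi (a b c : R) : a <= b ->
  IC c * cI a b (fun t => expi (c * t)) = expi (c * b) - expi (c * a).
Proof.
move=> ab.
have cos' (t : R) : is_derive t (1 : R) (fun t => cos (c * t)) (c * - sin (c * t)).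
  exact: (@is_derive_scale cos (fun t => - sin t)).
have sin' (t : R) : is_derive t (1 : R) (fun t => sin (c * t)) (c * cos (c * t)).
  exact: (@is_derive_scale sin cos).
rewrite -cIZ; last exact: continuous_expi.
rewrite cIE.
have cI0 : continuous (fun t => IC c * expi (c * t) : Cx R).
  by move=> t; apply: cvgM; [exact: cvg_cst|exact: continuous_expi].
apply: CxE; rewrite ?ReD ?ReN ?ImD ?ImN /=.
- rewrite -(@Rintegral_FTC (fun t => cos (c * t)) (fun t => c * - sin (c * t)))//.
  + by apply: eq_Rintegral => t _; ring.
  + rewrite (_ : (fun _ => _) = (fun t => complex.Re (IC c * expi (c * t)))).
      exact: (continuous_ReC cI0).
    by apply/funext => t /=; ring.
- rewrite -(@Rintegral_FTC (fun t => sin (c * t)) (fun t => c * cos (c * t)))//.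
  + by apply: eq_Rintegral => t _; ring.
  + rewrite (_ : (fun _ => _) = (fun t => complex.Im (IC c * expi (c * t)))).
      exact: (continuous_ImC cI0).
    by apply/funext => t /=; ring.
Qed.

Lemma cI_expR (a b : R) (w : Cx R) : a <= b ->
  cI a b (fun t => RC (expR t) * w) = RC (expR b - expR a) * w.
Proof.
move=> ab.
have cRe : continuous (fun t => RC (expR t) : Cx R).
  by move=> t; apply: continuous_comp; [exact: continuous_expR|exact: continuous_RC].
rewrite (_ : (fun _ => _) = (fun t => w * RC (expR t))); last first.
  by apply/funext => t; rewrite mulrC.
rewrite cIZ// mulrC cIE; congr (_ * _); apply: CxE => /=.
- by apply: Rintegral_FTC => //; exact: continuous_expR.
- by rewrite Rintegral_itv_cst// mul0r.
Qed.

End ComplexIntegral.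

(** * Cauchy's formula on the circle of radius 2 *)

Section Taylor.
Variable R : realType.
Implicit Types (f : Cx R -> Cx R) (a : Cx R).

(** Increments instead of quotients: the point [w = s] needs no separate treatment, and the bound
    has the shape that Goursat's local estimate consumes. *)
Definition cdifferentiable f (s : Cx R) := exists d : Cx R, forall e : R, 0 < e ->
  exists2 r : R, 0 < r & forall w, cabs (w - s) <= r ->
    cabs (f w - f s - d * (w - s)) <= e * cabs (w - s).

Lemma cdifferentiable_cvg f (l : Cx R) (T : Type) (F : set_system T) {FF : Filter F}
    (g : T -> Cx R) : cdifferentiable f l -> g @ F --> l -> f (g t) @[t --> F] --> f l.
Proof.
move=> [d hd] /cvgC_cabs gl; have [r r0 hr] := hd 1 ltr01.
apply/cvgC_cabs.
apply: (@squeeze_cvgr _ _ _ _ (fun=> 0) (fun t => (1 + cabs d) * cabs (g t - l))).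
- move/cvgrPdist_le: gl => /(_ r r0); apply: filterS => t.
  rewrite sub0r normrN (ger0_norm (cabs_ge0 _)) => /hr h; rewrite cabs_ge0/=.
  have -> : f (g t) - f l = (f (g t) - f l - d * (g t - l)) + d * (g t - l) by ring.
  by rewrite (le_trans (cabsD _ _))// cabsM mulrDl lerD.
- exact: cvg_cst.
- rewrite -[X in _ --> X](mulr0 (1 + cabs d)); apply: cvgM => //; exact: cvg_cst.
Qed.

Lemma expi1E : (fun t : R => expi (1 * t)) = @expi R.
Proof. by apply/funext => t; rewrite mul1r. Qed.

Lemma continuous_expi1 : continuous (@expi R : R -> Cx R).
Proof. by rewrite -expi1E; exact: continuous_expi. Qed.

Lemma expR_lipschitz (u v : R) : `|expR u - expR v| <= `|u - v| * expR (Num.max u v).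
Proof.
wlog uv : u v / v <= u.
  move=> h; have [vu|uv] := boolP (v <= u); first exact: h.
  rewrite -ltNge in uv; move/ltW in uv.
  by rewrite (distrC (expR u)) (distrC u) maxC; exact: h.
have uv' := uv; rewrite -ler_expR in uv'.
rewrite (max_idPl uv) !ger0_norm ?subr_ge0//.
have := expR_ge1Dx (v - u).
have -> : expR v = expR (v - u) * expR u by rewrite -expRD subrK.
move=> h1; rewrite -[X in X - _]mul1r -mulrBl ler_wpM2r ?expR_ge0//; lra.
Qed.

Lemma expi_lipschitz (s t : R) : cabs (expi s - expi t : Cx R) <= 2 * `|s - t|.
Proof.
have lip (u du : R -> R) : (forall x : R, is_derive x (1 : R) u (du x)) ->
    (forall x, `|du x| <= 1) -> forall s t, `|u s - u t| <= `|s - t|.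
  move=> hu du1.
  have cu : continuous u.
    by move=> x; apply/differentiable_continuous/derivable1_diffP; exact: ex_derive.
  have h (p q : R) : p < q -> `|u q - u p| <= `|q - p|.
    move=> ab; have [c _ ->] := MVT ab (fun x _ => hu x) (continuous_subspaceT cu).
    by rewrite normrM ler_piMl.
  move=> p q; have [/h|/h|->] := ltgtP p q; rewrite ?subrr ?normr0//.
  by rewrite (distrC (u q)) (distrC q).
rewrite (le_trans (cabs_le_ReIm _))// mulrDl !mul1r /=.
apply: lerD.
- by apply: (@lip cos (fun x => - sin x)) => x; rewrite normrN sin_max.
- by apply: (@lip sin cos) => x; rewrite cos_max.
Qed.

Section Cauchy.
Variables (f : Cx R -> Cx R) (a : Cx R).
Hypothesis fdiff : forall s, cdifferentiable f s.
Hypothesis a1 : cabs a <= 1.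

(* The homotopy [zz u th] contracts the circle of radius 2 to [a] as [u -> -oo]. *)
Let gam (th : R) : Cx R := RC 2 * expi th.
Let zz (u th : R) : Cx R := a + RC (expR u) * (gam th - a).
Let bet (th : R) : Cx R := gam th / (gam th - a).

Let cabs_gam th : cabs (gam th) = 2.
Proof. by rewrite cabsM cabsRC cabs_expi mulr1 gtr0_norm. Qed.

Let gam_sub_ge th : 1 <= cabs (gam th - a).
Proof.
have h1 := a1; have := cabsD (gam th - a) a; rewrite subrK cabs_gam; lra.
Qed.

Let gam_sub_le th : cabs (gam th - a) <= 3.
Proof. have h1 := a1; have := cabsB (gam th) a; rewrite cabs_gam; lra. Qed.

Let gam_neq th : gam th - a != 0.
Proof.
apply/eqP => h; have := gam_sub_ge th; rewrite h cabs0; lra.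
Qed.

Let cabs_bet th : cabs (bet th) <= 2.
Proof.
rewrite cabsM cabsV cabs_gam ler_pdivrMr ?ler_peMr//.
by rewrite (lt_le_trans ltr01).
Qed.

Let cgam : continuous gam.
Proof.
move=> t; apply: cvgM; first exact: cvg_cst.
exact: continuous_expi1.
Qed.

Let cbet : continuous bet.
Proof.
move=> t; apply: cvgM; first exact: cgam.
apply: cvgV; first exact: gam_neq.
by apply: cvgB; [exact: cgam|exact: cvg_cst].
Qed.

Let czz_th u : continuous (zz u).
Proof.
move=> t; apply: cvgD; first exact: cvg_cst.
apply: cvgM; first exact: cvg_cst.
by apply: cvgB; [exact: cgam|exact: cvg_cst].
Qed.

Let czz_u th : continuous (zz ^~ th).
Proof.
move=> t; apply: cvgD; first exact: cvg_cst.
apply: cvgM; last exact: cvg_cst.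
by apply: continuous_comp; [exact: continuous_expR|exact: continuous_RC].
Qed.

(** The boundary integral over the rectangle [[u1, u2] x [t1, t2]] of the pull-back of
    [g(z) dz / (z - a)] by [zz]. Since [gam' = i gam], the form [dzz / (zz - a)] equals
    [du + i bet dth]. *)
Let Phi (g : Cx R -> Cx R) (u1 u2 t1 t2 : R) : Cx R :=
  IC 1 * (cI t1 t2 (fun t => g (zz u2 t) * bet t) - cI t1 t2 (fun t => g (zz u1 t) * bet t))
  - (cI u1 u2 (fun u => g (zz u t2)) - cI u1 u2 (fun u => g (zz u t1))).

Let cvg_closed (g : Cx R -> Cx R) :=
  forall (h : R -> Cx R), continuous h -> continuous (fun t => g (h t)).

Let cont_th g u : cvg_closed g -> continuous (fun t => g (zz u t) * bet t).
Proof.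
by move=> cg t; apply: cvgM; [exact: (cg _ (@czz_th u))|exact: cbet].
Qed.

Let cont_u g t : cvg_closed g -> continuous (fun u => g (zz u t)).
Proof. by move=> cg; exact: cg (@czz_u t). Qed.

Let f_closed : cvg_closed f.
Proof. by move=> h ch t; apply: cdifferentiable_cvg => //; exact: ch. Qed.

Let Phi_add g u1 u2 u3 t1 t2 t3 : cvg_closed g -> u1 <= u2 <= u3 -> t1 <= t2 <= t3 ->
  Phi g u1 u3 t1 t3 = Phi g u1 u2 t1 t2 + Phi g u2 u3 t1 t2
    + Phi g u1 u2 t2 t3 + Phi g u2 u3 t2 t3.
Proof.
move=> cg hu ht; rewrite /Phi.
have E1 u := cI_split (@cont_th g u cg) ht.
have E2 t := cI_split (@cont_u g t cg) hu.
rewrite (E1 u1) (E1 u3) (E2 t1) (E2 t3).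
move: (cI _ _ _) (cI _ _ _) (cI _ _ _) (cI _ _ _) (cI _ _ _) (cI _ _ _).
by move=> X1 X2 X3 X4 X5 X6; ring.
Qed.

Let Phi_sub g h u1 u2 t1 t2 : cvg_closed g -> cvg_closed h ->
  Phi (fun z => g z - h z) u1 u2 t1 t2 = Phi g u1 u2 t1 t2 - Phi h u1 u2 t1 t2.
Proof.
move=> cg ch; rewrite /Phi.
have E1 u : cI t1 t2 (fun t => (g (zz u t) - h (zz u t)) * bet t) =
    cI t1 t2 (fun t => g (zz u t) * bet t) - cI t1 t2 (fun t => h (zz u t) * bet t).
  rewrite -(cIB _ _ (@cont_th g u cg) (@cont_th h u ch)).
  by apply: eq_cI => t; rewrite mulrBl.
have E2 t : cI u1 u2 (fun u => g (zz u t) - h (zz u t)) =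
    cI u1 u2 (fun u => g (zz u t)) - cI u1 u2 (fun u => h (zz u t)).
  exact: (cIB _ _ (@cont_u g t cg) (@cont_u h t ch)).
rewrite (E1 u1) (E1 u2) (E2 t1) (E2 t2).
move: (cI _ _ _) (cI _ _ _) (cI _ _ _) (cI _ _ _) (cI _ _ _) (cI _ _ _) (cI _ _ _) (cI _ _ _).
by move=> X1 X2 X3 X4 X5 X6 X7 X8; ring.
Qed.

Let aff_closed p q : cvg_closed (fun z => p + q * (z - a)).
Proof.
move=> h ch t; apply: cvgD; first exact: cvg_cst.
apply: cvgM; first exact: cvg_cst.
by apply: cvgB; [exact: ch|exact: cvg_cst].
Qed.

(** The pulled-back form is [p (du + i bet dth) + q dzz]. For the first part the integrals over
    opposite sides agree, because [bet] does not depend on [u]; the second part is exact. *)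
Let Phi_aff p q u1 u2 t1 t2 : u1 <= u2 -> t1 <= t2 ->
  Phi (fun z => p + q * (z - a)) u1 u2 t1 t2 = 0.
Proof.
move=> hu ht; rewrite /Phi.
have E1 u : cI t1 t2 (fun t => (p + q * (zz u t - a)) * bet t) =
    p * cI t1 t2 bet + q * RC (expR u) * cI t1 t2 gam.
  rewrite -(cIZ _ _ _ cbet) -(cIZ _ _ _ cgam) -cID; first last.
  - by move=> t; apply: cvgM; [exact: cvg_cst|exact: cgam].
  - by move=> t; apply: cvgM; [exact: cvg_cst|exact: cbet].
  apply: eq_cI => t; rewrite /zz addrAC subrr add0r mulrDl; congr (_ + _).
  rewrite /bet; have := gam_neq t; move: (gam t) (RC (expR u)) => G E G0.
  by rewrite -!mulrA; congr (_ * (_ * _)); rewrite mulrCA mulfV ?mulr1.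
have E2 t : cI u1 u2 (fun u => p + q * (zz u t - a)) =
    cI u1 u2 (fun=> p) + RC (expR u2 - expR u1) * (q * (gam t - a)).
  rewrite -cI_expR// -cID; first last.
  - move=> u; apply: cvgM; last exact: cvg_cst.
    by apply: continuous_comp; [exact: continuous_expR|exact: continuous_RC].
  - by move=> u; exact: cvg_cst.
  by apply: eq_cI => u; rewrite /zz addrAC subrr add0r; ring.
have E3 : IC 1 * cI t1 t2 gam = gam t2 - gam t1.
  rewrite /gam (cIZ _ _ _ continuous_expi1).
  have := @cI_expi R t1 t2 1 ht; rewrite expi1E !mul1r.
  by rewrite mulrCA => ->; rewrite mulrBr.
rewrite (E1 u1) (E1 u2) (E2 t1) (E2 t2) RCB.
move: E3; move: (cI t1 t2 gam) (cI t1 t2 bet) (cI u1 u2 _)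
  (RC (expR u2)) (RC (expR u1)) (gam t1) (gam t2).
move=> G B P e2 e1 g1 g2 E3.
transitivity (q * (e2 - e1) * (IC 1 * G) - q * (e2 - e1) * (g2 - g1)); first by ring.
by rewrite E3 subrr.
Qed.

(** The constant is [7 = 3 + 4]: the bound 3 on [|gam - a|], and the radius 2 times the Lipschitz
    constant 2 of [expi]. *)
Let zz_lip u0 t0 u t : `|u - u0| <= 1 ->
  cabs (zz u t - zz u0 t0) <= 7 * expR (u0 + 1) * (`|u - u0| + `|t - t0|).
Proof.
move=> hu.
have -> : zz u t - zz u0 t0 = RC (expR u - expR u0) * (gam t - a)
    + RC (expR u0) * (RC 2 * (expi t - expi t0)).
  by rewrite /zz /gam RCB; ring.
rewrite (le_trans (cabsD _ _))// !cabsM !cabsRC.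
have e0 := expR_gt0 (u0 + 1).
have h1 : `|expR u - expR u0| <= `|u - u0| * expR (u0 + 1).
  rewrite (le_trans (expR_lipschitz _ _))// ler_wpM2l// ler_expR ge_max.
  by move: hu; rewrite ler_norml => /andP[]; lra.
have h2 : `|expR u0| <= expR (u0 + 1) by rewrite gtr0_norm ?expR_gt0// ler_expR; lra.
have h3 := expi_lipschitz t t0; have h4 := gam_sub_le t.
have n1 := normr_ge0 (u - u0); have n2 := normr_ge0 (t - t0).
have n3 := cabs_ge0 (gam t - a); have n4 := cabs_ge0 (expi t - expi t0).
rewrite (ger0_norm (_ : 0 <= 2))//.
have k1 : `|expR u - expR u0| * cabs (gam t - a) <= `|u - u0| * expR (u0 + 1) * 3.
  by rewrite ler_pM.
have k2 : `|expR u0| * (2 * cabs (expi t - expi t0)) <= expR (u0 + 1) * (2 * (2 * `|t - t0|)).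
  by rewrite ler_pM// ?mulr_ge0// ler_wpM2l.
have k3 : 0 <= `|u - u0| * expR (u0 + 1) by rewrite mulr_ge0// ltW.
have k4 : 0 <= `|t - t0| * expR (u0 + 1) by rewrite mulr_ge0// ltW.
by nra.
Qed.

(** [Phi] kills the affine approximation of [f] at [zz u0 t0], so only the error remains. It is
    small compared with the size of the rectangle, and integrating it over the sides gains one more
    factor of that size. *)
Let Phi_local u0 t0 (e : R) : 0 < e -> exists2 r : R, 0 < r & forall u1 u2 t1 t2 : R,
  u1 <= u0 <= u2 -> t1 <= t0 <= t2 -> u2 - u1 <= r -> t2 - t1 <= r ->
  cabs (Phi f u1 u2 t1 t2) <= e * ((u2 - u1) + (t2 - t1)) ^+ 2.
Proof.
move=> e0; have [d hd] := fdiff (zz u0 t0).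
have [L LE] : exists L : R, L = 7 * expR (u0 + 1) by eexists.
have L0 : 0 < L by rewrite LE mulr_gt0// expR_gt0.
(* The two sides in [th] contribute 8, that is twice 2 from [cabs_cI] and 2 from [bet]; the two
   sides in [u] contribute 4. The 12 absorbs both, and [L] turns distances of values of [zz] into
   sizes of rectangles. *)
have [r r0 hr] := hd (e / (12 * L)) (divr_gt0 e0 (mulr_gt0 (ltr0n _ 12) L0)).
exists (Num.min 1 (r / (2 * L))); first by rewrite lt_min ltr01 divr_gt0// mulr_gt0.
move=> u1 u2 t1 t2 hu ht; rewrite !le_min => /andP[ru1 ru2] /andP[rt1 rt2].
have hu12 : u1 <= u2 by lra.
have ht12 : t1 <= t2 by lra.
set z0 := zz u0 t0 in hd hr *.
pose aff z := (f z0 + d * (a - z0)) + d * (z - a).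
pose err z := f z - aff z.
have -> : Phi f u1 u2 t1 t2 = Phi err u1 u2 t1 t2.
  rewrite (@Phi_sub f aff u1 u2 t1 t2 f_closed (@aff_closed _ _)).
  by rewrite (@Phi_aff (f z0 + d * (a - z0)) d u1 u2 t1 t2 hu12 ht12) subr0.
have err_closed : cvg_closed err.
  by move=> h ch t; apply: cvgB; [exact: f_closed|exact: (@aff_closed _ _ h ch)].
set H := (u2 - u1) + (t2 - t1).
have H0 : 0 <= H by rewrite /H; lra.
have errb u t : u1 <= u <= u2 -> t1 <= t <= t2 -> cabs (err (zz u t)) <= e / 12 * H.
  move=> hu' ht'.
  have uu : `|u - u0| <= u2 - u1 by rewrite ler_norml; lra.
  have tt : `|t - t0| <= t2 - t1 by rewrite ler_norml; lra.
  have lip := @zz_lip u0 t0 u t (le_trans uu ru1).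
  have LH : cabs (zz u t - z0) <= L * H.
    by rewrite (le_trans lip)// -LE ler_pM2l// lerD.
  have LHr : L * H <= r.
    by move: ru2 rt2; rewrite !ler_pdivlMr ?mulr_gt0// /H; lra.
  have -> : err (zz u t) = f (zz u t) - f z0 - d * (zz u t - z0).
    by rewrite /err /aff; ring.
  rewrite (le_trans (hr _ (le_trans LH LHr)))//.
  have eL : 0 <= e / (12 * L) by rewrite divr_ge0 ?mulr_ge0 ?ltW.
  rewrite (le_trans (ler_wpM2l eL LH))//.
  have -> : e / (12 * L) * (L * H) = e / 12 * H by field; rewrite lt0r_neq0.
  exact: lexx.
have B1 u : u1 <= u <= u2 ->
    cabs (cI t1 t2 (fun t => err (zz u t) * bet t)) <= 2 * (e / 12 * H * 2) * (t2 - t1).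
  move=> hu'; apply: cabs_cI; [exact: ht12|exact: cont_th|].
  move=> t ht'; rewrite cabsM ler_pM ?cabs_ge0//; exact: errb.
have B2 t : t1 <= t <= t2 ->
    cabs (cI u1 u2 (fun u => err (zz u t))) <= 2 * (e / 12 * H) * (u2 - u1).
  move=> ht'; apply: cabs_cI; [exact: hu12|exact: cont_u|].
  by move=> u hu'; exact: errb.
rewrite /Phi.
have b1 := B1 u1 ltac:(lra); have b2 := B1 u2 ltac:(lra).
have b3 := B2 t1 ltac:(lra); have b4 := B2 t2 ltac:(lra).
set X1 := cI t1 t2 _ in b1 *; set X2 := cI t1 t2 _ in b2 *.
set Y1 := cI u1 u2 _ in b3 *; set Y2 := cI u1 u2 _ in b4 *.
rewrite (le_trans (cabsB _ _))// cabsM cabsIC normr1 mul1r.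
have k1 := cabsB X2 X1; have k2 := cabsB Y2 Y1.
have q0 : 0 <= e / 12 * H by rewrite mulr_ge0// divr_ge0// ltW.
apply: (@le_trans _ _ (8 * (e / 12 * H) * (t2 - t1) + 4 * (e / 12 * H) * (u2 - u1))).
  by lra.
have -> : e * H ^+ 2 = 12 * (e / 12 * H) * H by field.
rewrite {4}/H; move: q0; set Q := e / 12 * H => q0.
have : 0 <= Q * (u2 - u1) by rewrite mulr_ge0//; lra.
have : 0 <= Q * (t2 - t1) by rewrite mulr_ge0//; lra.
by lra.
Qed.

(** [Phi f] vanishes by bisection, and the sides [th = 0] and [th = 2 pi] cancel by periodicity; so
    the integral over the contracted circle does not depend on [u]. As [expR u] tends to 0,
    [f (zz u th)] may be replaced by [f a]. *)
Lemma cauchy_formula_aux :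
  cI 0 (2 * pi) (fun t => f (RC 2 * expi t) * (RC 2 * expi t / (RC 2 * expi t - a))) =
  f a * cI 0 (2 * pi) (fun t => RC 2 * expi t / (RC 2 * expi t - a)).
Proof.
have pi0 : 0 <= 2 * pi :> R by rewrite mulr_ge0// pi_ge0.
pose psi u := cI 0 (2 * pi) (fun t => f (zz u t) * bet t).
have psiE u : u <= 0 -> psi 0 = psi u.
  move=> u0.
  have /cabs_eq0 : cabs (Phi f u 0 0 (2 * pi)) = 0.
    apply/eqP; rewrite eq_le cabs_ge0 andbT.
    apply: (@goursat_bisection R (fun b c d e : R => cabs (Phi f b c d e))); last 2 first.
    - exact: u0.
    - exact: pi0.
    - move=> u1 u2 u3 t1 t2 t3 hu ht; rewrite (Phi_add f_closed hu ht).
      move: (Phi f u1 u2 t1 t2) (Phi f u2 u3 t1 t2) (Phi f u1 u2 t2 t3) (Phi f u2 u3 t2 t3).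
      move=> X1 X2 X3 X4; have := cabsD (X1 + X2 + X3) X4.
      by have := cabsD (X1 + X2) X3; have := cabsD X1 X2; lra.
    - exact: Phi_local.
  rewrite /Phi.
  have -> : (fun u => f (zz u (2 * pi))) = (fun u => f (zz u 0)).
    apply/funext => v; rewrite /zz /gam; congr (f (_ + _ * (_ * _ - _))).
    apply: CxE => /=; first by rewrite mulrC mulr_natr cos2pi cos0.
    by rewrite mulrC mulr_natr sin2pi sin0.
  rewrite subrr subr0 => /eqP; rewrite mulf_eq0 => /orP[/eqP/(congr1 (@cabs R))|].
    by rewrite cabsIC normr1 cabs0 => /eqP; rewrite oner_eq0.
  by rewrite subr_eq0 => /eqP.
have psi0 : psi 0 = cI 0 (2 * pi) (fun t => f (gam t) * bet t).
  by apply: eq_cI => t; rewrite /zz expR0 mul1r addrC subrK.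
rewrite -psi0; apply/eqP; rewrite -subr_eq0; apply/eqP/cabs_eq0/eqP.
rewrite eq_le cabs_ge0 andbT; apply/ler_addgt0Pr => e e0; rewrite add0r.
rewrite -(cIZ _ _ _ cbet).
have [d hd] := fdiff a; have [r r0 hr] := hd 1 ltr01.
(* [K * q] dominates the final estimate: 3 bounds [|gam - a|], and [4 = 2 * 2] comes from [cabs_cI]
   and [cabs_bet]. The summand 1 makes [K] positive. *)
pose K := (1 + cabs d) * 3 * 4 * (2 * pi) + 1.
have K0 : 0 < K.
  have c0 := cabs_ge0 d.
  by rewrite ltr_wpDl// mulr_ge0//; lra.
pose q := Num.min 1 (Num.min (r / 3) (e / K)).
have q0 : 0 < q by rewrite !lt_min ltr01 !divr_gt0.
have [q1 q2 q3] : [/\ q <= 1, q <= r / 3 & q <= e / K].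
  by rewrite /q !ge_min !lexx !orbT.
have lq : expR (ln q) = q by rewrite lnK// posrE.
have lnq : ln q <= 0 by rewrite ln_le0.
have cfb : continuous (fun t => f a * bet t).
  by move=> t; apply: cvgM; [exact: cvg_cst|exact: cbet].
rewrite (psiE (ln q))// /psi -(cIB _ _ (@cont_th f (ln q) f_closed) cfb).
apply: (@le_trans _ _ (2 * ((1 + cabs d) * (q * 3) * 2) * (2 * pi - 0))).
  apply: cabs_cI; first exact: pi0.
    by move=> t; apply: cvgB; [exact: cont_th|exact: cfb].
  move=> t _; rewrite -mulrBl cabsM ler_pM ?cabs_ge0//.
  have zt : cabs (zz (ln q) t - a) <= q * 3.
    by rewrite /zz addrAC subrr add0r lq cabsM cabsRC gtr0_norm// ler_pM2l.
  have ztr : cabs (zz (ln q) t - a) <= r by rewrite (le_trans zt)//; move: q2; lra.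
  have -> : f (zz (ln q) t) - f a = (f (zz (ln q) t) - f a - d * (zz (ln q) t - a))
    + d * (zz (ln q) t - a) by ring.
  rewrite (le_trans (cabsD _ _))// cabsM (@le_trans _ _ ((1 + cabs d) * cabs (zz (ln q) t - a)))//.
    by rewrite mulrDl lerD2r; exact: hr.
  by rewrite ler_wpM2l// addr_ge0 ?cabs_ge0.
move: q3; rewrite ler_pdivlMr// /K; move: q0 => /ltW; lra.
Qed.

End Cauchy.

End Taylor.

(** * Taylor coefficients from Cauchy's formula *)

Section TaylorExpansion.
Variable R : realType.

Let kern (a : Cx R) (t : R) : Cx R := RC 2 * expi t / (RC 2 * expi t - a).

Let expiN_continuous n : continuous (fun t : R => expi (- n%:R * t) : Cx R).
Proof. exact: continuous_expi. Qed.

Let kern_continuous a : cabs a <= 1 -> continuous (kern a).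
Proof.
move=> a1 t.
have ce : (RC 2 * expi t0 : Cx R) @[t0 --> t] --> (RC 2 * expi t : Cx R).
  apply: cvgM; first exact: cvg_cst.
  exact: continuous_expi1.
apply: cvgM; first exact: ce.
apply: cvgV; last by apply: cvgB; [exact: ce|exact: cvg_cst].
apply/eqP => h; have := cabsD (RC 2 * expi t - a) a.
by rewrite subrK h cabs0 add0r cabsM cabsRC cabs_expi gtr0_norm//; lra.
Qed.

Let kern_rec a t : cabs a <= 1 -> kern a t = 1 + a / RC 2 * expi (- t) * kern a t.
Proof.
move=> a1; rewrite /kern.
have e0 : expi (- t) * expi t = 1 :> Cx R by rewrite -expiD addNr expi0.
have t0 : RC 2 * expi t - a != 0 :> Cx R.
  apply/eqP => h; have := cabsD (RC 2 * expi t - a) a.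
  by rewrite subrK h cabs0 add0r cabsM cabsRC cabs_expi gtr0_norm//; lra.
have n2 : RC 2 != 0 :> Cx R by rewrite RC_eq0.
apply: (mulIf t0); rewrite mulfVK// mulrDl mul1r -!mulrA mulVf// mulr1.
rewrite [expi (- t) * _]mulrCA e0 mulr1 mulVf// mulr1.
by rewrite subrK.
Qed.

Let kern_le a t : cabs a <= 1 -> cabs (kern a t) <= 2.
Proof.
move=> a1; rewrite cabsM cabsV cabsM cabsRC cabs_expi mulr1 gtr0_norm//.
have := cabsD (RC 2 * expi t - a) a.
rewrite subrK cabsM cabsRC cabs_expi mulr1 gtr0_norm// => h.
by rewrite ler_pdivrMr ?ler_peMr//; lra.
Qed.

(** A finite geometric series with its remainder kept explicit: [kern_rec] is iterated under the
    integral, and the remainder carries the factor [(a / 2) ^+ N]. *)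
Let kern_expand (g : R -> Cx R) a N : continuous g -> cabs a <= 1 ->
  cI 0 (2 * pi) (fun t => g t * kern a t) =
  \sum_(n < N) (a / RC 2) ^+ n * cI 0 (2 * pi) (fun t => g t * expi (- n%:R * t))
  + (a / RC 2) ^+ N * cI 0 (2 * pi) (fun t => g t * expi (- N%:R * t) * kern a t).
Proof.
move=> cg a1; elim: N => [|N ->].
  rewrite big_ord0 add0r expr0 mul1r; apply: eq_cI => t.
  by rewrite oppr0 mul0r expi0 mulr1.
rewrite big_ord_recr/= -addrA; congr (_ + _).
have -> : cI 0 (2 * pi) (fun t => g t * expi (- N%:R * t) * kern a t) =
   cI 0 (2 * pi) (fun t => g t * expi (- N%:R * t)) +
   a / RC 2 * cI 0 (2 * pi) (fun t => g t * expi (- N.+1%:R * t) * kern a t).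
  have cge n : continuous (fun t => g t * expi (- n%:R * t) : Cx R).
    by move=> t; apply: cvgM; [exact: cg|exact: expiN_continuous].
  have cgk n : continuous (fun t => g t * expi (- n%:R * t) * kern a t : Cx R).
    by move=> t; apply: cvgM; [exact: cge|exact: kern_continuous].
  rewrite -(cIZ _ _ _ (cgk _)) -cID; first last.
  - by move=> t; apply: cvgM; [exact: cvg_cst|exact: cgk].
  - exact: cge.
  apply: eq_cI => t; rewrite [in LHS]kern_rec//.
  rewrite -[N.+1]addn1 natrD opprD mulrDl expiD mulN1r; ring.
by rewrite exprSr mulrDr mulrA.
Qed.

Let cI_unit n : cI 0 (2 * pi) (fun t : R => 1 * expi (- n%:R * t)) =
  (if n == 0%N then RC (2 * pi) else 0 : Cx R).
Proof.
have pi0 : 0 <= 2 * pi :> R by rewrite mulr_ge0// pi_ge0.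
have -> : (fun t : R => 1 * expi (- n%:R * t) : Cx R) = (fun t => expi (- n%:R * t)).
  by apply/funext => t; rewrite mul1r.
case: n => [|n] /=.
  rewrite (_ : (fun _ => _) = fun=> 1); last first.
    by apply/funext => t; rewrite oppr0 mul0r expi0.
  by rewrite cIE; apply: CxE => /=; rewrite Rintegral_itv_cst// ?mul0r// mul1r subr0.
have := @cI_expi R 0 (2 * pi) (- n.+1%:R) pi0.
have -> : - n.+1%:R * (2 * pi) = (- (2 * pi : R)) *+ n.+1.
  by rewrite -[RHS]mulr_natl mulrN mulNr.
rewrite expiMn mulr0 expi0.
have -> : expi (- (2 * pi)) = 1 :> Cx R.
  by apply: CxE; rewrite /= ?cosN ?sinN mulrC mulr_natr ?cos2pi ?sin2pi ?oppr0.
rewrite expr1n subrr => /eqP; rewrite mulf_eq0 => /orP[|/eqP->//].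
by rewrite eq_complex /= oppr_eq0 pnatr_eq0 andbF.
Qed.

Lemma cvg_geometric_half (K : R) : (K / 2 ^+ N @[N --> \oo] --> (0 : R)).
Proof.
rewrite -[X in _ --> X](mulr0 K); apply: cvgM; first exact: cvg_cst.
under eq_fun do rewrite -exprVn.
by apply: cvg_expr; rewrite ger0_norm ?invr_ge0// invf_lt1// ltr1n.
Qed.

Lemma geometric_small (K x : R) : (forall N, x <= K / 2 ^+ N) -> x <= 0.
Proof. by move=> hx; apply: (cvgr_to_ge (cvg_geometric_half K)); exact: nearW. Qed.

(** Data on the circle of radius 2 give an expansion on the closed unit disc. The gap between the
    radii makes the coefficients decay like [2 ^- n], which leaves room for termwise operations; the
    factor 2 before [M] is the one of [cabs_cI]. *)
Theorem taylor_expansion (f : Cx R -> Cx R) (M : R) :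
  (forall s, cdifferentiable f s) -> (forall t : R, 0 <= t <= 2 * pi -> cabs (f (RC 2 * expi t)) <= M) ->
  exists c : nat -> Cx R, (forall n, cabs (c n) <= 2 * M / 2 ^+ n) /\
    forall a, cabs a <= 1 -> f a = csum (fun n => c n * a ^+ n).
Proof.
move=> fd fM; have pi0 : 0 < 2 * pi :> R by rewrite mulr_gt0// pi_gt0.
have ipi0 : 0 <= (2 * pi)^-1 :> R by rewrite invr_ge0 ltW.
have t00 : 0 <= (0 : R) <= 2 * pi by rewrite lexx ltW.
have M0 : 0 <= M := le_trans (cabs_ge0 _) (fM 0 t00).
pose g t := f (RC 2 * expi t).
have cg : continuous g.
  move=> t; apply: cdifferentiable_cvg => //.
  apply: cvgM; first exact: cvg_cst.
  exact: continuous_expi1.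
pose I n := cI 0 (2 * pi) (fun t => g t * expi (- n%:R * t)).
have rem (h : R -> Cx R) K a N : continuous h ->
    (forall t : R, 0 <= t <= 2 * pi -> cabs (h t) <= K) -> cabs a <= 1 ->
    cabs ((a / RC 2) ^+ N * cI 0 (2 * pi) (fun t => h t * expi (- N%:R * t) * kern a t))
    <= 2 * (K * 2) * (2 * pi) / 2 ^+ N.
  move=> ch hK a1; rewrite cabsM mulrC.
  have K0 : 0 <= K := le_trans (cabs_ge0 _) (hK 0 t00).
  apply: ler_pM; rewrite ?cabs_ge0//.
    rewrite -[leRHS]/(2 * (K * 2) * (2 * pi)) -[X in _ <= _ * X](subr0 (2 * pi)).
    apply: cabs_cI; first exact: ltW.
      move=> t; apply: cvgM; last exact: kern_continuous.
      by apply: cvgM; [exact: ch|exact: expiN_continuous].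
    move=> t tpi; rewrite (cabsM (h t * _)) (cabsM (h t)) cabs_expi mulr1.
    by apply: ler_pM; [exact: cabs_ge0|exact: cabs_ge0|exact: hK tpi|exact: kern_le].
  rewrite cabsX cabsM cabsV cabsRC (ger0_norm (_ : 0 <= 2))// expr_div_n.
  by rewrite ler_pdivrMr ?exprn_gt0// mulVf ?expf_neq0// exprn_ile1// cabs_ge0.
(* The same expansion with constant [g]: by orthogonality only the term [n = 0] survives. Expanding
   to [N.+1] terms guarantees that this term is present. *)
have kern_int a : cabs a <= 1 -> cI 0 (2 * pi) (kern a) = RC (2 * pi).
  move=> a1; apply/eqP; rewrite -subr_eq0; apply/eqP/cabs_eq0/eqP.
  rewrite eq_le cabs_ge0 andbT.
  apply: (@geometric_small (2 * (1 * 2) * (2 * pi) * 2)) => N.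
  have -> : kern a = (fun t => 1 * kern a t) by apply/funext => t; rewrite mul1r.
  have c1 : continuous (fun _ : R => (1 : Cx R)) by move=> t; exact: cvg_cst.
  rewrite (kern_expand N.+1 c1 a1).
  rewrite big_ord_recl /= cI_unit/= expr0 mul1r big1 ?addr0; last first.
    by move=> i _; rewrite cI_unit/= mulr0.
  rewrite addrAC subrr add0r.
  have r1 : forall t : R, 0 <= t <= 2 * pi -> cabs (1 : Cx R) <= 1.
    by move=> t _; rewrite cabs1.
  apply: (le_trans (@rem (fun=> 1) 1 a N.+1 c1 r1 a1)).
  have K0 : 0 <= 2 * (1 * 2) * (2 * pi) :> R by rewrite mulr_ge0 ?ltW//; lra.
  apply: ler_pM => //; first by rewrite ler_peMr// ler1n.
  by rewrite lef_pV2 ?posrE ?exprn_gt0// exprS ler_peMl ?exprn_ge0// ler1n.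
exists (fun n => RC (2 * pi)^-1 * (RC 2)^-1 ^+ n * I n); split.
  move=> n; rewrite !cabsM cabsX cabsV !cabsRC (ger0_norm (_ : 0 <= 2))//.
  rewrite (ger0_norm ipi0) exprVn.
  have : cabs (I n) <= 2 * M * (2 * pi - 0).
    apply: cabs_cI; first exact: ltW.
      by move=> t; apply: cvgM; [exact: cg|exact: expiN_continuous].
    by move=> t tpi; rewrite (cabsM (g t)) cabs_expi mulr1; exact: fM.
  rewrite subr0; move: (cabs (I n)) (pi0) => X; move: (2 * pi) => p p0 h.
  have n0 : 0 < 2 ^+ n :> R by rewrite exprn_gt0.
  have p0' : 0 <= p^-1 / 2 ^+ n by rewrite mulr_ge0// invr_ge0 ltW.
  apply: (le_trans (ler_wpM2l p0' h)).
  have -> : p^-1 / 2 ^+ n * (2 * M * p) = 2 * M / 2 ^+ n by field; rewrite !lt0r_neq0.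
  exact: lexx.
move=> a a1; apply/esym/csum_eq; apply/cvgC_cabs.
apply: (@squeeze_cvgr _ _ _ _ (fun=> 0)
  (fun N => (2 * pi)^-1 * (2 * (M * 2) * (2 * pi) / 2 ^+ N))); last 2 first.
- exact: cvg_cst.
- rewrite -[X in _ --> X](mulr0 (2 * pi)^-1); apply: cvgM; first exact: cvg_cst.
  exact: cvg_geometric_half.
apply: nearW => N; rewrite cabs_ge0/=.
have h := cauchy_formula_aux fd a1; rewrite -/(kern a) in h.
have {h} h : cI 0 (2 * pi) (fun t => g t * kern a t) = f a * RC (2 * pi).
  by rewrite [LHS]h kern_int.
have -> : f a = RC (2 * pi)^-1 * cI 0 (2 * pi) (fun t => g t * kern a t).
  by rewrite h mulrCA -RCM mulVf ?mulr1// lt0r_neq0.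
rewrite (kern_expand N cg a1) (mulrDr (RC (2 * pi)^-1))
  [X in _ - (X + _)]mulr_sumr.
have -> : psum (fun n => RC (2 * pi)^-1 * (RC 2)^-1 ^+ n * I n * a ^+ n) N =
    \sum_(i < N) RC (2 * pi)^-1 * ((a / RC 2) ^+ i * I i).
  by apply: eq_bigr => i _; rewrite exprMn; ring.
rewrite opprD addrA subrr add0r cabsN cabsM cabsRC.
rewrite (ger0_norm ipi0) ler_pM2l ?invr_gt0//.
exact: rem.
Qed.

End TaylorExpansion.

(** * Dunkl operators on polynomials *)

Section PolynomialTools.
Variables (R : realType) (m : nat).
Implicit Types (p q : mpoly m R) (x y a : 'rV[R]_m).

Notation XU i := (mpolyX R (mnm1 i) : mpoly m R).

Lemma mpoly_alg_ind (P : mpoly m R -> Prop) :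
  (forall c : R, P (mpolyC m c)) -> (forall p q, P p -> P q -> P (p + q)) ->
  (forall p q, P p -> P q -> P (p * q)) -> (forall i, P (XU i)) -> forall p, P p.
Proof.
move=> PC PD PM PX p; rewrite [p]mpolyE.
have P1 : P 1 by rewrite -mpolyC1; exact: PC.
have PXn i n : P (XU i ^+ n).
  by elim: n => [|n ih]; rewrite ?expr0// exprS; exact: PM.
apply: (big_ind P) => [|//|nu _]; first by rewrite -(mpolyC0 m R); exact: PC.
rewrite -mul_mpolyC; apply: (PM _ _ (PC _)); rewrite mpolyXE_id.
by apply: (big_ind P) => [//|p1 p2|i _]; [exact: PM|exact: PXn].
Qed.

Lemma pevalD p q x : peval (p + q) x = peval p x + peval q x.
Proof. exact: mevalD. Qed.
Lemma pevalB p q x : peval (p - q) x = peval p x - peval q x.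
Proof. exact: mevalB. Qed.
Lemma pevalM p q x : peval (p * q) x = peval p x * peval q x.
Proof. exact: mevalM. Qed.
Lemma pevalZ c p x : peval (c *: p) x = c * peval p x.
Proof. exact: mevalZ. Qed.
Lemma pevalC c x : peval (mpolyC m c) x = c.
Proof. exact: mevalC. Qed.
Lemma peval0 x : peval (0 : mpoly m R) x = 0.
Proof. exact: meval0. Qed.
Lemma peval1 x : peval (1 : mpoly m R) x = 1.
Proof. exact: meval1. Qed.
Lemma pevalXU i x : peval (XU i) x = x ord0 i.
Proof. exact: mevalXU. Qed.
Lemma peval_sum (I : Type) (r : seq I) (P : pred I) (F : I -> mpoly m R) x :
  peval (\sum_(i <- r | P i) F i) x = \sum_(i <- r | P i) peval (F i) x.
Proof. by apply: (big_morph (fun p => peval p x)) => [p q|]; rewrite ?pevalD ?peval0. Qed.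
Lemma pevalX_exp p n x : peval (p ^+ n) x = peval p x ^+ n.
Proof. by elim: n => [|n ih]; rewrite ?peval1// !exprS pevalM ih. Qed.

Lemma dotvC x y : dotv x y = dotv y x.
Proof. by apply: eq_bigr => i _; rewrite mulrC. Qed.
Lemma dotvDl x y a : dotv (x + y) a = dotv x a + dotv y a.
Proof. by rewrite -big_split; apply: eq_bigr => i _; rewrite mxE mulrDl. Qed.
Lemma dotvZl c x a : dotv (c *: x) a = c * dotv x a.
Proof. by rewrite mulr_sumr; apply: eq_bigr => i _; rewrite mxE mulrA. Qed.
Lemma dotvDr x y a : dotv a (x + y) = dotv a x + dotv a y.
Proof. by rewrite !(dotvC a) dotvDl. Qed.
Lemma dotvZr c x a : dotv a (c *: x) = c * dotv a x.
Proof. by rewrite !(dotvC a) dotvZl. Qed.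
Lemma dotvNl x a : dotv (- x) a = - dotv x a.
Proof. by rewrite -scaleN1r dotvZl mulN1r. Qed.
Lemma dotvBl x y a : dotv (x - y) a = dotv x a - dotv y a.
Proof. by rewrite dotvDl dotvNl. Qed.
Lemma dotvBr x y a : dotv a (x - y) = dotv a x - dotv a y.
Proof. by rewrite !(dotvC a) dotvBl. Qed.
Lemma dotv_ge0 x : 0 <= dotv x x.
Proof. by apply: sumr_ge0 => i _; rewrite -expr2 sqr_ge0. Qed.
Lemma dotv_eq0 x : dotv x x = 0 -> x = 0.
Proof.
move=> h; apply/rowP => i; rewrite mxE; apply/eqP; rewrite -sqrf_eq0.
move: h; rewrite /dotv => /psumr_eq0P h; rewrite expr2 h//.
by move=> j _; rewrite -expr2 sqr_ge0.
Qed.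
Lemma dotv_ej x i : dotv x (ej R i) = x ord0 i.
Proof.
rewrite /dotv (bigD1 i)//= mxE eqxx mulr1 big1 ?addr0// => j ji.
by rewrite mxE (negbTE ji) mulr0.
Qed.
Lemma row_ej x : x = \sum_(i < m) x ord0 i *: ej R i.
Proof.
apply/rowP => k; rewrite summxE (bigD1 k)//= !mxE eqxx mulr1 big1 ?addr0// => j jk.
by rewrite !mxE eq_sym (negbTE jk) mulr0.
Qed.

Lemma refl_isom a x y : dotv a a != 0 -> dotv (refl a x) (refl a y) = dotv x y.
Proof.
move=> a0; rewrite /refl !(dotvBl, dotvBr, dotvZl, dotvZr).
by rewrite (dotvC a y); field.
Qed.
Lemma reflD a x y : refl a (x + y) = refl a x + refl a y.
Proof.
rewrite /refl dotvDl; apply/rowP => i; rewrite !mxE.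
by rewrite mulrDr mulrDl mulrDl; ring.
Qed.
Lemma reflZ a c x : refl a (c *: x) = c *: refl a x.
Proof. by rewrite /refl dotvZl; apply/rowP => i; rewrite !mxE; ring. Qed.
Lemma reflB a x y : refl a (x - y) = refl a x - refl a y.
Proof. by rewrite reflD -scaleN1r reflZ scaleN1r. Qed.
Lemma reflK a : dotv a a != 0 -> involutive (refl a).
Proof.
move=> a0 x; rewrite /refl dotvBl dotvZl; apply/rowP => i; rewrite !mxE.
by field.
Qed.
Lemma refl_scale a c x : c != 0 -> refl (c *: a) x = refl a x.
Proof.
move=> c0; rewrite /refl !dotvZl !dotvZr; apply/rowP => i; rewrite !mxE.
have [->|a0] := eqVneq (dotv a a) 0; first by rewrite !mulr0 invr0 !(mulr0, mul0r).
by field; rewrite c0 a0.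
Qed.

Definition lform y : mpoly m R := \sum_(j < m) y ord0 j *: XU j.

Lemma peval_lform y x : peval (lform y) x = dotv x y.
Proof.
by rewrite peval_sum; apply: eq_bigr => j _; rewrite pevalZ pevalXU mulrC.
Qed.
Lemma lformD x y : lform (x + y) = lform x + lform y.
Proof. by rewrite -big_split; apply: eq_bigr => i _; rewrite mxE scalerDl. Qed.
Lemma lformZ c x : lform (c *: x) = c *: lform x.
Proof. by rewrite scaler_sumr; apply: eq_bigr => i _; rewrite mxE scalerA. Qed.
Lemma lform_ej i : lform (ej R i) = XU i.
Proof.
rewrite /lform (bigD1 i)//= mxE eqxx scale1r big1 ?addr0// => j ji.
by rewrite mxE (negbTE ji) scale0r.
Qed.
Lemma mderiv_lform j y : mderiv j (lform y) = mpolyC m (y ord0 j).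
Proof.
rewrite /lform raddf_sum /= (bigD1 j)//= mderivZ mderivX mnm1E eqxx scale1r.
rewrite (_ : mnm_sub _ _ = mnm0); last by apply/mnmP => i; rewrite mnmBE subnn mnm0E.
rewrite mpolyX0 alg_mpolyC big1 ?addr0// => i ij.
by rewrite mderivZ mderivX mnm1E (negbTE ij) scale0r scaler0.
Qed.
Lemma mderiv_expr j p n : mderiv j (p ^+ n.+1) = n.+1%:R *: (p ^+ n * mderiv j p).
Proof.
elim: n => [|n ih]; first by rewrite expr1 expr0 mul1r scale1r.
rewrite exprS mderivM ih [n.+2%:R]mulrS scalerDl scale1r -scalerAr.
by congr (_ + _); [rewrite mulrC|rewrite mulrA -exprS].
Qed.

Definition msigma a p : mpoly m R :=
  comp_mpoly [tuple XU i - (2 * a ord0 i / dotv a a) *: lform a | i < m] p.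

Lemma peval_msigma a p x : peval (msigma a p) x = peval p (refl a x).
Proof.
rewrite /peval /msigma comp_mpoly_meval; apply: meval_eq => i.
rewrite tnth_map tnth_ord_tuple mevalB mevalZ mevalXU.
have /= := peval_lform a x; rewrite /peval => ->.
by rewrite /refl !mxE; ring.
Qed.
Lemma msigmaD a p q : msigma a (p + q) = msigma a p + msigma a q.
Proof. exact: comp_mpolyD. Qed.
Lemma msigmaZ a c p : msigma a (c *: p) = c *: msigma a p.
Proof. exact: comp_mpolyZ. Qed.
Lemma msigmaM a p q : msigma a (p * q) = msigma a p * msigma a q.
Proof. exact: rmorphM. Qed.
Lemma msigmaC a c : msigma a (mpolyC m c) = mpolyC m c.
Proof. exact: comp_mpolyC. Qed.
Lemma msigmaXU a i : msigma a (XU i) = XU i - (2 * a ord0 i / dotv a a) *: lform a.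
Proof. by rewrite /msigma comp_mpolyXU -tnth_nth tnth_map tnth_ord_tuple. Qed.

Lemma dhomog_lform y : lform y \is (ishomog1 1 (@mdeg m)).
Proof.
by apply: rpred_sum => j _; apply: rpredZ; rewrite dhomogX; apply/eqP/mdeg1.
Qed.

Lemma dhomog_msigmaX a nu : msigma a (mpolyX R nu) \is (ishomog1 (mdeg nu) (@mdeg m)).
Proof.
rewrite /msigma comp_mpolyX mdegE.
apply: (big_ind2 (fun (p : mpoly m R) d => p \is (ishomog1 d (@mdeg m)))).
- exact: dhomog1.
- by move=> p1 d1 p2 d2; exact: dhomogM.
move=> i _; rewrite -[X in ishomog1 X]mul1n; apply: dhomogMn.
rewrite tnth_map tnth_ord_tuple; apply: rpredB; first by rewrite dhomogX; apply/eqP/mdeg1.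
by apply: rpredZ; exact: dhomog_lform.
Qed.

(** A linear substitution maps monomials to homogeneous polynomials of the same degree. This keeps
    the Euler operator inside the polynomials of bounded degree. *)
Lemma mcoeff_msigma_gt a p mu n : (msize p <= n)%N -> (n <= mdeg mu)%N ->
  mcoeff mu (msigma a p) = 0.
Proof.
move=> pn nmu; rewrite [p]mpolyE (big_morph _ (msigmaD a) (msigmaC a 0)) raddf_sum /=.
rewrite big_seq big1// => nu nup; rewrite msigmaZ mcoeffZ (dhomog_nemf_coeff (dhomog_msigmaX a nu)) ?mulr0//.
rewrite neq_ltn; apply/orP; right.
exact: leq_trans (msize_mdeg_lt nup) (leq_trans pn nmu).
Qed.

Lemma is_derive_peval p j x :
  is_derive (0 : R) (1 : R) (fun t => peval p (x + t *: ej R j)) (peval (mderiv j p) x).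
Proof.
elim/mpoly_alg_ind: p => [c|p q hp hq|p q hp hq|i].
- rewrite mderivC peval0 (_ : (fun _ => _) = cst c); first exact: is_derive_cst.
  by apply/funext => t; rewrite pevalC.
- rewrite mderivD pevalD (_ : (fun _ => _) = (fun t => peval p (x + t *: ej R j)) +
      (fun t => peval q (x + t *: ej R j))); first exact: is_deriveD.
  by apply/funext => t; rewrite pevalD.
- rewrite mderivM (_ : (fun _ => _) = (fun t => peval p (x + t *: ej R j)) *
      (fun t => peval q (x + t *: ej R j))); last by apply/funext => t; rewrite pevalM.
  apply: is_derive_eq.
  by rewrite pevalD !pevalM scale0r addr0 addrC; congr (_ + _); exact: mulrC.
- rewrite mderivX mnm1E.
  rewrite (_ : (fun _ => _) = (fun t => x ord0 i + ej R j ord0 i * t)); last first.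
    by apply/funext => t; rewrite pevalXU !mxE mulrC.
  apply: is_derive_eq.
  rewrite add0r pevalZ mxE mul1r; have [->|ij] := eqVneq i j.
    rewrite (_ : mnm_sub _ _ = mnm0); last by apply/mnmP => k; rewrite mnmBE subnn mnm0E.
    by rewrite mpolyX0 peval1 scale1r mulr1.
  by rewrite mul0r scale0r.
Qed.

Lemma peval_at0 p : peval p 0 = mcoeff mnm0 p.
Proof.
elim/mpoly_alg_ind: p => [c|p q hp hq|p q hp hq|i].
- by rewrite pevalC mcoeffC eqxx mulr1.
- by rewrite pevalD mcoeffD hp hq.
- by rewrite pevalM hp hq -rmorphM.
- by rewrite pevalXU mxE mcoeffX mnm1_eq0.
Qed.

(** Induction on the degree of the coefficient: the value at 0 is the constant coefficient, and the
    partial derivatives of [p] vanish identically too. *)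
Lemma peval_eq0 p : (forall x, peval p x = 0) -> p = 0.
Proof.
move=> p0; apply/mpolyP => nu; rewrite mcoeff0.
elim: {nu}(mdeg nu) {-2}nu (erefl (mdeg nu)) p p0 => [|n ih] nu nun p p0.
  by move/eqP: nun; rewrite mdeg_eq0 => /eqP ->; rewrite -peval_at0.
have [i nui] : exists i, (0 < nu i)%N.
  apply/existsP; apply: contraPT nun => /existsPn h; rewrite mdegE big1// => i _.
  by apply/eqP; rewrite -leqn0 leqNgt h.
have nuE : nu = mnm_add (mnm_sub nu (mnm1 i)) (mnm1 i).
  apply/mnmP => k; rewrite mnmDE mnmBE mnm1E; case: eqP => [<-|_]; last by rewrite subn0 addn0.
  by rewrite subnK.
have dn : mdeg (mnm_sub nu (mnm1 i)) = n.
  by move: nun; rewrite {1}nuE mdegD mdeg1 addn1 => -[].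
have dp0 x : peval (mderiv i p) x = 0.
  have h := is_derive_peval p i x.
  rewrite -(@derive_val _ _ _ _ _ _ _ h).
  rewrite (_ : (fun _ => _) = cst 0); last by apply/funext => t; rewrite p0.
  exact: derive_val.
have /eqP := ih _ dn _ dp0.
by rewrite mcoeff_deriv -nuE -mulr_natr mulf_eq0 pnatr_eq0 orbF => /eqP.
Qed.

End PolynomialTools.

Section DunklOnPolynomials.
Variables (R : realType) (m : nat).
Implicit Types (p q : mpoly m R) (x y a : 'rV[R]_m).

(** The Euclidean norm, because its balls are stable under all reflections. *)
Definition vnorm x : R := Num.sqrt (dotv x x).
Definition inball (rho : R) x := vnorm x <= rho.

Lemma vnorm_ge0 x : 0 <= vnorm x. Proof. exact: sqrtr_ge0. Qed.

Lemma coord_le_vnorm x i : `|x ord0 i| <= vnorm x.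
Proof.
rewrite -sqrtr_sqr ler_wsqrtr// /dotv (bigD1 i)//= expr2 lerDl.
by apply: sumr_ge0 => j _; rewrite -expr2 sqr_ge0.
Qed.

Lemma vnorm_refl a x : dotv a a != 0 -> vnorm (refl a x) = vnorm x.
Proof. by move=> a0; rewrite /vnorm refl_isom. Qed.

Lemma vnormZ c x : vnorm (c *: x) = `|c| * vnorm x.
Proof.
by rewrite /vnorm dotvZl dotvZr mulrA -expr2 sqrtrM ?sqr_ge0// sqrtr_sqr.
Qed.

Lemma vnorm_eq0 x : vnorm x = 0 -> x = 0.
Proof.
move=> /eqP; rewrite sqrtr_eq0 => h; apply: dotv_eq0; apply/eqP.
by rewrite eq_le h dotv_ge0.
Qed.

Lemma vnorm_ej i : vnorm (ej R i : 'rV[R]_m) = 1.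
Proof. by rewrite /vnorm dotv_ej mxE eqxx sqrtr1. Qed.

Lemma peval_bounded p rho : exists C, forall x, inball rho x -> `|peval p x| <= C.
Proof.
elim/mpoly_alg_ind: p => [c|p q [C hC] [D hD]|p q [C hC] [D hD]|i].
- by exists `|c| => x _; rewrite pevalC.
- by exists (C + D) => x hx; rewrite pevalD (le_trans (ler_normD _ _))// lerD ?hC ?hD.
- by exists (C * D) => x hx; rewrite pevalM normrM ler_pM ?hC ?hD.
- by exists rho => x hx; rewrite pevalXU (le_trans (coord_le_vnorm _ _)).
Qed.

Lemma peval_lipschitz p rho : exists C, forall x y, inball rho x -> inball rho y ->
  `|peval p x - peval p y| <= C * vnorm (x - y).
Proof.
elim/mpoly_alg_ind: p => [c|p q [C hC] [D hD]|p q [C hC] [D hD]|i].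
- by exists 0 => x y _ _; rewrite !pevalC subrr normr0 mul0r.
- exists (C + D) => x y hx hy; rewrite !pevalD opprD addrACA mulrDl.
  by rewrite (le_trans (ler_normD _ _))// lerD ?hC ?hD.
- have [A hA] := peval_bounded p rho; have [B hB] := peval_bounded q rho.
  exists (C * B + A * D) => x y hx hy; rewrite !pevalM.
  have -> : peval p x * peval q x - peval p y * peval q y =
    (peval p x - peval p y) * peval q x + peval p y * (peval q x - peval q y) by ring.
  rewrite (le_trans (ler_normD _ _))// !normrM mulrDl lerD//.
    by rewrite mulrAC ler_pM ?hC ?hB.
  by rewrite -mulrA ler_pM ?hA ?hD.
- exists 1 => x y _ _; rewrite !pevalXU mul1r.
  by have := coord_le_vnorm (x - y) i; rewrite !mxE.
Qed.

(** Products are handled by the twisted Leibniz rule [pq - s(pq) = (p - s p) q + s p (q - s q)],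
    where [s] is [msigma a]; a coordinate differs from its reflection by a multiple of [lform a]. *)
Lemma ddiff_ex a p : dotv a a != 0 -> exists d, p - msigma a p = lform a * d.
Proof.
move=> a0; elim/mpoly_alg_ind: p => [c|p q [C hC] [D hD]|p q [C hC] [D hD]|i].
- by exists 0; rewrite msigmaC subrr mulr0.
- by exists (C + D); rewrite msigmaD mulrDr -hC -hD; ring.
- exists (C * q + msigma a p * D); rewrite msigmaM.
  transitivity ((p - msigma a p) * q + msigma a p * (q - msigma a q)); first by ring.
  by rewrite hC hD; ring.
- exists (mpolyC m (2 * a ord0 i / dotv a a)).
  by rewrite msigmaXU opprB addrC subrK [RHS]mulrC [RHS]mul_mpolyC.
Qed.

(* The divided difference [(p - p o sigma_a) / <a,.>] as a polynomial. *)
Definition ddiff a p : mpoly m R := xget 0 [set d | p - msigma a p = lform a * d].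

Lemma ddiffE a p : dotv a a != 0 -> p - msigma a p = lform a * ddiff a p.
Proof.
move=> a0; rewrite /ddiff; case: xgetP => [d _ //|h].
by have [d hd] := ddiff_ex p a0; have := h d.
Qed.

Lemma lform_neq0 a : dotv a a != 0 -> lform a != 0.
Proof.
by move=> a0; apply: contraNneq a0 => h; rewrite -peval_lform h peval0.
Qed.

Lemma ddiff_unique a p d : dotv a a != 0 -> p - msigma a p = lform a * d -> ddiff a p = d.
Proof. by move=> a0; rewrite ddiffE// => /(mulfI (lform_neq0 a0)). Qed.

Lemma ddiffD a p q : dotv a a != 0 -> ddiff a (p + q) = ddiff a p + ddiff a q.
Proof.
move=> a0; apply: ddiff_unique => //.
by rewrite mulrDr -!ddiffE// msigmaD opprD addrACA.
Qed.

Lemma ddiffZ a c p : dotv a a != 0 -> ddiff a (c *: p) = c *: ddiff a p.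
Proof.
move=> a0; apply: ddiff_unique => //.
by rewrite -scalerAr -ddiffE// msigmaZ scalerBr.
Qed.

Lemma peval_cvg (T : Type) (F : set_system T) {FF : Filter F} (g : T -> 'rV[R]_m) p x :
  (forall i, g t ord0 i @[t --> F] --> x ord0 i) -> peval p (g t) @[t --> F] --> peval p x.
Proof.
move=> gx; elim/mpoly_alg_ind: p => [c|p q hp hq|p q hp hq|i].
- rewrite pevalC (_ : (fun _ => _) = fun=> c); first exact: cvg_cst.
  by apply/funext => t; rewrite pevalC.
- rewrite pevalD (_ : (fun _ => _) = fun t => peval p (g t) + peval q (g t)).
    exact: cvgD.
  by apply/funext => t; rewrite pevalD.
- rewrite pevalM (_ : (fun _ => _) = fun t => peval p (g t) * peval q (g t)).
    exact: cvgM.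
  by apply/funext => t; rewrite pevalM.
- rewrite pevalXU (_ : (fun _ => _) = fun t => g t ord0 i); first exact: gx.
  by apply/funext => t; rewrite pevalXU.
Qed.

(** The points [x + t *: a] with small [t != 0] lie off the hyperplane. Properness of this filter
    makes the limit in [dquot] unique. *)
Lemma within_dotv_proper a x : dotv a a != 0 -> dotv a x = 0 ->
  ProperFilter (within [set y | dotv a y != 0] (nbhs x)).
Proof.
move=> a0 ax; apply: (@Build_ProperFilter_ex _ _ _ (@within_filter _ _ _ (nbhs_filter x))) => B.
rewrite /within/= => nB.
have cv : x + t *: a @[t --> (0 : R)^'] --> x.
  rewrite -[X in _ --> X]addr0 -(scale0r a).
  apply: cvgD; first exact: cvg_cst.
  by apply: cvgZr_tmp; exact: nbhs_dnbhs.
near (0 : R)^' => t.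
exists (x + t *: a).
have : dotv a (x + t *: a) != 0 -> B (x + t *: a).
  by near: t; exact: (cv _ nB).
apply; rewrite dotvDr ax add0r dotvZr mulf_neq0//.
by near: t; exact: nbhs_dnbhs_neq.
Unshelve. all: by end_near.
Qed.

Lemma dquot_peval a p x : dotv a a != 0 ->
  dquot (fun y => RC (peval p y)) a x = RC (peval (ddiff a p) x).
Proof.
move=> a0.
have h y : dotv a y != 0 -> dquot0 (fun y => RC (peval p y)) a y = RC (peval (ddiff a p) y).
  move=> ay; rewrite /dquot0 -peval_msigma -RCB -pevalB ddiffE// pevalM peval_lform.
  by rewrite -RCV -RCM dotvC mulrAC divff// mul1r.
rewrite /dquot; case: ifPn => [/h//|/negPn/eqP ax].
have PF := within_dotv_proper a0 ax.
apply: cvgC_lim.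
apply: (@cvg_trans _ (RC (peval (ddiff a p) y) @[y --> within [set y | dotv a y != 0] (nbhs x)])).
  apply: near_eq_cvg; rewrite /prop_near1/= /within /=.
  by apply: nearW => y ay; rewrite h.
apply: cvgC_ReIm => /=; last exact: cvg_cst.
apply: peval_cvg => i; apply: cvg_trans (@coord_continuous _ _ _ ord0 i x).
by apply: cvg_app; exact: cvg_within.
Qed.

Lemma pdquot_RC (f : 'rV[R]_m -> R) j x d :
  is_derive (0 : R) (1 : R) (fun t => f (x + t *: ej R j)) d ->
  pdquot (fun y => RC (f y)) j x t @[t --> (0 : R)^'] --> (RC d : Cx R).
Proof.
move=> [df fd].
rewrite (_ : (fun _ => _) = fun t => RC (t^-1 * (f (x + t *: ej R j) - f x))); last first.
  by apply/funext => t; rewrite RCM RCV RCB.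
apply: cvgC_ReIm => /=; last exact: cvg_cst.
move: df => /cvg_ex[l hl]; have {fd} : l = d by rewrite -fd; apply/esym/cvg_lim.
move=> <-; apply: cvg_trans hl; apply: near_eq_cvg; apply: nearW => t /=.
by rewrite addr0 scale0r addr0 [t *: 1]mulr1.
Qed.

Lemma pd_peval p j x : has_pd (fun y => RC (peval p y)) j x /\
  pd (fun y => RC (peval p y)) j x = RC (peval (mderiv j p) x).
Proof.
have h := pdquot_RC (is_derive_peval p j x).
by split; [apply: cvgP h|exact: cvgC_lim h].
Qed.

Variables (Rt : seq 'rV[R]_m) (beta : 'rV[R]_m) (kappa : 'rV[R]_m -> R).
Hypothesis Rt0 : forall a, a \in Rt -> dotv a a != 0.

Definition pdunkl j p x : R := peval (mderiv j p) x +
  \sum_(a <- Rplus Rt beta) kappa a * a ord0 j * peval (ddiff a p) x.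

Lemma Rplus_neq0 a : a \in Rplus Rt beta -> dotv a a != 0.
Proof. by rewrite mem_filter => /andP[_ /Rt0]. Qed.

Lemma pdunklD j p q x : pdunkl j (p + q) x = pdunkl j p x + pdunkl j q x.
Proof.
rewrite /pdunkl mderivD pevalD addrACA -big_split/=; congr (_ + _).
by apply: eq_big_seq => a /Rplus_neq0 a0; rewrite ddiffD// pevalD mulrDr.
Qed.

Lemma pdunklZ j c p x : pdunkl j (c *: p) x = c * pdunkl j p x.
Proof.
rewrite /pdunkl mderivZ pevalZ mulrDr; congr (_ + _); rewrite [RHS]mulr_sumr.
by apply: eq_big_seq => a /Rplus_neq0 a0; rewrite ddiffZ// pevalZ; ring.
Qed.

Lemma dunkl_peval j p x :
  dunkl Rt beta kappa j (fun y => RC (peval p y)) x = RC (pdunkl j p x).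
Proof.
rewrite /dunkl (pd_peval p j x).2 /pdunkl RCD; congr (_ + _); rewrite [RHS]RC_sum.
by apply: eq_big_seq => a /Rplus_neq0 a0; rewrite (RCM (_ * _)) dquot_peval.
Qed.

End DunklOnPolynomials.

(** Stated for families over a finite type, since the unknowns below are coefficients indexed by
    multi-indices of bounded degree. *)
Lemma fin_inj_surj (F : fieldType) (I : finType) (M : I -> I -> F) :
  (forall u : I -> F, (forall i, \sum_j M i j * u j = 0) -> forall i, u i = 0) ->
  forall v : I -> F, exists u : I -> F, forall i, \sum_j M i j * u j = v i.
Proof.
move=> inj v; pose A := \matrix_(i < #|I|, j < #|I|) M (enum_val j) (enum_val i).
have mulA (u : 'rV[F]_#|I|) j : (u *m A) ord0 (enum_rank j) =
    \sum_i M j i * u ord0 (enum_rank i).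
  rewrite mxE (reindex (@enum_rank I))/=; last exact/onW_bij/enum_rank_bij.
  by apply: eq_bigr => i _; rewrite mxE !enum_rankK mulrC.
have Au : A \in unitmx.
  rewrite -row_free_unit -kermx_eq0; apply/eqP/row_matrixP => i; rewrite row0.
  have kA : row i (kermx A) *m A = 0 by rewrite -row_mul mulmx_ker row0.
  apply/rowP => k; rewrite [RHS]mxE -(enum_valK k).
  apply: (inj (fun j => row i (kermx A) ord0 (enum_rank j))) => j.
  by rewrite -mulA kA mxE.
pose w := (\row_j v (enum_val j)) *m invmx A.
exists (fun i => w ord0 (enum_rank i)) => i.
by rewrite -mulA mulmxKV// mxE enum_rankK.
Qed.

(** With [S] the supremum of [u], the hypothesis yields [(n + g) S <= g S + f], that is [n S <= f].
    The a priori bound [C] serves only to make [S] finite and leaves no trace in the result. *)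
Lemma sup_contraction (R : realType) (T : Type) (D : set T) (u : T -> R) (n g f : R) :
  0 < n -> 0 <= g -> (exists C, forall x, D x -> u x <= C) ->
  (forall S, (forall x, D x -> u x <= S) -> forall x, D x -> (n + g) * u x <= g * S + f) ->
  forall x, D x -> u x <= f / n.
Proof.
move=> n0 g0 [C hC] h x Dx.
pose S := sup (u @` D).
have hS y : D y -> u y <= S.
  by move=> Dy; apply: ub_le_sup; [exists C => _ [z Dz <-]; exact: hC|exists y].
have ng : 0 < n + g by rewrite ltr_wpDr.
have SS : S <= (g * S + f) / (n + g).
  apply: ge_sup; first by exists (u x), x.
  by move=> _ [y Dy <-]; rewrite ler_pdivlMr// mulrC; exact: h.
rewrite (le_trans (hS _ Dx))// ler_pdivlMr//.
by move: SS; rewrite ler_pdivlMr// mulrDr; lra.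
Qed.

(** * The contraction estimate for the Euler operator *)

Section EulerOperator.
Variables (R : realType) (m : nat).
Variables (Rt : seq 'rV[R]_m) (beta : 'rV[R]_m) (kappa : 'rV[R]_m -> R).
Hypothesis Rt0 : forall a, a \in Rt -> dotv a a != 0.
Hypothesis kappa_ge0 : forall a, a \in Rt -> 0 <= kappa a.
Notation Rp := (Rplus Rt beta).
Implicit Types (p q : mpoly m R) (x y : 'rV[R]_m) (nu : multinom m).

Definition gam : R := \sum_(a <- Rp) kappa a.

Lemma Rplus_sub a : a \in Rp -> a \in Rt.
Proof. by rewrite mem_filter => /andP[]. Qed.

Lemma gam_ge0 : 0 <= gam.
Proof.
rewrite /gam big_seq; apply: sumr_ge0 => a aR; apply: kappa_ge0.
exact: Rplus_sub.
Qed.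

Lemma inball_refl rho a x : a \in Rp -> inball rho (refl a x) <-> inball rho x.
Proof. by move=> /Rplus_sub/Rt0 a0; rewrite /inball vnorm_refl. Qed.

Lemma sum_kappa_le (f : 'rV[R]_m -> R) S : (forall a, a \in Rp -> f a <= S) ->
  \sum_(a <- Rp) kappa a * f a <= gam * S.
Proof.
move=> fS; rewrite /gam mulr_suml big_seq [leRHS]big_seq; apply: ler_sum => a aR.
by rewrite ler_wpM2l ?fS// kappa_ge0// Rplus_sub.
Qed.

(** Reflections map the ball to itself and [kappa] is nonnegative on the roots, so the reflected
    terms are at most [gam] times the supremum over the same ball. *)
Lemma euler_bound (w : 'rV[R]_m -> Cx R) (n : nat) (rho f : R) : (0 < n)%N ->
  (exists C, forall x, inball rho x -> cabs (w x) <= C) ->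
  (forall x, inball rho x -> cabs (RC (n%:R + gam) * w x -
     \sum_(a <- Rp) RC (kappa a) * w (refl a x)) <= f) ->
  forall x, inball rho x -> cabs (w x) <= f / n%:R.
Proof.
move=> n0 wC wf; apply: (@sup_contraction R _ (inball rho) (fun x => cabs (w x)) n%:R gam) => //.
- by rewrite ltr0n.
- exact: gam_ge0.
move=> S wS x hx; have := wf x hx.
have n0' : 0 <= n%:R + gam by rewrite addr_ge0// gam_ge0.
have : cabs (\sum_(a <- Rp) RC (kappa a) * w (refl a x)) <= gam * S.
  rewrite (le_trans (cabs_sum _ _ _))//.
  rewrite (@eq_big_seq _ _ _ _ _ _ (fun a => kappa a * cabs (w (refl a x)))); last first.
    by move=> a aR; rewrite cabsM cabsRC ger0_norm// kappa_ge0// Rplus_sub.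
  by apply: sum_kappa_le => a aR; apply: wS; apply/inball_refl.
have := cabsD (RC (n%:R + gam) * w x - \sum_(a <- Rp) RC (kappa a) * w (refl a x))
  (\sum_(a <- Rp) RC (kappa a) * w (refl a x)).
rewrite subrK cabsM cabsRC ger0_norm//; lra.
Qed.

Lemma euler_unique (w1 w2 h : 'rV[R]_m -> Cx R) (n : nat) (rho : R) : (0 < n)%N ->
  (exists C, forall x, inball rho x -> cabs (w1 x) <= C) ->
  (exists C, forall x, inball rho x -> cabs (w2 x) <= C) ->
  (forall x, inball rho x -> RC (n%:R + gam) * w1 x -
     \sum_(a <- Rp) RC (kappa a) * w1 (refl a x) = h x) ->
  (forall x, inball rho x -> RC (n%:R + gam) * w2 x -
     \sum_(a <- Rp) RC (kappa a) * w2 (refl a x) = h x) ->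
  forall x, inball rho x -> w1 x = w2 x.
Proof.
move=> n0 [C1 h1] [C2 h2] e1 e2 x hx; apply/eqP; rewrite -subr_eq0; apply/eqP/cabs_eq0/eqP.
rewrite eq_le cabs_ge0 andbT -(mul0r n%:R^-1).
apply: (@euler_bound (fun x => w1 x - w2 x) n rho 0) hx => //.
  exists (C1 + C2) => y hy; rewrite (le_trans (cabsB _ _))//.
  by rewrite lerD ?h1 ?h2.
move=> y hy; rewrite (_ : _ - _ = 0) ?cabs0//.
rewrite mulrBr (eq_bigr (fun a => RC (kappa a) * w1 (refl a y) - RC (kappa a) * w2 (refl a y))).
  rewrite sumrB; have := e1 _ hy; have := e2 _ hy.
  set s1 := \sum_(a <- _) _; set s2 := \sum_(a <- _) _ => E2 E1.
  by rewrite -[RHS](subrr (h y)) -{1}E1 -E2; ring.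
by move=> a _; rewrite mulrBr.
Qed.

End EulerOperator.

(** * The intertwining operator on polynomials *)

Section LinearExtension.
Variables (R : realType) (m : nat).
Implicit Types (p q : mpoly m R) (nu : multinom m).

Definition mlin (W : lmodType R) (v : multinom m -> W) p : W :=
  \sum_(nu <- msupp p) mcoeff nu p *: v nu.

Lemma mlinwE (W : lmodType R) (v : multinom m -> W) p k : (msize p <= k)%N ->
  mlin v p = \sum_(nu : bmultinom m k) mcoeff nu p *: v nu.
Proof.
move=> pk; rewrite /mlin (ssrcomplements.big_mksub (bmultinom m k)) /=; first last.
- by move=> nu; move/msize_mdeg_lt/leq_trans; apply.
- exact: msupp_uniq.
by rewrite big_rmcond //= => nu /memN_msupp_eq0 ->; rewrite scale0r.
Qed.

Lemma mlinD (W : lmodType R) (v : multinom m -> W) p q :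
  mlin v (p + q) = mlin v p + mlin v q.
Proof.
pose k := maxn (msize (p + q)) (maxn (msize p) (msize q)).
rewrite (@mlinwE _ _ (p + q) k) ?leq_maxl//.
rewrite (@mlinwE _ _ p k) ?leq_max ?leqnn ?orbT//.
rewrite (@mlinwE _ _ q k) ?leq_max ?leqnn ?orbT//.
by rewrite -big_split; apply: eq_bigr => nu _; rewrite mcoeffD scalerDl.
Qed.

Lemma mlinZ (W : lmodType R) (v : multinom m -> W) c p :
  mlin v (c *: p) = c *: mlin v p.
Proof.
pose k := maxn (msize (c *: p)) (msize p).
rewrite (@mlinwE _ _ (c *: p) k) ?leq_maxl// (@mlinwE _ _ p k) ?leq_maxr//.
by rewrite scaler_sumr; apply: eq_bigr => nu _; rewrite mcoeffZ scalerA.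
Qed.

Lemma mlin0 (W : lmodType R) (v : multinom m -> W) : mlin v 0 = 0.
Proof. by rewrite /mlin msupp0 big_nil. Qed.

Lemma mlinX (W : lmodType R) (v : multinom m -> W) nu : mlin v (mpolyX R nu) = v nu.
Proof. by rewrite /mlin msuppX big_seq1 mcoeffX eqxx scale1r. Qed.

Lemma mlin_sum (W : lmodType R) (v : multinom m -> W) (I : Type) (r : seq I)
    (F : I -> mpoly m R) : mlin v (\sum_(i <- r) F i) = \sum_(i <- r) mlin v (F i).
Proof. by apply: (big_morph (mlin v)) => [p q|]; rewrite ?mlinD ?mlin0. Qed.

Lemma mpoly_lin_ext (W : lmodType R) (f g : mpoly m R -> W) :
  (forall p q, f (p + q) = f p + f q) -> (forall c p, f (c *: p) = c *: f p) ->
  (forall p q, g (p + q) = g p + g q) -> (forall c p, g (c *: p) = c *: g p) ->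
  (forall nu, f (mpolyX R nu) = g (mpolyX R nu)) -> forall p, f p = g p.
Proof.
move=> fD fZ gD gZ fg; elim/mpolyind => [|c nu p _ _ ih].
  by rewrite -(scale0r 0) fZ gZ !scale0r.
by rewrite fD fZ gD gZ ih fg.
Qed.

End LinearExtension.

Section Intertwiner.
Variables (R : realType) (m : nat).
Variables (Rt : seq 'rV[R]_m) (beta : 'rV[R]_m) (kappa : 'rV[R]_m -> R).
Hypothesis Rt0 : forall a, a \in Rt -> dotv a a != 0.
Hypothesis kappa_ge0 : forall a, a \in Rt -> 0 <= kappa a.
Notation Rp := (Rplus Rt beta).
Notation gam := (gam Rt beta kappa).
Implicit Types (p q : mpoly m R) (x y : 'rV[R]_m) (nu mu : multinom m).

Definition eop (n : nat) p : mpoly m R :=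
  (n%:R + gam) *: p - \sum_(a <- Rp) kappa a *: msigma a p.

(** The same operator on arbitrary functions: it is also applied to maps of [x] that are not
    presented as polynomials, such as [W n x y] with [x] in the place of the linear form. *)
Definition feop (n : nat) (w : 'rV[R]_m -> R) x : R :=
  (n%:R + gam) * w x - \sum_(a <- Rp) kappa a * w (refl a x).

Lemma peval_eop n p x : peval (eop n p) x = feop n (peval p) x.
Proof.
rewrite /eop pevalB pevalZ peval_sum /feop; congr (_ - _).
by apply: eq_bigr => a _; rewrite pevalZ peval_msigma.
Qed.

Lemma mcoeff_eop n p mu : mcoeff mu (eop n p) =
  (n%:R + gam) * mcoeff mu p - \sum_(a <- Rp) kappa a * mcoeff mu (msigma a p).
Proof.
rewrite /eop mcoeffB mcoeffZ raddf_sum /=; congr (_ - _).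
by apply: eq_bigr => a _; rewrite mcoeffZ.
Qed.

Lemma feop_bound (w : 'rV[R]_m -> R) (n : nat) (rho f : R) : (0 < n)%N ->
  (exists C, forall x, inball rho x -> `|w x| <= C) ->
  (forall x, inball rho x -> `|feop n w x| <= f) ->
  forall x, inball rho x -> `|w x| <= f / n%:R.
Proof.
move=> n0 [C wC] wf x hx; rewrite -cabsRC.
apply: (@euler_bound R m Rt beta kappa Rt0 kappa_ge0 (fun x => RC (w x)) n rho f) => //.
  by exists C => y hy; rewrite cabsRC wC.
move=> y hy; rewrite (_ : _ - _ = RC (feop n w y)) ?cabsRC ?wf//.
rewrite /feop RCB RCM RC_sum; congr (_ - _).
by apply: eq_bigr => a _; rewrite RCM.
Qed.

Lemma eop_inj n p : (0 < n)%N -> eop n p = 0 -> p = 0.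
Proof.
move=> n0 e0; apply: peval_eq0 => x; apply/eqP; rewrite -normr_le0 -(mul0r n%:R^-1).
apply: (@feop_bound (peval p) n (vnorm x)) => //.
  exact: peval_bounded.
  by move=> y _; rewrite -peval_eop e0 peval0 normr0.
exact: lexx.
Qed.

(** On the finite-dimensional space of polynomials of degree at most [n] the operator is injective
    by the contraction estimate, hence onto. Coefficients of higher degree vanish because
    reflections preserve the degree. *)
Lemma eop_solve n f : (0 < n)%N -> (msize f <= n.+1)%N ->
  exists2 u, (msize u <= n.+1)%N & forall x, feop n (peval u) x = peval f x.
Proof.
move=> n0 fn.
pose M (mu nu : bmultinom m n.+1) := mcoeff mu (eop n (mpolyX R nu)).
pose P (u : bmultinom m n.+1 -> R) : mpoly m R := \sum_nu u nu *: mpolyX R nu.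
have Pcoeff u (mu : bmultinom m n.+1) : mcoeff mu (P u) = u mu.
  rewrite /P raddf_sum/= (bigD1 mu)//= mcoeffZ mcoeffX eqxx mulr1 big1 ?addr0// => nu numu.
  by rewrite mcoeffZ mcoeffX (inj_eq val_inj) (negbTE numu) mulr0.
have Psize u : (msize (P u) <= n.+1)%N.
  rewrite msizeE; apply/bigmax_leqP_seq => nu nuP _; rewrite ltnNge.
  apply: contraL nuP => nun; rewrite mcoeff_msupp negbK; apply/eqP.
  rewrite /P raddf_sum/= big1// => mu _; rewrite mcoeffZ mcoeffX.
  case: eqP => [h|_]; last by rewrite mulr0.
  by have := bmdeg mu; rewrite h ltnNge nun.
have LD mu p q : mcoeff mu (eop n (p + q)) = mcoeff mu (eop n p) + mcoeff mu (eop n q).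
  rewrite [LHS]mcoeff_eop [X in _ = X + _]mcoeff_eop [X in _ = _ + X]mcoeff_eop mcoeffD mulrDr.
  have -> : \sum_(a <- Rp) kappa a * mcoeff mu (msigma a (p + q)) =
      \sum_(a <- Rp) kappa a * mcoeff mu (msigma a p) +
      \sum_(a <- Rp) kappa a * mcoeff mu (msigma a q).
    by rewrite -big_split; apply: eq_bigr => a _; rewrite msigmaD mcoeffD mulrDr.
  by rewrite opprD addrACA.
have LZ mu c p : mcoeff mu (eop n (c *: p)) = c * mcoeff mu (eop n p).
  rewrite [LHS]mcoeff_eop [X in _ = _ * X]mcoeff_eop mcoeffZ mulrBr mulrCA; congr (_ - _).
  by rewrite [RHS]mulr_sumr; apply: eq_bigr => a _; rewrite msigmaZ mcoeffZ mulrCA.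
have L0 mu : mcoeff mu (eop n 0) = 0.
  by rewrite -(scale0r 0) LZ mul0r.
have coefM u (mu : bmultinom m n.+1) :
    mcoeff mu (eop n (P u)) = \sum_nu M mu nu * u nu.
  rewrite /P (big_morph (fun p => mcoeff mu (eop n p)) (LD mu) (L0 mu)).
  by apply: eq_bigr => nu _; rewrite LZ mulrC.
have big_coeff u mu : (n < mdeg mu)%N -> mcoeff mu (eop n (P u)) = 0.
  move=> nmu; rewrite mcoeff_eop (memN_msupp_eq0 (msize_mdeg_ge (leq_trans (Psize u) nmu))).
  rewrite mulr0 sub0r big1 ?oppr0// => a _.
  by rewrite (mcoeff_msigma_gt a (Psize u) nmu) mulr0.
have [|u hu] := @fin_inj_surj R _ M _ (fun mu : bmultinom m n.+1 => mcoeff mu f).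
  move=> u hu mu; rewrite -Pcoeff (@eop_inj n (P u))// ?mcoeff0//.
  apply/mpolyP => nu; rewrite mcoeff0; have [nun|] := ltnP (mdeg nu) n.+1.
    by have := coefM u (BMultinom nun); rewrite hu.
  exact: big_coeff.
exists (P u) => // x; rewrite -peval_eop; congr peval; apply/mpolyP => nu.
have [nun|nun] := ltnP (mdeg nu) n.+1.
  by have := coefM u (BMultinom nun); rewrite hu.
by rewrite big_coeff// (memN_msupp_eq0 (msize_mdeg_ge (leq_trans fn nun))).
Qed.

End Intertwiner.

(** * Linear functionals of geometric growth *)

Section Functionals.
Variables (R : realType) (m : nat).
Implicit Types (p q : mpoly m R) (x y : 'rV[R]_m) (nu mu : multinom m).
Implicit Types (lam : multinom m -> R).

(* A linear functional on polynomials is encoded by its values [lam] on monomials. *)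
Definition Lam lam p : R := mlin (lam : multinom m -> R^o) p.

Lemma LamD lam p q : Lam lam (p + q) = Lam lam p + Lam lam q.
Proof. exact: mlinD. Qed.
Lemma LamZ lam c p : Lam lam (c *: p) = c * Lam lam p.
Proof. exact: mlinZ. Qed.
Lemma LamX lam nu : Lam lam (mpolyX R nu) = lam nu.
Proof. exact: mlinX. Qed.
Lemma Lam_sum lam (I : Type) (r : seq I) (F : I -> mpoly m R) :
  Lam lam (\sum_(i <- r) F i) = \sum_(i <- r) Lam lam (F i).
Proof. exact: mlin_sum. Qed.
Lemma LamE lam p : Lam lam p = \sum_(nu <- msupp p) mcoeff nu p * lam nu.
Proof. by []. Qed.

Lemma Lam_add lam1 lam2 p :
  Lam (fun nu => lam1 nu + lam2 nu) p = Lam lam1 p + Lam lam2 p.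
Proof. by rewrite !LamE -big_split; apply: eq_bigr => nu _; rewrite mulrDr. Qed.

Lemma Lam_scale lam c p : Lam (fun nu => c * lam nu) p = c * Lam lam p.
Proof. by rewrite !LamE mulr_sumr; apply: eq_bigr => nu _; rewrite mulrCA. Qed.

Lemma Lam_ev x p : Lam (fun nu => peval (mpolyX R nu) x) p = peval p x.
Proof.
rewrite LamE [in RHS](mpolyE p) peval_sum; apply: eq_bigr => nu _.
by rewrite pevalZ.
Qed.

(** The transpose of multiplication by [q]. It lets one factor of a power of a linear form be moved
    to the functional at a time. *)
Definition mulf q lam : multinom m -> R := fun nu => Lam lam (q * mpolyX R nu).

Lemma Lam_mulf q lam p : Lam (mulf q lam) p = Lam lam (q * p).
Proof.
apply: (@mpoly_lin_ext R m R^o (Lam (mulf q lam)) (fun p => Lam lam (q * p))).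
- exact: LamD.
- exact: LamZ.
- by move=> p1 p2; rewrite mulrDr LamD.
- by move=> c p1; rewrite -scalerAr LamZ.
- by move=> nu; rewrite LamX.
Qed.

(** Growth with ratio [rho] in the degree is shared by the evaluations at points with coordinates at
    most [rho] and by the values at [z] of the intertwiner, with [rho = |z|]. *)
Definition bdd (rho C : R) lam := forall nu, `|lam nu| <= C * rho ^+ mdeg nu.
Definition n1 y : R := \sum_(i < m) `|y ord0 i|.

Lemma n1_ge0 y : 0 <= n1 y.
Proof. exact: sumr_ge0. Qed.

Lemma bdd_lform rho C lam y : bdd rho C lam -> bdd rho (C * (rho * n1 y)) (mulf (lform y) lam).
Proof.
move=> hl nu; rewrite /mulf /lform mulr_suml Lam_sum (le_trans (ler_norm_sum _ _ _))//.
rewrite /n1 !mulr_sumr mulr_suml; apply: ler_sum => i _.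
rewrite -scalerAl LamZ -mpolyXD LamX normrM.
have := hl (mnm_add (mnm1 i) nu); rewrite mdegD mdeg1 add1n exprS => h.
rewrite (le_trans (ler_wpM2l (normr_ge0 _) h))//.
by rewrite le_eqVlt; apply/orP; left; apply/eqP; ring.
Qed.

Lemma bdd_lformX rho C lam y n : bdd rho C lam ->
  bdd rho (C * (rho * n1 y) ^+ n) (mulf (lform y ^+ n) lam).
Proof.
move=> hl; elim: n => [|n ih].
  by move=> nu; rewrite !expr0 mulr1 /mulf mul1r LamX; exact: hl.
have -> : mulf (lform y ^+ n.+1) lam = mulf (lform y) (mulf (lform y ^+ n) lam).
  by apply/funext => nu; rewrite [RHS]Lam_mulf /mulf exprSr mulrA.
by rewrite exprSr [C * _]mulrA; exact: bdd_lform.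
Qed.

Lemma Lam_bdd1 rho C lam : bdd rho C lam -> `|Lam lam 1| <= C.
Proof. by move=> /(_ mnm0); rewrite mdeg0 expr0 mulr1 -mpolyX0 LamX. Qed.

Lemma Lam_lformX rho C lam y n : bdd rho C lam ->
  `|Lam lam (lform y ^+ n)| <= C * (rho * n1 y) ^+ n.
Proof. by move=> /(bdd_lformX y n)/Lam_bdd1; rewrite Lam_mulf mulr1. Qed.

Lemma n1_ej i : n1 (ej R i) = 1.
Proof.
rewrite /n1 (bigD1 i)//= mxE eqxx normr1 big1 ?addr0// => j ji.
by rewrite mxE (negbTE ji) normr0.
Qed.

Lemma n1Z c y : n1 (c *: y) = `|c| * n1 y.
Proof. by rewrite /n1 mulr_sumr; apply: eq_bigr => i _; rewrite mxE normrM. Qed.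

Lemma n1D x y : n1 (x + y) <= n1 x + n1 y.
Proof. by rewrite /n1 -big_split; apply: ler_sum => i _; rewrite mxE ler_normD. Qed.

Lemma dotv_le_n1 x y : `|dotv x y| <= vnorm x * n1 y.
Proof.
rewrite /dotv (le_trans (ler_norm_sum _ _ _))// /n1 mulr_sumr; apply: ler_sum => i _.
by rewrite normrM ler_wpM2r// coord_le_vnorm.
Qed.

End Functionals.

Section IntertwinerDef.
Variables (R : realType) (m : nat).
Variables (Rt : seq 'rV[R]_m) (beta : 'rV[R]_m) (kappa : 'rV[R]_m -> R).
Hypothesis Rt0 : forall a, a \in Rt -> dotv a a != 0.
Hypothesis kappa_ge0 : forall a, a \in Rt -> 0 <= kappa a.
Notation fe := (feop Rt beta kappa).
Implicit Types (p q : mpoly m R) (x y : 'rV[R]_m) (nu mu : multinom m).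

(* The image of [X^nu] under the intertwiner, [n = |nu|].  If [T_j V p = V (d_j p)], then
   [sum_j x_j T_j (V p)] gives this equation, Euler's identity with reflection terms; it is
   solvable in degree at most [n] because the operator [fe n] is injective. *)
Fixpoint vrec (n : nat) nu : mpoly m R :=
  if n is n'.+1 then xget 0 [set u | (msize u <= n.+1)%N /\ forall x,
    fe n (peval u) x = \sum_(j < m) (nu j)%:R *
       (x ord0 j * peval (vrec n' (mnm_sub nu (mnm1 j))) x)]
  else 1.

Lemma vrec_spec n nu : (msize (vrec n nu) <= n.+1)%N /\ ((0 < n)%N -> forall x,
    fe n (peval (vrec n nu)) x = \sum_(j < m) (nu j)%:R *
       (x ord0 j * peval (vrec n.-1 (mnm_sub nu (mnm1 j))) x)).
Proof.
elim: n nu => [|n ih] nu; first by rewrite /= msize1.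
pose f := \sum_(j < m) (nu j)%:R *: (mpolyX R (mnm1 j) * vrec n (mnm_sub nu (mnm1 j))).
have fs : (msize f <= n.+2)%N.
  rewrite /f; apply: (leq_trans (mmeasure_sum _ _ _ _)); apply/bigmax_leqP => j _.
  apply: (leq_trans (mmeasureZ_le _ _ _)); have [h _] := ih (mnm_sub nu (mnm1 j)).
  have [->|v0] := eqVneq (vrec n (mnm_sub nu (mnm1 j))) 0; first by rewrite mulr0 msize0.
  by rewrite msizeM// ?msizeX ?mdeg1// -msize_poly_eq0 msizeX.
have [u us hu] := @eop_solve R m Rt beta kappa Rt0 kappa_ge0 n.+1 f (ltn0Sn n) fs.
rewrite [vrec n.+1 nu]/= ; case: xgetP => [v _ [vs hv]//|/(_ u)[]]; split=> // x.
rewrite hu /f peval_sum; apply: eq_bigr => j _.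
by rewrite pevalZ pevalM pevalXU.
Qed.

Definition vnu nu := vrec (mdeg nu) nu.
Definition intertwiner p : mpoly m R := mlin vnu p.

Lemma V_eval p x : peval (intertwiner p) x = Lam (fun nu => peval (vnu nu) x) p.
Proof. by rewrite /intertwiner /mlin peval_sum LamE; apply: eq_bigr => nu _; rewrite pevalZ. Qed.

Lemma vnu_rec nu x : (0 < mdeg nu)%N -> fe (mdeg nu) (peval (vnu nu)) x =
  \sum_(j < m) (nu j)%:R * (x ord0 j * peval (vnu (mnm_sub nu (mnm1 j))) x).
Proof.
move=> nu0; have [_ /(_ nu0 x) ->] := vrec_spec (mdeg nu) nu.
(* If [nu j = 0], the truncated subtraction does not lower the degree, but the coefficient kills the
   term. *)
apply: eq_bigr => j _; have [->|nuj] := posnP (nu j); first by rewrite !mul0r.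
congr (_ * (_ * peval _ x)); rewrite /vnu; congr vrec.
rewrite -[in LHS](@submK _ (mnm1 j) nu) ?mdegD ?mdeg1 ?addn1//.
by rewrite lep1mP -lt0n.
Qed.

(** In degree [n + 1] the right side of the recursion is at most [sum_j nu_j rho rho^n = (n + 1)
    rho^(n + 1)], and the contraction estimate divides by exactly [n + 1]; so the constant stays 1
    in all degrees. *)
Lemma vnu_bound rho x nu : inball rho x -> `|peval (vnu nu) x| <= rho ^+ mdeg nu.
Proof.
move=> hx; have rho0 : 0 <= rho := le_trans (vnorm_ge0 x) hx.
elim: {nu}(mdeg nu) {-2}nu (erefl (mdeg nu)) x hx => [|n ih] nu nun x hx.
  by rewrite /vnu nun /= peval1 normr1 expr0.
rewrite nun (_ : rho ^+ n.+1 = n.+1%:R * rho ^+ n.+1 / n.+1%:R); last first.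
  by rewrite mulrAC divff ?mul1r// pnatr_eq0.
apply: (@feop_bound R m Rt beta kappa Rt0 kappa_ge0 (peval (vnu nu)) n.+1 rho) => //.
  exact: peval_bounded.
move=> y hy; rewrite -{1}nun vnu_rec ?nun//.
rewrite (le_trans (ler_norm_sum _ _ _))//.
rewrite -nun mdegE natr_sum mulr_suml; apply: ler_sum => j _.
have [->|nuj] := posnP (nu j); first by rewrite !mul0r normr0.
rewrite normrM ger0_norm// ler_wpM2l// normrM -mdegE nun exprS ler_pM//.
  exact: le_trans (coord_le_vnorm _ _) hy.
have dn : mdeg (mnm_sub nu (mnm1 j)) = n.
  move: nun; rewrite -[in X in X -> _](@submK _ (mnm1 j) nu) ?mdegD ?mdeg1 ?addn1; first by case.
  by rewrite lep1mP -lt0n.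
by rewrite -[in leRHS]dn; apply: ih.
Qed.

Lemma V_bdd rho x : inball rho x -> bdd rho 1 (fun nu => peval (vnu nu) x).
Proof. by move=> hx nu; rewrite mul1r vnu_bound. Qed.

Lemma feop_sum n (I : Type) (r : seq I) (c : I -> R) (w : I -> 'rV[R]_m -> R) x :
  fe n (fun x => \sum_(i <- r) c i * w i x) x = \sum_(i <- r) c i * fe n (w i) x.
Proof.
rewrite /feop [RHS](eq_bigr (fun i => (n%:R + gam Rt beta kappa) * (c i * w i x) -
  \sum_(a <- Rplus Rt beta) kappa a * (c i * w i (refl a x)))); last first.
  move=> i _; rewrite mulrBr mulrCA; congr (_ - _).
  by rewrite mulr_sumr; apply: eq_bigr => a _; rewrite mulrCA.
rewrite [RHS]sumrB -mulr_sumr; congr (_ - _); rewrite [RHS]exchange_big/=.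
by apply: eq_bigr => a _; rewrite mulr_sumr.
Qed.

Lemma V_rec n p x : p \is (ishomog1 n (@mdeg m)) -> (0 < n)%N ->
  fe n (peval (intertwiner p)) x = \sum_(j < m) x ord0 j * peval (intertwiner (mderiv j p)) x.
Proof.
move=> hp n0.
rewrite (_ : peval (intertwiner p) = fun x => \sum_(nu <- msupp p) mcoeff nu p * peval (vnu nu) x);
  last by apply/funext => y; rewrite V_eval LamE.
rewrite feop_sum.
rewrite (eq_bigr (fun j => \sum_(nu <- msupp p) mcoeff nu p *
   (x ord0 j * ((nu j)%:R * peval (vnu (mnm_sub nu (mnm1 j))) x)))); last first.
  move=> j _; rewrite V_eval {1}[p]mpolyE raddf_sum/= Lam_sum mulr_sumr.
  by apply: eq_bigr => nu _; rewrite mderivZ mderivX !LamZ LamX mulrCA.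
rewrite exchange_big/=; apply: eq_big_seq => nu nup.
have <- := dhomog_mf hp nup; rewrite vnu_rec; last by rewrite (dhomog_mf hp nup).
by rewrite mulr_sumr; apply: eq_bigr => j _; rewrite [x ord0 j * (_ * _)]mulrCA.
Qed.

Definition kernel_coef n y x : R := peval (intertwiner (lform y ^+ n)) x.

Lemma W0 y x : kernel_coef 0 y x = 1.
Proof. by rewrite /kernel_coef expr0 V_eval -mpolyX0 LamX /vnu mdeg0 /= peval1. Qed.

Lemma W_rec n y x : fe n.+1 (kernel_coef n.+1 y) x = n.+1%:R * (dotv x y * kernel_coef n y x).
Proof.
rewrite /kernel_coef (@V_rec n.+1); [|by rewrite -[X in ishomog1 X]mul1n; apply: dhomogMn; exact: dhomog_lform|by []].
rewrite /dotv mulr_suml mulr_sumr; apply: eq_bigr => j _.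
rewrite mderiv_expr mderiv_lform [_ * mpolyC _ _]mulrC mul_mpolyC !V_eval !LamZ.
by ring.
Qed.

Lemma W_scale n c y x : kernel_coef n (c *: y) x = c ^+ n * kernel_coef n y x.
Proof. by rewrite /kernel_coef lformZ exprZn !V_eval LamZ. Qed.

Lemma W_bound rho n y x : inball rho x -> `|kernel_coef n y x| <= (rho * n1 y) ^+ n.
Proof.
move=> /V_bdd h; rewrite /kernel_coef V_eval.
by have := Lam_lformX y n h; rewrite mul1r.
Qed.

End IntertwinerDef.

(** * Equivariance, symmetry and Lipschitz bounds of the kernel coefficients *)

Section RootSums.
Variables (R : realType) (m : nat).
Variables (Rt : seq 'rV[R]_m) (beta : 'rV[R]_m) (kappa : 'rV[R]_m -> R).
Hypothesis HR : root_system Rt.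
Hypothesis Hbeta : regular_vector Rt beta.
Hypothesis Hkap : G_invariant Rt kappa.
Hypothesis kappa_ge0 : forall a, a \in Rt -> 0 <= kappa a.
Notation Rp := (Rplus Rt beta).
Notation fe := (feop Rt beta kappa).
Implicit Types (x y a b : 'rV[R]_m).

Lemma root_neq0 a : a \in Rt -> dotv a a != 0.
Proof.
case: HR => _ R0 _ _ aR; apply: contraNneq R0 => /dotv_eq0 a0.
by rewrite -a0.
Qed.

Lemma refl_self a : dotv a a != 0 -> refl a a = - a.
Proof. by move=> a0; rewrite /refl mulfK// scaler_nat mulr2n opprD addNKr. Qed.

Lemma root_opp a : (- a \in Rt) = (a \in Rt).
Proof.
have h b : b \in Rt -> - b \in Rt.
  by move=> bR; case: HR => _ _ hs _; rewrite -scaleN1r hs// eqxx orbT.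
by apply/idP/idP => [/h|/h//]; rewrite opprK.
Qed.

Lemma refl_root a b : a \in Rt -> b \in Rt -> refl a b \in Rt.
Proof. by case: HR => _ _ _; apply. Qed.

Lemma kappa_refl a b : a \in Rt -> b \in Rt -> kappa (refl b a) = kappa a.
Proof. by move=> aR bR; have := Hkap (w := [:: b]); rewrite /= bR => /(_ isT a aR). Qed.

Lemma kappa_opp a : a \in Rt -> kappa (- a) = kappa a.
Proof. by move=> aR; rewrite -refl_self ?root_neq0// kappa_refl. Qed.

Lemma refl_opp a x : refl (- a) x = refl a x.
Proof. by rewrite -scaleN1r refl_scale// oppr_eq0 oner_eq0. Qed.

(** As [beta] is regular, exactly one of [a] and [- a] is positive. The full system is the better
    index set because reflections permute it, whereas they need not preserve the positive roots. *)
Lemma sum_Rplus (f : 'rV[R]_m -> R) : (forall a, a \in Rt -> f (- a) = f a) ->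
  \sum_(a <- Rt) f a = 2 * \sum_(a <- Rp) f a.
Proof.
move=> fN; have [uR _ _ _] := HR.
rewrite (bigID (fun a => 0 < dotv a beta))/= -[X in X + _]big_filter.
rewrite mulrDl !mul1r; congr (_ + _).
rewrite -big_filter.
rewrite (perm_big [seq - a | a <- Rp]); last first.
  apply: uniq_perm; first exact: filter_uniq.
    by rewrite map_inj_uniq ?filter_uniq//; exact: oppr_inj.
  move=> a; rewrite mem_filter; apply/idP/idP.
    move=> /andP[a0 aR]; apply/mapP; exists (- a); last by rewrite opprK.
    rewrite mem_filter root_opp aR andbT dotvNl oppr_gt0 lt_neqAle.
    by rewrite Hbeta//= leNgt.
  move=> /mapP[b]; rewrite mem_filter => /andP[b0 bR] ->.
  by rewrite root_opp bR andbT dotvNl oppr_gt0 -leNgt ltW.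
rewrite big_map; apply: eq_big_seq => a; rewrite mem_filter => /andP[_ aR].
by rewrite fN.
Qed.

Lemma sum_refl b (f : 'rV[R]_m -> R) : b \in Rt ->
  \sum_(a <- Rt) f (refl b a) = \sum_(a <- Rt) f a.
Proof.
move=> bR; have [uR _ _ _] := HR; rewrite -(big_map (refl b) xpredT f).
apply: perm_big; apply: uniq_perm => //.
  by rewrite map_inj_uniq//; exact: (can_inj (reflK (root_neq0 bR))).
move=> a; apply/idP/idP => [/mapP[c cR ->]|aR]; first exact: refl_root.
by apply/mapP; exists (refl b a); rewrite ?refl_root// reflK// root_neq0.
Qed.

Lemma refl_conj a b x : dotv b b != 0 ->
  refl (refl b a) (refl b x) = refl b (refl a x).
Proof.
by move=> b0; rewrite {1}/refl !refl_isom// -reflZ -reflB.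
Qed.

(** After passing to the full system, the sum is reindexed by [refl b], and the reflection in
    [refl b a] is the conjugate by [refl b] of the reflection in [a]. *)
Lemma sum_Rplus_conj b (F : 'rV[R]_m -> R) x : b \in Rt ->
  \sum_(a <- Rp) kappa a * F (refl b (refl a x)) =
  \sum_(a <- Rp) kappa a * F (refl a (refl b x)).
Proof.
move=> bR; have b0 := root_neq0 bR.
have hN (G : 'rV[R]_m -> 'rV[R]_m) (y : 'rV[R]_m) a : a \in Rt ->
    kappa (- a) * F (G (refl (- a) y)) = kappa a * F (G (refl a y)).
  by move=> aR; rewrite kappa_opp// refl_opp.
apply: (@mulfI R 2); first by rewrite pnatr_eq0.
rewrite -(@sum_Rplus (fun a => kappa a * F (refl b (refl a x)))); last exact: (hN (refl b)).
rewrite -(@sum_Rplus (fun a => kappa a * F (refl a (refl b x)))); last exact: (hN id).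
rewrite -(@sum_refl b (fun a => kappa a * F (refl a (refl b x))))//.
by apply: eq_big_seq => a aR; rewrite kappa_refl// refl_conj.
Qed.

Let Rt0 := root_neq0.

Lemma feop_unique (w1 w2 : 'rV[R]_m -> R) (n : nat) (rho : R) : (0 < n)%N ->
  (exists C, forall x, inball rho x -> `|w1 x| <= C) ->
  (exists C, forall x, inball rho x -> `|w2 x| <= C) ->
  (forall x, inball rho x -> fe n w1 x = fe n w2 x) ->
  forall x, inball rho x -> w1 x = w2 x.
Proof.
move=> n0 [C1 h1] [C2 h2] e12 x hx; apply/eqP; rewrite -subr_eq0 -normr_le0.
rewrite -(mul0r n%:R^-1).
apply: (@feop_bound R m Rt beta kappa Rt0 kappa_ge0 (fun x => w1 x - w2 x) n rho) hx => //.
  exists (C1 + C2) => y hy; rewrite (le_trans (ler_normB _ _))//.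
  by rewrite lerD ?h1 ?h2.
move=> y hy; have -> : fe n (fun x => w1 x - w2 x) y = fe n w1 y - fe n w2 y.
  rewrite /feop (eq_bigr (fun a => kappa a * w1 (refl a y) - kappa a * w2 (refl a y))).
    by rewrite sumrB; ring.
  by move=> a _; rewrite mulrBr.
by rewrite e12// subrr normr0.
Qed.

Notation W := (@kernel_coef R m Rt beta kappa).

Let Wrec := W_rec beta Rt0 kappa_ge0.

Lemma W_bounded n y rho : exists C, forall x, inball rho x -> `|W n y x| <= C.
Proof.
by exists ((rho * n1 y) ^+ n) => x hx; exact: (W_bound beta Rt0 kappa_ge0).
Qed.

(* Both sides satisfy [W_rec], whose bounded solutions are unique; the same idea proves the
   symmetry below. *)
Lemma W_equivariant n b y x : b \in Rt -> W n (refl b y) (refl b x) = W n y x.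
Proof.
move=> bR; have b0 := root_neq0 bR.
elim: n x => [|n ih] x; first by rewrite !W0.
apply: (@feop_unique (fun x => W n.+1 (refl b y) (refl b x)) (W n.+1 y) n.+1 (vnorm x)) => //.
- have [C hC] := W_bounded n.+1 (refl b y) (vnorm x); exists C => z hz.
  by apply: hC; rewrite /inball vnorm_refl.
- exact: W_bounded.
- move=> z _; rewrite Wrec -ih -(refl_isom z y b0) -Wrec /feop.
  by rewrite sum_Rplus_conj.
- exact: lexx.
Qed.

Lemma W_symmetric n y x : W n y x = W n x y.
Proof.
elim: n x => [|n ih] x; first by rewrite !W0.
(* Equivariance moves the reflection from one argument to the other, so that both functions have the
   same reflection terms; their right sides agree by the induction hypothesis and the symmetry of
   [dotv]. *)
have eqv a z : a \in Rp -> W n.+1 (refl a z) y = W n.+1 z (refl a y).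
  move=> /Rplus_sub aR; rewrite -(W_equivariant n.+1 (refl a z) y aR).
  by rewrite reflK// root_neq0.
apply: (@feop_unique (W n.+1 y) (fun x => W n.+1 x y) n.+1 (vnorm x)) => //.
- exact: W_bounded.
(* Here the varying point [z] is the linear form, and [n1 z <= m |z|] gives a bound uniform over the
   ball. *)
- exists ((vnorm y * (m%:R * vnorm x)) ^+ n.+1) => z hz.
  rewrite (le_trans (W_bound beta Rt0 kappa_ge0 n.+1 z (lexx (vnorm y))))//.
  rewrite lerXn2r ?nnegrE ?mulr_ge0 ?vnorm_ge0 ?n1_ge0//.
  rewrite ler_wpM2l ?vnorm_ge0// /n1.
  rewrite (le_trans (ler_sum _ (fun i _ => le_trans (coord_le_vnorm z i) hz)))//.
  by rewrite sumr_const card_ord -[X in X <= _]mulr_natl.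
- move=> z _; rewrite Wrec ih dotvC -Wrec /feop; congr (_ - _).
  by apply: eq_big_seq => a aR; rewrite eqv.
- exact: lexx.
Qed.

(* [sup_contraction] applied to the difference quotient on pairs of points. *)
Lemma W_lipschitz rho n y x x' : inball rho x -> inball rho x' ->
  `|W n y x - W n y x'| <= n%:R * n1 y * (rho * n1 y) ^+ n.-1 * vnorm (x - x').
Proof.
move=> hx hx'; have rho0 : 0 <= rho := le_trans (vnorm_ge0 x) hx.
elim: n x x' hx hx' => [|n ih] x x' hx hx'; first by rewrite !W0 subrr normr0 !mul0r.
have [xx|xx] := eqVneq x x'.
  by rewrite xx !subrr normr0 mulr_ge0 ?vnorm_ge0// !mulr_ge0// ?exprn_ge0 ?mulr_ge0 ?n1_ge0.
set t := rho * n1 y; have t0 : 0 <= t by rewrite mulr_ge0// n1_ge0.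
pose D := [set q : 'rV[R]_m * 'rV[R]_m | [/\ inball rho q.1, inball rho q.2 & q.1 != q.2]].
have dpos q : D q -> 0 < vnorm (q.1 - q.2).
  move=> [_ _ qq]; rewrite lt_neqAle vnorm_ge0 andbT eq_sym.
  by apply: contra_neq qq => /vnorm_eq0/eqP; rewrite subr_eq0 => /eqP.
pose u (q : 'rV[R]_m * 'rV[R]_m) := `|W n.+1 y q.1 - W n.+1 y q.2| / vnorm (q.1 - q.2).
(* The constant comes from differencing the right side [(n + 1) <x, y> W n y x] as a product: the
   first summand varies the linear form, the second is [t] times the Lipschitz constant of degree
   [n]. *)
have := @sup_contraction R _ D u n.+1%:R (gam Rt beta kappa)
  (n.+1%:R * (n1 y * t ^+ n + t * (n%:R * n1 y * t ^+ n.-1))).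
move=> /(_ (ltr0Sn _ _) (gam_ge0 beta kappa_ge0)) h.
have {h}h : u (x, x') <= n.+1%:R * (n1 y * t ^+ n + t * (n%:R * n1 y * t ^+ n.-1)) / n.+1%:R.
  apply: h => //.
    have [C hC] := peval_lipschitz (intertwiner Rt beta kappa (lform y ^+ n.+1)) rho.
    exists C => q Dq; rewrite /u ler_pdivrMr ?dpos//.
    by case: Dq => q1 q2 _; exact: hC.
  move=> S hS q Dq; have [q1 q2 qq] := Dq; have d0 := dpos _ Dq.
  rewrite /u [leLHS]mulrA ler_pdivrMr//.
  have n0' : 0 <= n.+1%:R + gam Rt beta kappa by rewrite addr_ge0// (gam_ge0 beta kappa_ge0).
  rewrite -{1}(ger0_norm n0') -normrM mulrBr.
  have e1 := Wrec n y q.1.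
  have e2 := Wrec n y q.2.
  rewrite /feop in e1 e2.
  move/eqP: e1; rewrite subr_eq => /eqP ->; move/eqP: e2; rewrite subr_eq => /eqP ->.
  rewrite opprD addrACA -sumrB -mulrBr.
  rewrite (le_trans (ler_normD _ _))// addrC mulrDl lerD//.
    rewrite (le_trans (ler_norm_sum _ _ _))// -mulrA.
    rewrite (@eq_big_seq _ _ _ _ _ _
      (fun a => kappa a * `|W n.+1 y (refl a q.1) - W n.+1 y (refl a q.2)|)); last first.
      by move=> a aR; rewrite -mulrBr normrM ger0_norm// kappa_ge0// (Rplus_sub aR).
    apply: sum_kappa_le => // a aR; have a0 := root_neq0 (Rplus_sub aR).
    have Da : D (refl a q.1, refl a q.2).
      split; rewrite /= ?/inball ?vnorm_refl//.
      by apply: contra_neq qq; exact: (can_inj (reflK a0)).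
    have := hS _ Da; rewrite /u /= -reflB vnorm_refl// ler_pdivrMr//.
  rewrite normrM normr_nat -[leRHS]mulrA ler_wpM2l//.
  have -> : dotv q.1 y * W n y q.1 - dotv q.2 y * W n y q.2 =
    dotv (q.1 - q.2) y * W n y q.1 + dotv q.2 y * (W n y q.1 - W n y q.2).
    by rewrite dotvBl; ring.
  rewrite (le_trans (ler_normD _ _))// mulrDl !normrM lerD//.
    rewrite [leRHS]mulrAC; apply: ler_pM => //.
      by rewrite mulrC; exact: dotv_le_n1.
    exact: (W_bound beta Rt0 kappa_ge0).
  rewrite -[leRHS]mulrA; apply: ler_pM => //; last exact: ih.
  by rewrite (le_trans (dotv_le_n1 _ _))// ler_wpM2r ?n1_ge0.
have Dx : D (x, x') by split.
move: h; rewrite /u /= ler_pdivrMr ?(dpos _ Dx)// => /le_trans; apply.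
rewrite ler_wpM2r ?vnorm_ge0// mulrAC divff ?pnatr_eq0// mul1r.
(* The case [n = 0] is apart because [t * t ^+ n.-1] is then not [t ^+ n]; the factor [n] removes
   the term. *)
case: n {ih D dpos u Dx} => [|n] /=; first by rewrite !mul0r mulr0 addr0 mul1r.
by rewrite le_eqVlt; apply/orP; left; apply/eqP; rewrite !exprS -[n.+2]addn1 natrD; ring.
Qed.

End RootSums.

(** * Homogeneous expansion of the Dunkl kernel *)

Section ComplexNbhs.
Variable R : realType.

Lemma nbhsC_cabs (z : Cx R) (P : set (Cx R)) : nbhs z P ->
  exists2 r : R, 0 < r & forall w, cabs (w - z) <= r -> P w.
Proof.
move=> /nbhs_ballP[e /= e0 he].
have eE : e = RC (complex.Re e) by have /complex_realP[k ->] := gtr0_real e0.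
have e0' : 0 < complex.Re e by rewrite eE in e0; rewrite ltcR in e0.
exists (complex.Re e / 2); first by rewrite divr_gt0.
move=> w wz; apply: he; rewrite /ball /= normC_cabs eE ltcR cabs_distC.
by rewrite (le_lt_trans wz)// ltr_pdivrMr// ltr_pMr// ltr1n.
Qed.

Lemma dnbhsC_cabs (P : set (Cx R)) : (\forall h \near (0 : Cx R)^', P h) ->
  exists2 r : R, 0 < r & forall h, h != 0 -> cabs h <= r -> P h.
Proof.
move=> /nbhsC_cabs[r r0 hr]; exists r => // h h0 hh; apply: hr => //.
by rewrite subr0.
Qed.

Lemma cvg_RC_dnbhs : (RC t : Cx R) @[t --> (0 : R)^'] --> (0 : Cx R)^'.
Proof.
move=> P /dnbhsC_cabs[r r0 hr]; rewrite !near_simpl.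
near=> t; apply: hr; first by rewrite RC_eq0; near: t; exact: nbhs_dnbhs_neq.
by rewrite cabsRC; near: t; exact: dnbhs0_le.
Unshelve. all: by end_near.
Qed.

End ComplexNbhs.

Section KernelExpansion.
Variables (R : realType) (m : nat).
Variables (Rt : seq 'rV[R]_m) (beta : 'rV[R]_m) (kappa : 'rV[R]_m -> R).
Variable E : 'rV[Cx R]_m -> 'rV[Cx R]_m -> Cx R.
Hypothesis HR : root_system Rt.
Hypothesis Hbeta : regular_vector Rt beta.
Hypothesis Hkap : G_invariant Rt kappa.
Hypothesis kappa_ge0 : forall a, a \in Rt -> 0 <= kappa a.
Hypothesis HE : is_Dunkl_kernel Rt beta kappa E.
Notation Rp := (Rplus Rt beta).
Notation W := (@kernel_coef R m Rt beta kappa).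
Implicit Types (x y a : 'rV[R]_m) (X Y U : 'rV[Cx R]_m).

Notation mRC := (map_mx (@RC R)).

Let EE (u : 'rV[Cx R]_m * 'rV[Cx R]_m) := E u.1 u.2.

Lemma kernel_directional X Y U :
  (h^-1 * (E (X + h *: U) Y - E X Y) : Cx R) @[h --> (0 : Cx R)^'] --> 'd EE (X, Y) (U, 0).
Proof.
have [dE _ _] := HE.
have d0 := dE (X, Y); rewrite -/EE in d0.
have := @diff_derivable _ _ _ EE (X, Y) (U, 0) d0.
rewrite -(deriveE (U, 0) d0) => h; apply: cvg_trans h.
apply: near_eq_cvg; apply: nearW => h /=.
by rewrite /EE /= scaler0 add0r [X + _]addrC.
Qed.

Lemma kernel_cdifferentiable Y U s : cdifferentiable (fun s => E (s *: U) Y) s.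
Proof.
exists ('d EE (s *: U, Y) (U, 0)) => e e0.
have /cvgC_cabs/cvgrPdist_le/(_ e e0)/dnbhsC_cabs[r r0 hr] :=
  @kernel_directional (s *: U) Y U.
exists r => // w wr; have [->|ws] := eqVneq w s.
  by rewrite !subrr mulr0 subrr cabs0 mulr0.
have h0 : w - s != 0 by rewrite subr_eq0.
have := hr _ h0 wr; rewrite sub0r normrN (ger0_norm (cabs_ge0 _)).
rewrite -scalerDl [s + _]addrC subrK => h.
have -> : E (w *: U) Y - E (s *: U) Y - 'd EE (s *: U, Y) (U, 0) * (w - s) =
  (w - s) * ((w - s)^-1 * (E (w *: U) Y - E (s *: U) Y) - 'd EE (s *: U, Y) (U, 0)).
  move: h0; move: (w - s) (E _ _ - E _ _) ('d _ _ _) => u1 u2 u3 u10.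
  by rewrite mulrBr mulVKf// [u3 * _]mulrC.
by rewrite cabsM mulrC ler_wpM2r// cabs_ge0.
Qed.

Local Notation g := (fun y x => E (mRC x) (mRC y)).

Lemma mRC_D x y : mRC (x + y) = mRC x + mRC y.
Proof. by apply/rowP => i; rewrite !mxE RCD. Qed.
Lemma mRC_Z c x : mRC (c *: x) = RC c *: mRC x.
Proof. by apply/rowP => i; rewrite !mxE RCM. Qed.

Lemma pd_kernel y j x : pd (g y) j x = 'd EE (mRC x, mRC y) (mRC (ej R j), 0).
Proof.
apply: cvgC_lim.
have h := cvg_comp _ _ (@cvg_RC_dnbhs R) (@kernel_directional (mRC x) (mRC y) (mRC (ej R j))).
apply: cvg_trans h; apply: near_eq_cvg; apply: nearW => t /=.
by rewrite /pdquot /g mRC_D mRC_Z.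
Qed.

Lemma directional_pd y x U : U = mRC x -> forall x0,
  'd EE (mRC x0, mRC y) (U, 0) = \sum_(j < m) RC (x ord0 j) * pd (g y) j x0.
Proof.
move=> -> x0.
pose L (Z : 'rV[Cx R]_m) : Cx R := 'd EE (mRC x0, mRC y) (Z, 0).
have LD Z1 Z2 : L (Z1 + Z2) = L Z1 + L Z2.
  rewrite /L -linearD; congr ('d EE _ _).
  by rewrite -[RHS]/(Z1 + Z2, 0 + 0) addr0.
have LZ c Z : L (c *: Z) = c * L Z.
  rewrite /L -[RHS]/(c *: _) -linearZ; congr ('d EE _ _).
  by rewrite -[RHS]/(c *: Z, c *: 0) scaler0.
have L0 : L 0 = 0 by rewrite -(scale0r 0) LZ mul0r.
rewrite -/(L (mRC x)).
have -> : mRC x = \sum_(j < m) RC (x ord0 j) *: mRC (ej R j).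
  rewrite {1}[x]row_ej (big_morph _ mRC_D (_ : mRC 0 = 0)); last first.
    by apply/rowP => i; rewrite !mxE.
  by apply: eq_bigr => j _; rewrite mRC_Z.
rewrite (big_morph L LD L0); apply: eq_bigr => j _.
by rewrite LZ pd_kernel.
Qed.

(** On the hyperplane both sides are zero, whatever value the limit in [dquot] takes there. *)
Lemma dquot_euler (f : 'rV[R]_m -> Cx R) a x : RC (dotv a x) * dquot f a x = f x - f (refl a x).
Proof.
rewrite /dquot; case: ifPn => [ax|/negPn/eqP ax].
  by rewrite /dquot0 mulrCA mulfV ?mulr1// RC_eq0.
rewrite ax mul0r /refl dotvC ax mulr0 mul0r scale0r subr0 subrr; done.
Qed.

(** The equations [T_j E = y_j E] are multiplied by [x_j] and summed: the factor [<a, x>] that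
    appears clears the denominators of the reflection quotients. *)
Lemma kernel_euler y x : \sum_(j < m) RC (x ord0 j) * pd (g y) j x =
  RC (dotv x y) * g y x - \sum_(a <- Rp) RC (kappa a) * (g y x - g y (refl a x)).
Proof.
have [_ _ hD] := HE.
have h j : pd (g y) j x = RC (y ord0 j) * g y x -
    \sum_(a <- Rp) RC (kappa a * a ord0 j) * dquot (g y) a x.
  have [_ ] := hD (mRC y) j x; rewrite /dunkl mxE -/(g y x) => <-.
  by rewrite addrK.
rewrite (eq_bigr (fun j => RC (x ord0 j * y ord0 j) * g y x - \sum_(a <- Rp)
  RC (kappa a) * (RC (a ord0 j * x ord0 j) * dquot (g y) a x))); last first.
  move=> j _; rewrite h mulrBr mulrA -RCM; congr (_ - _).
  by rewrite mulr_sumr; apply: eq_bigr => a _; rewrite !RCM; ring.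
rewrite sumrB -mulr_suml -RC_sum; congr (_ - _); rewrite exchange_big/=.
apply: eq_bigr => a _; rewrite -mulr_sumr; congr (_ * _).
by rewrite -mulr_suml -RC_sum -/(dotv a x) dquot_euler.
Qed.

(** Continuity at a point where [E] is 1. The bound holds over a whole polydisc in the first
    argument, which makes the Taylor bounds uniform over all rays in a ball. *)
Lemma kernel_locally_bounded Y : exists2 r : R, 0 < r &
  forall X, (forall i, cabs (X ord0 i) <= r) -> cabs (E X Y) <= 2.
Proof.
have [dE E0 _] := HE.
have /differentiable_continuous cE := dE (0, Y).
have hP : nbhs (EE (0, Y)) [set w : Cx R | cabs (w - 1) < 1].
  have -> : EE (0, Y) = 1 by rewrite /EE /= E0.
  have h1 : cabs (w - 1 : Cx R) @[w --> nbhs (1 : Cx R)] --> (0 : R).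
    by apply/(@cvgC_cabs R _ _ _ id 1); exact: cvg_id.
  move/cvgrPdist_lt: h1 => /(_ 1 ltr01); apply: filterS => w /=.
  by rewrite sub0r normrN (ger0_norm (cabs_ge0 _)).
have [[A B] /= [[P hPn PA] [P2 hP2 PB]] AB] := cE _ hP.
have [r r0 hr] : exists2 r : R, 0 < r &
    forall j : 'I_m, forall z : Cx R, cabs z <= r -> P ord0 j z.
  have h : \forall r \near (0 : R)^'+, forall j : 'I_m,
      forall z : Cx R, cabs z <= r -> P ord0 j z.
    apply: filter_forall => j.
    have /nbhsC_cabs[r r0 hr] := hPn ord0 j.
    near=> s => z zs; apply: hr; rewrite mxE subr0 (le_trans zs)//.
    by near: s; exact: nbhs_right_le.
  have h2 : \forall r \near (0 : R)^'+, 0 < r by exact: nbhs_right_gt.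
  by have [r [r1 r2]] := filter_ex (filterI h h2); exists r.
exists r => // X hX.
have /= /ltW h : cabs (E X Y - 1) < 1.
  apply: (AB (X, Y)); split => /=; last by apply: PB => i j; exact: nbhs_singleton (hP2 i j).
  by apply: PA => i j; rewrite ord1; apply: hr.
rewrite -[E X Y](subrK 1) (le_trans (cabsD _ _))//.
have -> : cabs (1 : Cx R) = 1 by rewrite -[1 : Cx R]/(RC 1) cabsRC normr1.
by have : 2 = 1 + 1 :> R; [by []|move=> ->; rewrite lerD].
Unshelve. all: by end_near.
Qed.

End KernelExpansion.

(** * Termwise operations on power series *)

Section PowerSeries.
Variable R : realType.
Implicit Types (c u : nat -> Cx R) (K s : R).

Lemma cvg_geometric_weight K q : 0 <= q < 1 -> cvgn (series (fun n => K * q ^+ n : R)).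
Proof. by move=> q1; apply: is_cvg_geometric_series; rewrite ger0_norm; case/andP: q1. Qed.

Lemma natr_le_exp2 n : n%:R <= 2 ^+ n :> R.
Proof. by rewrite -natrX ler_nat ltnW// ltn_expl. Qed.

Lemma dominated_pseries c K (a : Cx R) : (forall n, cabs (c n) <= K / 2 ^+ n) -> cabs a <= 1 ->
  dominated (fun n => c n * a ^+ n) (fun n => K * (1 / 2) ^+ n).
Proof.
move=> hc a1; split; last by apply: cvg_geometric_weight; lra.
move=> n; rewrite cabsM cabsX (le_trans (ler_wpM2l (cabs_ge0 _) (exprn_ile1 n (cabs_ge0 _) a1)))//.
by rewrite mulr1 (le_trans (hc n))// div1r exprVn.
Qed.

(** The derivative in the scaling factor [1 + t] multiplies the coefficient of degree [n] by [n]: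
    the quotient [((1 + t)^n - 1) / t] is a finite geometric sum with limit [n]. *)
Lemma pseries_scale_derive c K s : (forall n, cabs (c n) <= K / 2 ^+ n) -> 0 < s <= 1 / 2 ->
  ((RC t)^-1 * (csum (fun n => c n * RC ((1 + t) * s) ^+ n) - csum (fun n => c n * RC s ^+ n))
    : Cx R) @[t --> (0 : R)^'] --> csum (fun n => RC n%:R * c n * RC s ^+ n).
Proof.
move=> hc s12.
have cK n : cabs (c n) * s ^+ n <= K / 4 ^+ n.
  have -> : K / 4 ^+ n = K / 2 ^+ n * (1 / 2) ^+ n.
    by rewrite div1r exprVn -mulrA -invfM -exprMn; congr (_ / _ ^+ _); ring.
  by apply: ler_pM; rewrite ?cabs_ge0// ?exprn_ge0 ?lerXn2r ?nnegrE//; lra.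
have h : csum (fun n => (c n * RC s ^+ n) * RC (\sum_(i < n) (1 + t) ^+ i))
    @[t --> (0 : R)^'] --> csum (fun n => RC n%:R * c n * RC s ^+ n).
  (* With [s <= 1/2] a term is at most [K / 4^n], and with [|1 + t| <= 3/2] the geometric sum is at
     most [n (3/2)^n <= 2^n (3/2)^n]; the product is [K (3/4)^n]. *)
  apply: (@tannery _ _ _ _ _ _ (fun n => K * (3 / 4) ^+ n)); last by apply: cvg_geometric_weight; lra.
    move=> n; have -> : RC n%:R * c n * RC s ^+ n = (c n * RC s ^+ n) * RC n%:R by ring.
    apply: cvgM; first exact: cvg_cst.
    apply: continuous_cvg; first exact: continuous_RC.
    have -> : n%:R = \sum_(i < n) (1 + 0 : R) ^+ i.
      by rewrite addr0 (eq_bigr (fun=> 1)) ?sumr_const ?card_ord// => i _; rewrite expr1n.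
    apply: cvg_within_filter => /=.
    elim: n => [|n ih]; first by under eq_fun do rewrite big_ord0; rewrite big_ord0; exact: cvg_cst.
    rewrite big_ord_recr /=; under eq_fun do rewrite big_ord_recr /=.
    apply: cvgD; first exact: ih.
    apply: (cvg_comp (fun x : R => 1 + x) (fun x => x ^+ n)); last exact: exprn_continuous.
    by apply: cvgD; [exact: cvg_cst|exact: cvg_id].
  near=> t => n.
  have t1 : `|t| <= 1 / 2 by near: t; apply: dnbhs0_le; lra.
  have t2 : `|1 + t| <= 3 / 2 by rewrite (le_trans (ler_normD _ _))// normr1; lra.
  rewrite cabsM cabsM cabsX !cabsRC (ger0_norm (ltW (proj1 (andP s12)))).
  have -> : K * (3 / 4) ^+ n = K / 4 ^+ n * (2 ^+ n * (3 / 2) ^+ n).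
    by rewrite -exprMn -mulrA -exprVn -exprMn; congr (_ * _ ^+ _); lra.
  apply: ler_pM => //; first by rewrite mulr_ge0 ?cabs_ge0// exprn_ge0//; lra.
  rewrite (le_trans (ler_norm_sum _ _ _))//.
  apply: (@le_trans _ _ (\sum_(i < n) (3 / 2) ^+ n)).
    apply: ler_sum => i _; rewrite normrX (@le_trans _ _ ((3 / 2) ^+ i))//.
      by rewrite lerXn2r ?nnegrE//; lra.
    by apply: ler_weXn2l; [lra|exact: ltnW].
  rewrite sumr_const card_ord -[X in X <= _]mulr_natl ler_wpM2r ?natr_le_exp2// exprn_ge0//; lra.
apply: cvg_trans h; apply: near_eq_cvg; near=> t.
have t0 : t != 0 by near: t; exact: nbhs_dnbhs_neq.
have t1 : `|t| <= 1 / 2 by near: t; apply: dnbhs0_le; lra.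
have d1 := @dominated_pseries c K (RC s) hc.
have d2 := @dominated_pseries c K (RC ((1 + t) * s)) hc.
have c1 : cabs (RC s) <= 1 by rewrite cabsRC ger0_norm; lra.
have c2 : cabs (RC ((1 + t) * s)) <= 1.
  rewrite cabsRC normrM (ger0_norm (_ : 0 <= s)); last lra.
  have := ler_normD 1 t; rewrite normr1; nra.
have d1' := dominatedZ (- 1) (d1 c1).
rewrite -[X in _ = _ * (_ - X)]mul1r -mulNr -(csumZ (-1) (d1 c1)).
rewrite -(csumD (d2 c2) d1') -(csumZ _ (dominatedD (d2 c2) d1')).
congr csum; apply/funext => n; rewrite RCM exprMn -RCX.
have -> : RC (\sum_(i < n) (1 + t) ^+ i) = (RC t)^-1 * RC ((1 + t) ^+ n - 1).
  by rewrite subrX1 [1 + t]addrC addrK RCM mulKf ?RC_eq0.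
by rewrite RCB RC1 !RCX; ring.
Unshelve. all: by end_near.
Qed.

Lemma csum_at0 c : csum (fun n => c n * 0 ^+ n) = c 0%N.
Proof.
apply: csum_eq; apply: cvg_near_cst; exists 1%N => // -[//|N] _; rewrite /psum big_ord_recl /= expr0 mulr1 big1 ?addr0// => i _.
by rewrite /bump /= add1n expr0n /= mulr0.
Qed.

Lemma csum_shift u w : dominated u w ->
  csum (fun n => if n is n'.+1 then u n' else 0) = csum u.
Proof.
move=> /psum_cvg h; apply: csum_eq; rewrite -(cvg_shiftS (psum _)).
apply: cvg_trans h; apply: near_eq_cvg; apply: nearW => N /=.
by rewrite /psum big_ord_recl /= add0r.
Qed.

Lemma csum_sum (I : Type) (r : seq I) (u : I -> nat -> Cx R) (w : I -> nat -> R) :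
  (forall i, dominated (u i) (w i)) ->
  csum (fun n => \sum_(i <- r) u i n) = \sum_(i <- r) csum (u i).
Proof.
move=> h; apply: csum_eq.
rewrite (_ : psum _ = fun N => \sum_(i <- r) psum (u i) N); last first.
  by apply/funext => N; rewrite /psum exchange_big.
elim: r => [|i r ih].
  by rewrite big_nil; under eq_fun do rewrite big_nil; exact: cvg_cst.
rewrite big_cons; under eq_fun do rewrite big_cons.
by apply: cvgD; [exact: psum_cvg (h i)|exact: ih].
Qed.

End PowerSeries.

Section KernelCoefficients.
Variables (R : realType) (m : nat).
Variables (Rt : seq 'rV[R]_m) (beta : 'rV[R]_m) (kappa : 'rV[R]_m -> R).
Variable E : 'rV[Cx R]_m -> 'rV[Cx R]_m -> Cx R.
Hypothesis HR : root_system Rt.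
Hypothesis Hbeta : regular_vector Rt beta.
Hypothesis Hkap : G_invariant Rt kappa.
Hypothesis kappa_ge0 : forall a, a \in Rt -> 0 <= kappa a.
Hypothesis HE : is_Dunkl_kernel Rt beta kappa E.
Notation Rp := (Rplus Rt beta).
Notation W := (@kernel_coef R m Rt beta kappa).
Notation gam := (gam Rt beta kappa).
Implicit Types (x y a : 'rV[R]_m).
Local Notation mRC := (map_mx (@RC R)).

Let Rt0 a : a \in Rt -> dotv a a != 0 := root_neq0 HR (a := a).

Definition ray_coefs y x (c : nat -> Cx R) K := (forall n, cabs (c n) <= K / 2 ^+ n) /\
  forall s : Cx R, cabs s <= 1 -> E (s *: mRC x) (mRC y) = csum (fun n => c n * s ^+ n).

(** The constant 4 is twice the bound 2 near the origin and is the same for all [x] in the ball, as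
    the uniqueness argument for bounded solutions requires. The radius is halved because Taylor's
    expansion uses the circle of radius 2. *)
Lemma ray_coefs_local y : exists2 r : R, 0 < r &
  forall x, inball r x -> exists c, ray_coefs y x c 4.
Proof.
have [r r0 hr] := kernel_locally_bounded HE (mRC y).
exists (r / 2) => [|x hx]; first by rewrite divr_gt0.
have := @taylor_expansion R (fun s => E (s *: mRC x) (mRC y)) 2.
have -> : 2 * 2 = 4 :> R by lra.
apply.
  by move=> s; exact: kernel_cdifferentiable HE _ _ _.
move=> t _; apply: hr => i; rewrite !mxE !cabsM cabs_expi mulr1 !cabsRC.
have := le_trans (coord_le_vnorm x i) hx; rewrite (ger0_norm (ler0n R 2)); lra.
Qed.

(** Here the bound is a maximum over a compact circle and depends on [x]; this suffices for
    comparing coefficients on a single ray. *)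
Lemma ray_coefs_global y x : exists c K, ray_coefs y x c K.
Proof.
pose f s := E (s *: mRC x) (mRC y).
have df s : cdifferentiable f s by exact: kernel_cdifferentiable HE _ _ _.
have [t0 _ ht0] : exists2 t0, t0 \in `[0, 2 * pi] &
    forall t, t \in `[0, 2 * pi : R] -> cabs (f (RC 2 * expi t)) <= cabs (f (RC 2 * expi t0)).
  apply: EVT_max; first by rewrite mulr_ge0// pi_ge0.
  apply: continuous_subspaceT => t.
  have h : f (RC 2 * expi u) @[u --> t] --> f (RC 2 * expi t).
    apply: cdifferentiable_cvg; first exact: df.
    by apply: cvgM; [exact: cvg_cst|exact: continuous_expi1].
  apply/cvgrPdist_le => e e0; move/cvgC_cabs/cvgrPdist_le/(_ e e0) : h.
  apply: filterS => u; rewrite sub0r normrN (ger0_norm (cabs_ge0 _)) => /(le_trans _); apply.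
  move: (f _) (f _) => z w; rewrite ler_norml.
  have := cabsD (z - w) w; have := cabsD (w - z) z; rewrite !subrK (cabs_distC w z); lra.
have [c [hc1 hc2]] := @taylor_expansion R f _ df
  (fun t ht => ht0 t (ltac:(by rewrite in_itv/=))).
by exists c, (2 * cabs (f (RC 2 * expi t0))).
Qed.

Lemma ray_coefs0 y x c K : ray_coefs y x c K -> c 0%N = 1.
Proof.
have [_ E0 _] := HE.
by move=> [_ /(_ 0)]; rewrite scale0r E0 csum_at0 cabs0 => -> //; exact: ler01.
Qed.

(** Euler's identity for [E] at [s x], read as an identity of power series in [s]. The same constant
    [K] on [x] and its reflections allows the series to be added. *)
Lemma ray_coefs_rec y x K c (d : 'rV[R]_m -> nat -> Cx R) : ray_coefs y x c K ->
  (forall a, a \in Rp -> ray_coefs y (refl a x) (d a) K) ->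
  forall n, RC (n.+1%:R + gam) * c n.+1 - \sum_(a <- Rp) RC (kappa a) * d a n.+1 =
    RC (dotv x y) * c n.
Proof.
move=> [hc hf] hd n.
have K0 : 0 <= K by have := le_trans (cabs_ge0 _) (hc 0%N); rewrite expr0 divr1.
(* Zero outside the positive roots, so that the majorant holds for every vector [a], as [csum_sum]
   asks. *)
pose d' a := if a \in Rp then d a else (fun=> 0).
have hd' a : forall n, cabs (d' a n) <= K / 2 ^+ n.
  rewrite /d'; case: ifPn => [/hd[]//|_ k].
  by rewrite cabs0 divr_ge0// exprn_ge0.
(* [u n] is the coefficient of [s ^+ n] in Euler's identity; the factor [s] in [<s x, y>] shifts the
   last term by one index. *)
pose u n : Cx R := RC (n%:R + gam) * c n - \sum_(a <- Rp) RC (kappa a) * d' a n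
  - (if n is n'.+1 then RC (dotv x y) * c n' else 0).
suff /(_ n.+1) : forall n, u n = 0.
  rewrite /u => /eqP; rewrite subr_eq0 => /eqP <-; congr (_ - _).
  by apply: eq_big_seq => a aR; rewrite /d' aR.
pose S := \sum_(a <- Rp) `|kappa a|.
have S0 : 0 <= S by rewrite sumr_ge0.
have cK k : cabs (c k) <= K.
  by rewrite (le_trans (hc k))// ler_pdivrMr ?exprn_gt0// ler_peMr// exprn_ege1// ler1n.
apply: (@power_series_eq0 R u ((1 + gam) * K + S * K + `|dotv x y| * K)).
  move=> k; have g0 : 0 <= gam by exact: gam_ge0.
  rewrite (le_trans (cabsB _ _))// lerD//; last first.
    case: k => [|k]; first by rewrite cabs0 mulr_ge0.
    by rewrite cabsM cabsRC ler_wpM2l.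
  rewrite (le_trans (cabsB _ _))// lerD//.
    rewrite cabsM cabsRC ger0_norm ?addr_ge0// mulrDl mulrDl mul1r lerD// ?ler_wpM2l//.
    rewrite (le_trans (ler_wpM2l _ (hc k)))// mulrCA ler_piMr// ler_pdivrMr ?exprn_gt0// mul1r.
    exact: natr_le_exp2.
  rewrite (le_trans (cabs_sum _ _ _))// /S mulr_suml; apply: ler_sum => a _.
  rewrite cabsM cabsRC ler_wpM2l// (le_trans (hd' a k))//.
  by rewrite ler_pdivrMr ?exprn_gt0// ler_peMr// exprn_ege1// ler1n.
move=> s s12.
have sC : cabs (RC s) <= 1 by rewrite cabsRC ger0_norm; lra.
pose f x' := E (RC s *: mRC x') (mRC y).
(* The radial derivative at [s x] is computed twice, from the power series and from the differential
   of [E]. *)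
have hder := pseries_scale_derive hc s12.
have kd := cvg_comp _ _ (@cvg_RC_dnbhs R)
   (@kernel_directional R m Rt beta kappa E HE (mRC (s *: x)) (mRC y) (mRC (s *: x))).
have kE := directional_pd HE y (erefl (mRC (s *: x))) (s *: x).
rewrite (kernel_euler HE) in kE; rewrite {}kE in kd.
have {hder kd} e1 : csum (fun n => RC n%:R * c n * RC s ^+ n) =
  RC (s * dotv x y) * f x - \sum_(a <- Rp) RC (kappa a) * (f x - f (refl a x)).
  apply: (cvgC_unique hder).
  have -> : RC (s * dotv x y) * f x - \sum_(a <- Rp) RC (kappa a) * (f x - f (refl a x)) =
    RC (dotv (s *: x) y) * E (mRC (s *: x)) (mRC y) -
          \sum_(a <- Rp) RC (kappa a) * (E (mRC (s *: x)) (mRC y) - E (mRC (refl a (s *: x))) (mRC y)).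
    rewrite dotvZl /f -mRC_Z; congr (_ - _); apply: eq_bigr => a _.
    by rewrite -!mRC_Z reflZ.
  apply: cvg_trans kd; apply: near_eq_cvg; near=> t => /=.
  have t1 : `|t| <= 1 / 2 by near: t; apply: dnbhs0_le; lra.
  have c2 : cabs (RC ((1 + t) * s)) <= 1.
    rewrite cabsRC normrM (ger0_norm (_ : 0 <= s)); last lra.
    have := ler_normD 1 t; rewrite normr1; nra.
  have eX : RC ((1 + t) * s) *: mRC x = mRC (s *: x) + RC t *: mRC (s *: x).
    by rewrite -mRC_Z -mRC_Z -mRC_D scalerA mulrDl mul1r scalerDl.
  by have := hf _ c2; have := hf _ sC; rewrite eX -mRC_Z => -> ->.
have dc := dominated_pseries hc sC.
have dd a := dominated_pseries (hd' a) sC.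
have d1 : dominated (fun n => RC n%:R * c n * RC s ^+ n) (fun n => K * (1 / 2) ^+ n).
  split; last by apply: cvg_geometric_weight; lra.
  move=> k; rewrite cabsM cabsM cabsX !cabsRC.
  rewrite (ger0_norm (_ : 0 <= s)); last lra.
  rewrite ger0_norm//; apply: ler_pM => //; first by rewrite mulr_ge0 ?cabs_ge0.
  - by rewrite exprn_ge0//; lra.
  - rewrite (le_trans (ler_wpM2l _ (hc k)))// mulrCA ler_piMr// ler_pdivrMr ?exprn_gt0// mul1r.
    exact: natr_le_exp2.
  - by rewrite lerXn2r ?nnegrE//; lra.
have dg := dominatedZ (RC gam) dc.
have dsum a := dominatedZ (- RC (kappa a)) (dd a).
have dsh := dominatedZ (- RC (s * dotv x y)) dc.
have es := csum_shift dsh.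
have -> : (fun n => u n * RC s ^+ n) = (fun n => (RC n%:R * c n * RC s ^+ n + RC gam * (c n * RC s ^+ n))
   + (\sum_(a <- Rp) (- RC (kappa a)) * (d' a n * RC s ^+ n) +
     (if n is n'.+1 then - RC (s * dotv x y) * (c n' * RC s ^+ n') else 0))).
  apply/funext => k; rewrite /u !mulrBl -addrA; congr (_ + _); first by rewrite RCD; ring.
  congr (_ + _).
    by rewrite mulr_suml -sumrN; apply: eq_bigr => a _; ring.
  by case: k => [|k]; rewrite ?mul0r ?oppr0// exprS RCM; ring.
pose wd := fun n => \sum_(a <- Rp) (cabs (- RC (kappa a)) * (K * (1 / 2) ^+ n)).
have dS : dominated (fun n => \sum_(a <- Rp) (- RC (kappa a)) * (d' a n * RC s ^+ n)) wd.
  split=> [k|].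
    by rewrite (le_trans (cabs_sum _ _ _))//; apply: ler_sum => a _; exact: (dsum a).1.
  have -> : wd = fun n => (\sum_(a <- Rp) (cabs (- RC (kappa a)))) * K * (1 / 2) ^+ n.
    by apply/funext => k; rewrite /wd -mulr_suml mulrA.
  by apply: cvg_geometric_weight; lra.
have dsh' : dominated (fun n => if n is n'.+1 then - RC (s * dotv x y) * (c n' * RC s ^+ n') else 0)
   (fun n => (2 * (cabs (- RC (s * dotv x y)) * K)) * (1 / 2) ^+ n).
  split; last by apply: cvg_geometric_weight; lra.
  case=> [|k]; first by rewrite cabs0 !mulr_ge0 ?cabs_ge0// exprn_ge0//; lra.
  rewrite (le_trans (dsh.1 k))// exprS le_eqVlt; apply/orP; left; apply/eqP.
  by move: ((1 / 2) ^+ k) => q; field.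
rewrite (csumD (dominatedD d1 dg) (dominatedD dS dsh')) (csumD d1 dg) (csumD dS dsh').
have es2 : \sum_(a <- Rp) csum (fun n => - RC (kappa a) * (d' a n * RC s ^+ n)) =
    \sum_(a <- Rp) - RC (kappa a) * f (refl a x).
  apply: eq_big_seq => a aR; rewrite (csumZ _ (dd a)) /f; congr (_ * _).
  by rewrite (hd a aR).2// /d' aR.
rewrite es (csumZ _ dc) (csumZ _ dc) (csum_sum _ dsum) es2 e1 -(hf _ sC) -/(f x).
have -> : \sum_(a <- Rp) RC (kappa a) * (f x - f (refl a x)) =
  RC gam * f x + \sum_(a <- Rp) - RC (kappa a) * f (refl a x).
  rewrite /gam RC_sum mulr_suml -big_split; apply: eq_bigr => a _ /=; ring.
by move: (\sum_(a <- Rp) _) (f x) => S' fx; ring.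
Unshelve. all: by end_near.
Qed.

(** The recursion links [x] with its reflections, so the coefficients are chosen for all [x] of the
    ball at once. Each is then a bounded function on the ball that solves the equation of
    [W n y x / n!], and bounded solutions are unique. *)
Lemma ray_coefs_small y : exists2 r : R, 0 < r & forall x, inball r x ->
  ray_coefs y x (fun n => RC (W n y x / n`!%:R)) 4.
Proof.
have [r r0 hr] := ray_coefs_local y; exists r => //.
have hr' x : exists c, inball r x -> ray_coefs y x c 4.
  by have [/hr[c hc]|] := pselect (inball r x); [exists c|exists (fun=> 0)].
have /choice[c hc] := hr'.
suff h n : forall x, inball r x -> c x n = RC (W n y x / n`!%:R).
  move=> x hx; have [h1 h2] := hc x hx; split=> [n|s s1]; first by rewrite -h.
  by rewrite h2//; congr csum; apply/funext => n; rewrite h.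
elim: n => [|n ih].
  by move=> x hx; rewrite (ray_coefs0 (hc x hx)) W0 fact0 divr1 RC1.
apply: (@euler_unique R m Rt beta kappa Rt0 kappa_ge0 (fun x => c x n.+1) _
   (fun x => RC (dotv x y) * c x n) n.+1 r) => //.
- by exists (4 / 2 ^+ n.+1) => x /hc[].
- have [C hC] := W_bounded beta HR kappa_ge0 n.+1 y r.
  exists (C / n.+1`!%:R) => x hx; rewrite cabsRC normrM (ger0_norm (_ : 0 <= _^-1)) ?invr_ge0//.
  by rewrite ler_wpM2r ?invr_ge0// hC.
- move=> x hx; apply: (@ray_coefs_rec y x 4 (c x) (fun a => c (refl a x))); first exact: hc.
  move=> a aR; apply: hc; apply/(inball_refl Rt0) => //; exact: aR.
- move=> x hx; rewrite ih// -[RC (dotv x y) * _]RCM.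
  have := W_rec beta Rt0 kappa_ge0 n y x; rewrite /feop => e.
  have f0 : n`!%:R != 0 :> R by rewrite pnatr_eq0 -lt0n fact_gt0.
  have -> : dotv x y * (W n y x / n`!%:R) = (n.+1%:R * (dotv x y * W n y x)) / n.+1`!%:R.
    by rewrite factS natrM; field; rewrite f0 /= addrC natr1 pnatr_eq0.
  rewrite -e mulrBl RCB -mulrA [RC (_ * (_ * _))]RCM; congr (_ - _).
  by rewrite mulr_suml RC_sum; apply: eq_bigr => a _; rewrite -RCM mulrA.
Qed.

(** A point [x] is shrunk to [x0 = x / k] in the small ball. The two rays coincide up to scale, so
    the coefficients along [x] are [k^n] times those along [x0]; homogeneity of [W] in [x] follows
    from that in [y] by symmetry. *)
Lemma kernel_expansion y x (s : Cx R) : cabs s <= 1 ->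
  E (s *: mRC x) (mRC y) = csum (fun n => RC (W n y x / n`!%:R) * s ^+ n).
Proof.
have [r r0 hr] := ray_coefs_small y.
have [d [K hd]] := ray_coefs_global y x.
(* [k >= 1] and [|x| / k = r |x| / (r + |x|) <= r]. *)
pose k := (r + vnorm x) / r.
have v0 := vnorm_ge0 x.
have k1 : 1 <= k by rewrite ler_pdivlMr// mul1r lerDl.
have k0 : k != 0 by rewrite gt_eqF// (lt_le_trans ltr01).
have rv : 0 < r + vnorm x by lra.
pose x0 := k^-1 *: x.
have hx0 : inball r x0.
  rewrite /inball vnormZ gtr0_norm ?invr_gt0 ?(lt_le_trans ltr01)// /k invf_div mulrAC.
  by rewrite ler_pdivrMr// ler_pM2l//; lra.
have [hc hf] := hr x0 hx0.
have Wx n : W n y x0 = k^-1 ^+ n * W n y x.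
  by rewrite /x0 !(W_symmetric HR Hbeta Hkap kappa_ge0 n y) W_scale.
have h : forall n, d n * RC (k^-1 ^+ n) - RC (W n y x0 / n`!%:R) = 0.
  have [hd1 hd2] := hd.
  have dk n : cabs (d n * RC (k^-1 ^+ n)) <= K / 2 ^+ n.
    rewrite cabsM cabsRC normrX gtr0_norm ?invr_gt0 ?(lt_le_trans ltr01)//.
    rewrite (le_trans _ (hd1 n))// ler_piMr ?cabs_ge0// exprn_ile1// ?invf_le1 ?(lt_le_trans ltr01)//.
    by rewrite invr_ge0; lra.
  have K0 : 0 <= K by have := le_trans (cabs_ge0 _) (hd1 0%N); rewrite expr0 divr1.
  apply: (@power_series_eq0 R _ (K + 4)).
    move=> n; rewrite (le_trans (cabsB _ _))// lerD// (le_trans (dk n) _, le_trans (hc n) _)//.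
      by rewrite ler_pdivrMr ?exprn_gt0// ler_peMr// exprn_ege1// ler1n.
    by rewrite ler_pdivrMr ?exprn_gt0// ler_peMr// exprn_ege1// ler1n.
  move=> t t12; have tC : cabs (RC t) <= 1 by rewrite cabsRC ger0_norm; lra.
  have tk : cabs (RC (t / k)) <= 1.
    have tk0 : 0 <= t / k by apply: divr_ge0; lra.
    by rewrite cabsRC ger0_norm// ler_pdivrMr; lra.
  have p1 := dominated_pseries dk tC.
  have p2 := dominated_pseries hc tC.
  have p2' := dominatedZ (-1) p2.
  rewrite (_ : (fun n => _) = fun n => d n * RC (k^-1 ^+ n) * RC t ^+ n +
      (-1) * (RC (W n y x0 / n`!%:R) * RC t ^+ n)); last first.
    by apply/funext => n; rewrite mulrBl mulN1r.
  rewrite (csumD p1 p2') (csumZ _ p2) -(hf _ tC).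
  have -> : csum (fun n => d n * RC (k^-1 ^+ n) * RC t ^+ n) = E (RC (t / k) *: mRC x) (mRC y).
    rewrite (hd2 _ tk); apply: (congr1 (@csum R)); apply/funext => n.
    rewrite RCX [RC (t / k)]RCM exprMn.
    by move: (RC t ^+ n) (RC k^-1 ^+ n) (d n) => u1 u2 u3; ring.
  by rewrite -!mRC_Z /x0 scalerA mulN1r subrr.
have -> : (fun n => RC (W n y x / n`!%:R) * s ^+ n) = (fun n => d n * s ^+ n).
  apply/funext => n; have /eqP := h n; rewrite subr_eq0 => /eqP e; congr (_ * _).
  have q0 : RC (k^-1 ^+ n) != 0 :> Cx R by rewrite RC_eq0 expf_neq0// invr_neq0.
  apply: (mulIf q0); rewrite e Wx -RCM; congr RC; ring.
by move=> s1; exact: hd.2.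
Qed.

End KernelCoefficients.

Section ExponentialWeights.
Variable R : realType.

Lemma cvg_exp_weight (C D : R) : cvgn (series (fun n => C * (D ^+ n / n`!%:R))).
Proof. by apply: (@is_cvg_seriesZ R); exact: is_cvg_series_exp_coeff. Qed.

Lemma weight_le_limn (w : nat -> R) n : (forall n, 0 <= w n) -> cvgn (series w) ->
  w n <= limn (series w).
Proof.
move=> w0 cw; apply: (@le_trans _ _ (series w n.+1)).
  by rewrite seriesEnat /= big_nat_recr//= lerDr sumr_ge0.
by apply: nondecreasing_cvgn_le => //; exact: nondecreasing_series.
Qed.

(** Absorbs the factor [n] of Lipschitz constants into a power, so that majorants keep the form
    [C D^n / n!]. *)
Lemma lipschitz_weight (B : R) n : 0 <= B -> n%:R * B ^+ n.-1 <= (2 * (B + 1)) ^+ n.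
Proof.
move=> B0; rewrite exprMn; apply: ler_pM => //; rewrite ?exprn_ge0// ?natr_le_exp2//.
apply: (@le_trans _ _ ((B + 1) ^+ n.-1)); first by rewrite lerXn2r ?nnegrE//; lra.
by apply: ler_weXn2l; [lra|exact: leq_pred].
Qed.

End ExponentialWeights.

(** * Directional derivatives in the linear form, and polarization *)

Section LformDerivative.
Variables (R : realType) (m : nat).
Implicit Types (p q : mpoly m R) (x y : 'rV[R]_m) (nu : multinom m) (lam : multinom m -> R).

Lemma Lam_lformS lam y n : Lam lam (lform y ^+ n.+1) = Lam (mulf (lform y) lam) (lform y ^+ n).
Proof. by rewrite Lam_mulf exprS. Qed.

Lemma mulf_lformD lam x y p :
  Lam (mulf (lform (x + y)) lam) p = Lam (mulf (lform x) lam) p + Lam (mulf (lform y) lam) p.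
Proof. by rewrite !Lam_mulf lformD mulrDl LamD. Qed.

Lemma mulf_lformZ lam c y p :
  Lam (mulf (lform (c *: y)) lam) p = c * Lam (mulf (lform y) lam) p.
Proof. by rewrite !Lam_mulf lformZ -scalerAl LamZ. Qed.

Lemma Lam_lform_line lam x y n t : Lam lam (lform (y + t *: x) ^+ n.+1) =
  Lam (mulf (lform y) lam) (lform (y + t *: x) ^+ n) +
  t * Lam (mulf (lform x) lam) (lform (y + t *: x) ^+ n).
Proof. by rewrite Lam_lformS mulf_lformD mulf_lformZ. Qed.

Lemma Lam_lform_cvg lam x y n :
  Lam lam (lform (y + t *: x) ^+ n) @[t --> (0 : R)] --> Lam lam (lform y ^+ n).
Proof.
elim: n lam => [|n ih] lam.
  by under eq_fun do rewrite expr0; rewrite expr0; exact: cvg_cst.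
under eq_fun do rewrite Lam_lform_line.
have -> : Lam lam (lform y ^+ n.+1) = Lam (mulf (lform y) lam) (lform y ^+ n) +
    0 * Lam (mulf (lform x) lam) (lform y ^+ n) by rewrite mul0r addr0 Lam_lformS.
by apply: cvgD; [exact: ih|apply: cvgM; [exact: cvg_id|exact: ih]].
Qed.

Lemma Lam_lform_derive lam x y n :
  t^-1 * (Lam lam (lform (y + t *: x) ^+ n) - Lam lam (lform y ^+ n)) @[t --> (0 : R)^'] -->
  n%:R * Lam (mulf (lform x) lam) (lform y ^+ n.-1).
Proof.
elim: n lam => [|n ih] lam.
  rewrite mul0r; under eq_fun do rewrite !expr0 subrr mulr0; exact: cvg_cst.
have -> : n.+1%:R * Lam (mulf (lform x) lam) (lform y ^+ n.+1.-1) =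
    n%:R * Lam (mulf (lform x) (mulf (lform y) lam)) (lform y ^+ n.-1) +
    Lam (mulf (lform x) lam) (lform y ^+ n).
  rewrite /= -natr1 mulrDl mul1r; congr (_ + _); case: n {ih} => [|n]; first by rewrite !mul0r.
  by rewrite /= !Lam_mulf exprS; congr (_ * Lam _ _); ring.
have h1 : Lam (mulf (lform x) lam) (lform (y + t *: x) ^+ n) @[t --> (0 : R)^'] -->
    Lam (mulf (lform x) lam) (lform y ^+ n).
  by apply: cvg_within_filter; exact: Lam_lform_cvg.
have h : (t^-1 * (Lam (mulf (lform y) lam) (lform (y + t *: x) ^+ n) -
      Lam (mulf (lform y) lam) (lform y ^+ n)) +
    Lam (mulf (lform x) lam) (lform (y + t *: x) ^+ n)) @[t --> (0 : R)^'] -->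
    n%:R * Lam (mulf (lform x) (mulf (lform y) lam)) (lform y ^+ n.-1) +
    Lam (mulf (lform x) lam) (lform y ^+ n).
  by apply: cvgD; [exact: ih|exact: h1].
apply: cvg_trans h; apply: near_eq_cvg; near=> t => /=.
have t0 : t != 0 by near: t; exact: nbhs_dnbhs_neq.
rewrite Lam_lform_line Lam_lformS.
by move: (Lam _ _) (Lam _ _) (Lam _ _) => a b c; field.
Unshelve. all: by end_near.
Qed.

(** Polarization by differentiation: as [Lam lam (lform y ^+ k.+1)] vanishes for all [y], so does
    its derivative in direction [e_i], which is [k + 1] times the functional [X_i . lam] at
    [lform y ^+ k]. Thus [X_i . lam] satisfies the same hypothesis, and the degree of the monomial
    drops. *)
Lemma Lam_polarization lam : (forall y n, Lam lam (lform y ^+ n) = 0) -> forall p, Lam lam p = 0.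
Proof.
move=> h p; suff hX : forall nu, lam nu = 0.
  by rewrite LamE big1// => nu _; rewrite hX mulr0.
move=> nu; elim: {nu}(mdeg nu) {-2}nu (erefl (mdeg nu)) lam h => [|n ih] nu nun lam h.
  move/eqP: nun; rewrite mdeg_eq0 => /eqP ->.
  by have := h 0 0%N; rewrite expr0 -mpolyX0 LamX.
have [i nui] : exists i, (0 < nu i)%N.
  apply/existsP; apply: contraT => /existsPn h0.
  suff : mdeg nu = 0%N by rewrite nun.
  by rewrite mdegE big1// => i _; have := h0 i; rewrite lt0n negbK => /eqP.
have nuE : nu = mnm_add (mnm1 i) (mnm_sub nu (mnm1 i)).
  by rewrite addmC submK// lep1mP -lt0n.
have dn : mdeg (mnm_sub nu (mnm1 i)) = n.
  by move: nun; rewrite {1}nuE mdegD mdeg1 add1n => -[].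
rewrite nuE -LamX mpolyXD -lform_ej -Lam_mulf LamX; apply: ih dn _ _ => y k.
have := @Lam_lform_derive lam (ej R i) y k.+1.
under eq_fun do rewrite !h subrr mulr0.
move=> /(cvg_unique (@norm_hausdorff _ R) (cvg_cst 0)) /esym/eqP.
by rewrite mulf_eq0 pnatr_eq0 /= => /eqP.
Qed.

End LformDerivative.

Section FiniteSums.
Variable R : realType.

Lemma csum_finite_sum (I : eqType) (r : seq I) (u : I -> nat -> Cx R) :
  (forall i, i \in r -> exists w, dominated (u i) w) ->
  exists w, dominated (fun n => \sum_(i <- r) u i n) w /\
    csum (fun n => \sum_(i <- r) u i n) = \sum_(i <- r) csum (u i).
Proof.
elim: r => [|i r ih] hu.
  exists (fun n => 0 * (0 ^+ n / n`!%:R)); split.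
    by split=> [n|]; [rewrite big_nil cabs0 mul0r|exact: cvg_exp_weight].
  rewrite big_nil; apply: csum_eq; rewrite (_ : psum _ = cst 0); first exact: cvg_cst.
  by apply/funext => N; rewrite /psum big1// => k _; rewrite big_nil.
have [w1 d1] := hu i (mem_head _ _).
have [|w2 [d2 e2]] := ih; first by move=> k kr; apply: hu; rewrite inE kr orbT.
have -> : (fun n => \sum_(k <- i :: r) u k n) = (fun n => u i n + \sum_(k <- r) u k n).
  by apply/funext => n; rewrite big_cons.
exists (fun n => w1 n + w2 n); split; first exact: dominatedD.
by rewrite (csumD d1 d2) big_cons e2.
Qed.

End FiniteSums.

(** * The relation [T_j V = V d_j] on polynomials *)

Section Intertwining.
Variables (R : realType) (m : nat).
Variables (Rt : seq 'rV[R]_m) (beta : 'rV[R]_m) (kappa : 'rV[R]_m -> R).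
Variable E : 'rV[Cx R]_m -> 'rV[Cx R]_m -> Cx R.
Hypothesis HR : root_system Rt.
Hypothesis Hbeta : regular_vector Rt beta.
Hypothesis Hkap : G_invariant Rt kappa.
Hypothesis kappa_ge0 : forall a, a \in Rt -> 0 <= kappa a.
Hypothesis HE : is_Dunkl_kernel Rt beta kappa E.
Notation Rp := (Rplus Rt beta).
Notation W := (@kernel_coef R m Rt beta kappa).
Notation V := (@intertwiner R m Rt beta kappa).
Notation pdk := (@pdunkl R m Rt beta kappa).
Implicit Types (x y a : 'rV[R]_m) (p : mpoly m R).
Local Notation mRC := (map_mx (@RC R)).

Let Rt0 a : a \in Rt -> dotv a a != 0 := root_neq0 HR (a := a).

Let G y x : Cx R := csum (fun n => RC (W n y x / n`!%:R)).

Lemma kernel_csum y x : E (mRC x) (mRC y) = G y x.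
Proof.
have := @kernel_expansion R m Rt beta kappa E HR Hbeta Hkap kappa_ge0 HE y x 1.
rewrite cabs1 scale1r => -> //; apply: (congr1 (@csum R)); apply/funext => n.
by rewrite expr1n mulr1.
Qed.

Lemma dominated_W y x rho : inball rho x ->
  dominated (fun n => RC (W n y x / n`!%:R)) (fun n => 1 * ((rho * n1 y) ^+ n / n`!%:R)).
Proof.
move=> hx; split; last exact: cvg_exp_weight.
move=> n; rewrite cabsRC normrM mul1r [in leLHS](ger0_norm (_ : 0 <= _^-1)) ?invr_ge0//.
by rewrite ler_wpM2r ?invr_ge0//; exact: (W_bound beta Rt0 kappa_ge0).
Qed.

(** Partial derivatives and reflection quotients, on and off the hyperplane, are all quotients of
    increments between points at distance at most [C |h|]. The Lipschitz bound of [W] then gives a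
    majorant independent of [t]. *)
Lemma cvg_kernel_quot (T : Type) (F : set_system T) {FF : ProperFilter F} y (h : T -> R)
    (x1 x2 : T -> 'rV[R]_m) (D : nat -> R) rho C : 0 <= rho -> 0 <= C ->
  (\forall t \near F, [/\ inball rho (x1 t), inball rho (x2 t), h t != 0 &
     vnorm (x1 t - x2 t) <= C * `|h t|]) ->
  (forall n, (RC (h t))^-1 * (RC (W n y (x1 t)) - RC (W n y (x2 t))) @[t --> F] --> (RC (D n) : Cx R)) ->
  (RC (h t))^-1 * (G y (x1 t) - G y (x2 t)) @[t --> F] --> csum (fun n => RC (D n / n`!%:R))
  /\ dominated (fun n => RC (D n / n`!%:R))
       (fun n => (n1 y * C) * ((2 * (rho * n1 y + 1)) ^+ n / n`!%:R)).
Proof.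
move=> rho0 C0 hn hD.
pose w n := (n1 y * C) * ((2 * (rho * n1 y + 1)) ^+ n / n`!%:R).
have cw : cvgn (series w) by exact: cvg_exp_weight.
pose u n t : Cx R := (RC (h t))^-1 * (RC (W n y (x1 t)) - RC (W n y (x2 t))) * RC (n`!%:R^-1).
have uD n : u n t @[t --> F] --> (RC (D n / n`!%:R) : Cx R).
  by rewrite RCM; apply: cvgM; [exact: hD|exact: cvg_cst].
have uw : \forall t \near F, forall n, cabs (u n t) <= w n.
  apply: filterS hn => t [h1 h2 h3 h4] n.
  rewrite /u !cabsM cabsV -RCB !cabsRC (ger0_norm (_ : 0 <= n`!%:R^-1)) ?invr_ge0//.
  rewrite /w mulrA ler_wpM2r ?invr_ge0// ler_pdivrMl ?normr_gt0//.
  have := W_lipschitz beta HR kappa_ge0 n y h1 h2 => /le_trans; apply.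
  have B0 : 0 <= rho * n1 y by rewrite mulr_ge0// n1_ge0.
  have -> : `|h t| * (n1 y * C * (2 * (rho * n1 y + 1)) ^+ n) =
    n1 y * (2 * (rho * n1 y + 1)) ^+ n * (C * `|h t|) by ring.
  apply: ler_pM => //; rewrite ?vnorm_ge0// ?mulr_ge0 ?n1_ge0 ?exprn_ge0//.
  by rewrite mulrAC mulrC ler_wpM2l ?n1_ge0// lipschitz_weight.
split; last first.
  by split=> // n; apply: (cvgC_cabs_le (uD n)); apply: filterS uw => t; exact.
have hT : csum (u ^~ t) @[t --> F] --> csum (fun n => RC (D n / n`!%:R)).
  exact: tannery uD uw cw.
apply: cvg_trans hT; apply: near_eq_cvg; apply: filterS hn => t [h1 h2 h3 h4].
have d1 := dominated_W y h1; have d2 := dominated_W y h2.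
have d2' := dominatedZ (-1) d2.
have d3 := dominatedD d1 d2'.
transitivity (csum (fun n => (RC (h t))^-1 * (RC (W n y (x1 t) / n`!%:R) +
   -1 * RC (W n y (x2 t) / n`!%:R)))).
  apply: (congr1 (@csum R)); apply/funext => n; rewrite /u !RCM; ring.
rewrite (csumZ _ d3) (csumD d1 d2') (csumZ _ d2) -/(G y (x1 t)) -/(G y (x2 t)).
by rewrite mulN1r.
Qed.

Lemma refl_dist a x : dotv a a != 0 -> vnorm (x - refl a x) = 2 * vnorm a / dotv a a * `|dotv a x|.
Proof.
move=> a0; rewrite /refl opprB addrC subrK vnormZ dotvC normrM normrM.
rewrite (ger0_norm (_ : 0 <= 2))// (ger0_norm (_ : 0 <= _^-1)) ?invr_ge0 ?dotv_ge0//.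
by ring.
Qed.

(** The squared norm is a polynomial in the coordinates, hence eventually at most [|x|^2 + 1]. *)
Lemma near_inball (T : Type) (F : set_system T) {FF : Filter F} (g : T -> 'rV[R]_m) x :
  (forall i, g t ord0 i @[t --> F] --> x ord0 i) ->
  \forall t \near F, inball (Num.sqrt (dotv x x + 1)) (g t).
Proof.
move=> gx; have := @peval_cvg R m T F FF g (\sum_(i < m) mpolyX R (mnm1 i) ^+ 2) x gx.
have e x' : peval (\sum_(i < m) mpolyX R (mnm1 i) ^+ 2) x' = dotv x' x'.
  by rewrite peval_sum; apply: eq_bigr => i _; rewrite expr2 pevalM !pevalXU.
rewrite e => /cvgrPdist_le/(_ 1 ltr01); apply: filterS => t; rewrite e => h.
by rewrite /inball ler_wsqrtr//; move: h; rewrite ler_norml; lra.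
Qed.

Lemma pd_kernel_csum y j x : exists C B : R,
  pd (G y) j x = csum (fun n => RC (peval (mderiv j (V (lform y ^+ n))) x / n`!%:R)) /\
  dominated (fun n => RC (peval (mderiv j (V (lform y ^+ n))) x / n`!%:R)) (fun n => C * (B ^+ n / n`!%:R)).
Proof.
have [] := @cvg_kernel_quot R (0 : R)^' _ y id (fun t => x + t *: ej R j) (fun=> x)
  (fun n => peval (mderiv j (V (lform y ^+ n))) x) (Num.sqrt (dotv x x + 1)) 1.
- exact: sqrtr_ge0.
- by [].
- have hb : \forall t \near (0 : R)^', inball (Num.sqrt (dotv x x + 1)) (x + t *: ej R j).
    apply: near_inball => i; apply: cvg_within_filter; under eq_fun do rewrite !mxE.
    have h : x ord0 i + t * (if i == j then 1 else 0) @[t --> (0 : R)] -->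
        x ord0 i + 0 * (if i == j then 1 else 0).
      by apply: cvgD; [exact: cvg_cst|apply: cvgM; [exact: cvg_id|exact: cvg_cst]].
    by rewrite mul0r addr0 in h.
  near=> t; have t0 : t != 0 by near: t; exact: nbhs_dnbhs_neq.
  split => //.
  + by near: t.
  + by rewrite /inball ler_wsqrtr// lerDl.
  + by rewrite addrC addrA addNr add0r vnormZ vnorm_ej mulr1 mul1r.
- move=> n; exact: pdquot_RC (is_derive_peval _ j x).
move=> h1 h2; eexists; eexists; split; last exact: h2.
exact: cvgC_lim h1.
Unshelve. all: by end_near.
Qed.

Lemma dquot_kernel_csum y a x : dotv a a != 0 -> exists C B : R,
  dquot (G y) a x = csum (fun n => RC (peval (ddiff a (V (lform y ^+ n))) x / n`!%:R)) /\
  dominated (fun n => RC (peval (ddiff a (V (lform y ^+ n))) x / n`!%:R)) (fun n => C * (B ^+ n / n`!%:R)).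
Proof.
move=> a0.
have va : 0 <= 2 * vnorm a / dotv a a.
  by rewrite divr_ge0 ?dotv_ge0// mulr_ge0// vnorm_ge0.
have eW n x' : dotv a x' != 0 -> (RC (dotv a x'))^-1 * (RC (W n y x') - RC (W n y (refl a x'))) =
    RC (peval (ddiff a (V (lform y ^+ n))) x').
  move=> ax; rewrite -RCB -RCV -RCM; congr RC; rewrite /kernel_coef -peval_msigma -pevalB ddiffE// pevalM.
  by rewrite peval_lform [dotv x' a]dotvC mulKf.
have [ax|ax] := boolP (dotv a x != 0).
  (* Off the hyperplane nothing moves; the constant case still supplies the value of the series and
     its majorant together. *)
  have [] := @cvg_kernel_quot nat \oo _ y (fun=> dotv a x) (fun=> x) (fun=> refl a x)
    (fun n => peval (ddiff a (V (lform y ^+ n))) x) (vnorm x) (2 * vnorm a / dotv a a).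
  - exact: vnorm_ge0.
  - exact: va.
  - apply: nearW => _; split=> //; first exact: lexx.
      by rewrite /inball vnorm_refl.
    by rewrite refl_dist.
  - by move=> n; rewrite eW//; exact: cvg_cst.
  move=> h1 h2; eexists; eexists; split; last exact: h2.
  rewrite /dquot ax /dquot0 mulrC.
  by apply: (cvgC_unique _ h1); exact: cvg_cst.
have ax0 : dotv a x = 0 by apply/eqP; rewrite negbK in ax.
have PF := within_dotv_proper a0 ax0.
have [] := @cvg_kernel_quot _ (within [set y | dotv a y != 0] (nbhs x)) _ y (dotv a) id (refl a)
    (fun n => peval (ddiff a (V (lform y ^+ n))) x) (Num.sqrt (dotv x x + 1)) (2 * vnorm a / dotv a a).
- exact: sqrtr_ge0.
- exact: va.
- have h1 : \forall x' \near within [set y | dotv a y != 0] (nbhs x),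
      inball (Num.sqrt (dotv x x + 1)) x'.
    apply: near_inball => i; apply: cvg_trans (@coord_continuous _ _ _ ord0 i x).
    by apply: cvg_app; exact: cvg_within.
  have h2 : \forall x' \near within [set y | dotv a y != 0] (nbhs x), dotv a x' != 0.
    by rewrite /prop_near1/= /within /=; apply: nearW => x'.
  apply: filterS (filterI h1 h2) => x' [h3 h4]; split=> //.
    by rewrite /inball vnorm_refl.
  by rewrite refl_dist.
- move=> n.
  apply: (@cvg_trans _ (RC (peval (ddiff a (V (lform y ^+ n))) x') @[x' --> within [set y | dotv a y != 0] (nbhs x)])).
    apply: near_eq_cvg; rewrite /prop_near1/= /within /=.
    by apply: nearW => x' ax'; rewrite eW.
  apply: cvgC_ReIm => /=; last exact: cvg_cst.
  apply: peval_cvg => i; apply: cvg_trans (@coord_continuous _ _ _ ord0 i x).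
  by apply: cvg_app; exact: cvg_within.
move=> h1 h2; eexists; eexists; split; last exact: h2.
rewrite /dquot (negbTE ax); apply: cvgC_lim; apply: cvg_trans h1.
apply: near_eq_cvg; rewrite /prop_near1/= /within /=.
by apply: nearW => x' _; rewrite /dquot0 mulrC.
Qed.

Lemma pdunkl_csum y j x : exists w : nat -> R,
  dominated (fun n => RC (pdk j (V (lform y ^+ n)) x / n`!%:R)) w /\
  csum (fun n => RC (pdk j (V (lform y ^+ n)) x / n`!%:R)) = RC (y ord0 j) * G y x.
Proof.
have [_ _ /(_ (mRC y) j x)[_]] := HE.
have -> : (fun x' => E (mRC x') (mRC y)) = G y by apply/funext => x'; exact: kernel_csum.
rewrite mxE kernel_csum => <-; rewrite /dunkl.
have [C [B [-> dp]]] := pd_kernel_csum y j x.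
have [] := @csum_finite_sum R _ (Rplus Rt beta)
  (fun a n => RC (kappa a * a ord0 j) * RC (peval (ddiff a (V (lform y ^+ n))) x / n`!%:R)).
  move=> a /(Rplus_neq0 Rt0) a0; have [C' [B' [_ da]]] := dquot_kernel_csum y x a0.
  by eexists; exact: dominatedZ _ da.
move=> w [dw ew]; exists (fun n => C * (B ^+ n / n`!%:R) + w n).
have e : (fun n => RC (pdk j (V (lform y ^+ n)) x / n`!%:R) : Cx R) = (fun n =>
    RC (peval (mderiv j (V (lform y ^+ n))) x / n`!%:R) + \sum_(a <- Rp)
      RC (kappa a * a ord0 j) * RC (peval (ddiff a (V (lform y ^+ n))) x / n`!%:R)).
  apply/funext => n; rewrite /pdunkl mulrDl RCD; congr (_ + _); rewrite mulr_suml RC_sum.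
  by apply: eq_bigr => a _; rewrite -mulrA RCM.
rewrite e; split; first exact: dominatedD.
rewrite (csumD dp dw) ew; congr (_ + _).
apply: eq_big_seq => a /(Rplus_neq0 Rt0) a0; have [C' [B' [-> da]]] := dquot_kernel_csum y x a0.
exact: csumZ da.
Qed.

Lemma V_scale c n y : V (lform (c *: y) ^+ n) = c ^+ n *: V (lform y ^+ n).
Proof. by rewrite lformZ exprZn; exact: mlinZ. Qed.

(** [y] is replaced by [s y] in [T_j E = y_j E]: the left side becomes a power series in [s], and on
    the right the factor [s] of [s y_j] shifts the index by one. The coefficients are then
    compared. *)
Lemma pdunkl_V_lform y j n x :
  pdk j (V (lform y ^+ n.+1)) x = n.+1%:R * (y ord0 j * W n y x).
Proof.
pose P n := RC (pdk j (V (lform y ^+ n)) x / n`!%:R).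
pose Q n := RC (W n y x / n`!%:R).
pose u n := P n + (if n is n'.+1 then - RC (y ord0 j) * Q n' else 0).
have [w [dP _]] := pdunkl_csum y j x; rewrite -/P in dP.
have [cP cw] := dP.
have dQ : dominated Q _ := dominated_W y (lexx (vnorm x)).
set w' := (fun n => 1 * _) in dQ; have [cQ cw'] := dQ.
have w0 k : 0 <= w k := le_trans (cabs_ge0 _) (cP k).
have w0' k : 0 <= w' k := le_trans (cabs_ge0 _) (cQ k).
suff /(_ n.+1) : forall n, u n = 0.
  rewrite /u mulNr => /eqP; rewrite subr_eq0 /P /Q -RCM => /eqP/RC_inj/(congr1 (fun z => z * n.+1`!%:R)).
  have f0 : n`!%:R != 0 :> R by rewrite pnatr_eq0 -lt0n fact_gt0.
  rewrite factS natrM divfK; last by rewrite mulf_neq0// pnatr_eq0.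
  by move=> ->; field.
apply: (@power_series_eq0 R u (limn (series w) + `|y ord0 j| * limn (series w'))).
  move=> k; rewrite (le_trans (cabsD _ _))// lerD// ?(le_trans (cP k))// ?weight_le_limn//.
  case: k => [|k]; rewrite ?cabs0 ?mulr_ge0 ?(le_trans (w0' 0%N) (weight_le_limn _ _ _))//.
  by rewrite cabsM cabsN cabsRC ler_wpM2l// (le_trans (cQ k))// weight_le_limn.
move=> s s12.
have sX k : cabs (RC s ^+ k) <= 1.
  by rewrite cabsX cabsRC exprn_ile1// ger0_norm; lra.
have dPs : dominated (fun n => P n * RC s ^+ n) w.
  by split=> // k; rewrite cabsM (le_trans _ (cP k))// ler_piMr// cabs_ge0.
have dQs : dominated (fun n => Q n * RC s ^+ n) w'.
  by split=> // k; rewrite cabsM (le_trans _ (cQ k))// ler_piMr// cabs_ge0.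
have dQ' := dominatedZ (- RC (s * y ord0 j)) dQs.
have es := csum_shift dQ'.
have dsh : dominated (fun n => if n is n'.+1 then - RC (s * y ord0 j) * (Q n' * RC s ^+ n') else 0)
    (fun n => if n is n'.+1 then cabs (- RC (s * y ord0 j)) * w' n' else 0).
  split; first by case=> [|k]; rewrite ?cabs0//; exact: (proj1 dQ').
  have [_ /cvg_ex[l hl]] := dQ'; apply/cvg_ex; exists l.
  rewrite -(cvg_shiftS (series _)); apply: cvg_trans hl.
  apply: near_eq_cvg; apply: nearW => N /=.
  by rewrite !seriesEord /= big_ord_recl /= add0r.
have -> : (fun n => u n * RC s ^+ n) = (fun n => P n * RC s ^+ n +
   (if n is n'.+1 then - RC (s * y ord0 j) * (Q n' * RC s ^+ n') else 0)).
  apply/funext => k; rewrite /u mulrDl; congr (_ + _).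
  by case: k => [|k]; rewrite ?mul0r// exprS RCM; ring.
rewrite (csumD dPs dsh) es (csumZ _ dQs).
have [w2 [_]] := pdunkl_csum (s *: y) j x; rewrite mxE.
have -> : (fun n => RC (pdk j (V (lform (s *: y) ^+ n)) x / n`!%:R)) = (fun n => P n * RC s ^+ n).
  by apply/funext => k; rewrite V_scale pdunklZ// /P -RCX -RCM; congr RC; ring.
have -> : G (s *: y) x = csum (fun n => Q n * RC s ^+ n).
  apply: (congr1 (@csum R)); apply/funext => k.
  by rewrite W_scale /Q -RCX -RCM; congr RC; ring.
by move=> ->; rewrite mulNr subrr.
Qed.

Theorem pdunkl_V j p x : pdk j (V p) x = peval (V (mderiv j p)) x.
Proof.
pose th nu := pdk j (V (mpolyX R nu)) x - peval (V (mderiv j (mpolyX R nu))) x.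
have thE q : Lam th q = pdk j (V q) x - peval (V (mderiv j q)) x.
  apply: (@mpoly_lin_ext R m R^o (Lam th) (fun q => pdk j (V q) x - peval (V (mderiv j q)) x)).
  - exact: LamD.
  - exact: LamZ.
  - move=> p1 p2; rewrite mderivD /intertwiner !mlinD pdunklD// pevalD opprD.
    by rewrite [LHS]addrACA.
  - by move=> c p1; rewrite mderivZ /intertwiner !mlinZ pdunklZ// pevalZ -mulrBr.
  - by move=> nu; rewrite LamX.
apply/eqP; rewrite -subr_eq0 -thE; apply/eqP; apply: Lam_polarization => y [|n]; rewrite thE.
  have d1 : mderiv j (1 : mpoly m R) = 0 by rewrite -mpolyC1 mderivC.
  rewrite expr0 d1 /intertwiner mlin0 peval0 subr0 -mpolyX0 mlinX /vnu mdeg0 /=.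
  rewrite /pdunkl d1 peval0 add0r big_seq big1// => a /(Rplus_neq0 Rt0) a0.
  rewrite (_ : ddiff a 1 = 0) ?peval0 ?mulr0//; apply: ddiff_unique => //.
  by rewrite -mpolyC1 msigmaC subrr mulr0.
rewrite pdunkl_V_lform mderiv_expr mderiv_lform [_ * mpolyC _ _]mulrC mul_mpolyC.
by rewrite /intertwiner !mlinZ !pevalZ /kernel_coef /intertwiner; apply/eqP; rewrite subr_eq0; apply/eqP; ring.
Qed.

End Intertwining.

(** * The heat operator on transforms of functionals *)

Section FunctionalTransform.
Variables (R : realType) (m : nat).
Implicit Types (p q : mpoly m R) (x y : 'rV[R]_m) (nu : multinom m) (lam : multinom m -> R).
Implicit Types (rho C : R) (j : 'I_m).

(* The power series of [lam(exp(i<.,y>))]. *)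
Definition Ft lam y : Cx R := csum (fun n => RC (Lam lam (lform y ^+ n) / n`!%:R) * IC 1 ^+ n).

Lemma bdd_C_ge0 rho C lam : bdd rho C lam -> 0 <= C.
Proof. by move=> /(_ mnm0); rewrite mdeg0 expr0 mulr1; exact: le_trans. Qed.

Lemma cabs_ICX n : cabs (IC 1 ^+ n : Cx R) = 1.
Proof. by rewrite cabsX cabsIC normr1 expr1n. Qed.

Lemma dominated_Ft rho C lam y B : 0 <= rho -> bdd rho C lam -> n1 y <= B ->
  dominated (fun n => RC (Lam lam (lform y ^+ n) / n`!%:R) * IC 1 ^+ n)
    (fun n => C * ((rho * B) ^+ n / n`!%:R)).
Proof.
move=> rho0 hl yB; split; last exact: cvg_exp_weight.
move=> n; rewrite cabsM cabs_ICX mulr1 cabsRC normrM mulrA.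
rewrite [`|n`!%:R^-1|]ger0_norm ?invr_ge0// ler_wpM2r ?invr_ge0//.
rewrite (le_trans (Lam_lformX y n hl))// ler_wpM2l ?(bdd_C_ge0 hl)//.
have B0 : 0 <= B := le_trans (n1_ge0 y) yB.
by apply: lerXn2r; rewrite ?nnegrE ?mulr_ge0 ?n1_ge0// ler_wpM2l.
Qed.

Lemma limn_exp_weight (C D : R) : limn (series (fun n => C * (D ^+ n / n`!%:R))) = C * expR D.
Proof.
apply/cvg_lim => //; have -> : series (fun n => C * (D ^+ n / n`!%:R)) = fun N => C * series (exp_coeff D) N.
  by apply/funext => N; rewrite !seriesEord /= mulr_sumr.
apply: cvgM; [exact: cvg_cst|exact: is_cvg_series_exp_coeff].
Qed.

Lemma Ft_bound rho C lam y : 0 <= rho -> bdd rho C lam -> cabs (Ft lam y) <= C * expR (rho * n1 y).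
Proof.
by move=> rho0 hl; have := cabs_csum (dominated_Ft rho0 hl (lexx (n1 y))); rewrite limn_exp_weight.
Qed.

Lemma Lam_lform_lipschitz rho C lam x y t B n : 0 <= rho -> bdd rho C lam -> `|t| <= 1 ->
  n1 y + n1 x <= B -> `|Lam lam (lform (y + t *: x) ^+ n) - Lam lam (lform y ^+ n)| <=
    `|t| * (n%:R * (C * (rho * n1 x) * (rho * B) ^+ n.-1)).
Proof.
move=> rho0 hl t1 hB; have yB : n1 y <= B by have := n1_ge0 x; lra.
have B0 : 0 <= rho * B by rewrite mulr_ge0// (le_trans (n1_ge0 y)).
have ytB : n1 (y + t *: x) <= B.
  by rewrite (le_trans (n1D _ _))// n1Z; have := n1_ge0 x; nra.
elim: n lam C hl => [|n ih] lam C hl; first by rewrite !expr0 subrr normr0 mul0r mulr0.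
have C0 := bdd_C_ge0 hl.
rewrite Lam_lform_line Lam_lformS addrAC (le_trans (ler_normD _ _))//.
have h1 := ih _ _ (bdd_lform y hl).
have h2 : `|t * Lam (mulf (lform x) lam) (lform (y + t *: x) ^+ n)| <=
    `|t| * (C * (rho * n1 x) * (rho * B) ^+ n).
  rewrite normrM ler_wpM2l// (le_trans (Lam_lformX _ n (bdd_lform x hl)))//.
  rewrite ler_wpM2l ?mulr_ge0 ?n1_ge0// lerXn2r ?nnegrE// ?mulr_ge0 ?n1_ge0//.
  by rewrite ler_wpM2l.
apply: (le_trans (lerD h1 h2)); rewrite -mulrDr ler_wpM2l// -natr1 mulrDl mul1r lerD2r//.
case: n {ih h1 h2} => [|n]; first by rewrite !mul0r.
rewrite /= ler_wpM2l// exprS.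
have -> : C * (rho * n1 x) * (rho * B * (rho * B) ^+ n) =
  C * (rho * B) * (rho * n1 x) * (rho * B) ^+ n by ring.
rewrite ler_wpM2r ?exprn_ge0// ler_wpM2r ?mulr_ge0 ?n1_ge0// ler_wpM2l//.
by rewrite ler_wpM2l.
Qed.

Lemma Ft_cvg_line rho C lam x y : 0 <= rho -> bdd rho C lam ->
  Ft lam (y + t *: x) @[t --> (0 : R)] --> Ft lam y.
Proof.
move=> rho0 hl.
apply: (@tannery R _ (nbhs (0 : R)) _ (fun n t => RC (Lam lam (lform (y + t *: x) ^+ n) / n`!%:R) * IC 1 ^+ n) _
   (fun n => C * ((rho * (n1 y + n1 x)) ^+ n / n`!%:R))); last exact: cvg_exp_weight.
  move=> n; apply: cvgM; last exact: cvg_cst.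
  apply: continuous_cvg; first exact: continuous_RC.
  by apply: cvgM; [exact: Lam_lform_cvg|exact: cvg_cst].
have h1 : \forall t \near (0 : R), `|t| <= 1 by exact: nbhs0_le.
apply: filterS h1 => t t1; apply: (dominated_Ft rho0 hl _).1.
by rewrite (le_trans (n1D _ _))// n1Z; have := n1_ge0 x; nra.
Qed.

(** Differentiation in [y_j] becomes [i] times multiplication of the functional by [X_j]. Each term
    loses one degree, so the limit appears as a series shifted by one index. *)
Lemma Ft_pdquot rho C lam j y : 0 <= rho -> bdd rho C lam ->
  pdquot (Ft lam) j y t @[t --> (0 : R)^'] --> IC 1 * Ft (mulf (lform (ej R j)) lam) y.
Proof.
move=> rho0 hl; have C0 := bdd_C_ge0 hl.
have hl' := bdd_lform (ej R j) hl; rewrite n1_ej mulr1 in hl'.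
have d' := dominated_Ft rho0 hl' (lexx (n1 y)).
have es := csum_shift (dominatedZ (IC 1) d').
rewrite (csumZ _ d') in es; rewrite -[Ft (mulf _ _) y]/(csum _) -es.
pose u n t : Cx R := RC (t^-1 * (Lam lam (lform (y + t *: ej R j) ^+ n) - Lam lam (lform y ^+ n)))
   * RC (n`!%:R^-1) * IC 1 ^+ n.
pose B := n1 y + 1.
have B0 : 0 <= B by rewrite addr_ge0// n1_ge0.
have hT : csum (u ^~ t) @[t --> (0 : R)^'] --> csum (fun n => if n is n'.+1 then
    IC 1 * (RC (Lam (mulf (lform (ej R j)) lam) (lform y ^+ n') / n'`!%:R) * IC 1 ^+ n') else 0).
  apply: (@tannery R _ _ _ u _ (fun n => (C * rho) * ((2 * (rho * B + 1)) ^+ n / n`!%:R))); last exact: cvg_exp_weight.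
    move=> n.
    have -> : (if n is n'.+1 then
        IC 1 * (RC (Lam (mulf (lform (ej R j)) lam) (lform y ^+ n') / n'`!%:R) * IC 1 ^+ n') else 0) =
        RC (n%:R * Lam (mulf (lform (ej R j)) lam) (lform y ^+ n.-1)) * RC (n`!%:R^-1) * IC 1 ^+ n :> Cx R.
      case: n => [|n]; first by rewrite !mul0r.
      rewrite /= exprS -[RC (_ * _) * RC _]RCM mulrCA; congr (_ * _); congr RC.
      have f0 : n`!%:R != 0 :> R by rewrite pnatr_eq0 -lt0n fact_gt0.
      by rewrite factS natrM; field; rewrite f0 /= addrC natr1 pnatr_eq0.
    apply: cvgM; last exact: cvg_cst.
    apply: cvgM; last exact: cvg_cst.
    apply: continuous_cvg; first exact: continuous_RC.
    exact: Lam_lform_derive.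
  near=> t => n.
  have t0 : t != 0 by near: t; exact: nbhs_dnbhs_neq.
  have t1 : `|t| <= 1 by near: t; exact: dnbhs0_le.
  rewrite /u cabsM cabsM cabs_ICX mulr1 !cabsRC (ger0_norm (_ : 0 <= n`!%:R^-1)) ?invr_ge0//.
  rewrite mulrA ler_wpM2r ?invr_ge0// normrM normfV ler_pdivrMl ?normr_gt0//.
  have yB : n1 y + n1 (ej R j) <= B by rewrite n1_ej.
  apply: (le_trans (Lam_lform_lipschitz n rho0 hl t1 yB)); rewrite n1_ej mulr1 ler_wpM2l//.
  rewrite mulrCA ler_wpM2l ?mulr_ge0// lipschitz_weight// mulr_ge0//.
apply: cvg_trans hT; apply: near_eq_cvg; near=> t.
have t1 : `|t| <= 1 by near: t; exact: dnbhs0_le.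
have d1 := dominated_Ft rho0 hl (lexx (n1 (y + t *: ej R j))).
have d2 := dominated_Ft rho0 hl (lexx (n1 y)).
have d2' := dominatedZ (-1) d2.
have d3 := dominatedD d1 d2'.
rewrite /pdquot /Ft -[X in _ = _ * (_ - X)]mul1r -mulNr -(csumZ _ d2) -(csumD d1 d2') -(csumZ _ d3).
apply: (congr1 (@csum R)); apply/funext => n; rewrite /u !RCM RCB RCV.
by move: (RC (Lam _ _)) (RC (Lam _ _)) (RC t)^-1 (RC _^-1) (IC 1 ^+ n) => a b c d e; ring.
Unshelve. all: by end_near.
Qed.

Lemma FtD rho C1 C2 lam1 lam2 y : 0 <= rho -> bdd rho C1 lam1 -> bdd rho C2 lam2 ->
  Ft (fun nu => lam1 nu + lam2 nu) y = Ft lam1 y + Ft lam2 y.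
Proof.
move=> rho0 h1 h2.
rewrite /Ft -(csumD (dominated_Ft rho0 h1 (lexx (n1 y))) (dominated_Ft rho0 h2 (lexx (n1 y)))).
by apply: (congr1 (@csum R)); apply/funext => n; rewrite Lam_add mulrDl RCD mulrDl.
Qed.

Lemma FtZ rho C lam c y : 0 <= rho -> bdd rho C lam ->
  Ft (fun nu => c * lam nu) y = RC c * Ft lam y.
Proof.
move=> rho0 h1; rewrite /Ft -(csumZ _ (dominated_Ft rho0 h1 (lexx (n1 y)))).
by apply: (congr1 (@csum R)); apply/funext => n; rewrite Lam_scale !RCM; ring.
Qed.

Lemma Ft_zero y : Ft (fun=> 0) y = 0.
Proof.
apply: csum_eq; rewrite (_ : psum _ = cst 0); first exact: cvg_cst.
apply/funext => N; rewrite /psum big1// => n _.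
by rewrite LamE big1 ?mul0r// => nu _; rewrite mulr0.
Qed.

Definition lapf lam : multinom m -> R := fun nu =>
  \sum_(j < m) mulf (lform (ej R j)) (mulf (lform (ej R j)) lam) nu.

Lemma mulfD q lam1 lam2 : mulf q (fun nu => lam1 nu + lam2 nu) = fun nu => mulf q lam1 nu + mulf q lam2 nu.
Proof. by apply/funext => nu; rewrite /mulf Lam_add. Qed.

Lemma mulfZ q lam c : mulf q (fun nu => c * lam nu) = fun nu => c * mulf q lam nu.
Proof. by apply/funext => nu; rewrite /mulf Lam_scale. Qed.

Lemma lapfD lam1 lam2 : lapf (fun nu => lam1 nu + lam2 nu) = fun nu => lapf lam1 nu + lapf lam2 nu.
Proof.
by apply/funext => nu; rewrite /lapf -big_split; apply: eq_bigr => j _; rewrite !mulfD.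
Qed.

Lemma lapfZ lam c : lapf (fun nu => c * lam nu) = fun nu => c * lapf lam nu.
Proof.
by apply/funext => nu; rewrite /lapf mulr_sumr; apply: eq_bigr => j _; rewrite !mulfZ.
Qed.

Lemma bddD rho C1 C2 lam1 lam2 : bdd rho C1 lam1 -> bdd rho C2 lam2 ->
  bdd rho (C1 + C2) (fun nu => lam1 nu + lam2 nu).
Proof. by move=> h1 h2 nu; rewrite (le_trans (ler_normD _ _))// mulrDl lerD. Qed.

Lemma bddZ rho C lam c : bdd rho C lam -> bdd rho (`|c| * C) (fun nu => c * lam nu).
Proof. by move=> h nu; rewrite normrM -mulrA ler_wpM2l. Qed.

Lemma Ft_sum (I : Type) (r : seq I) rho C (F : I -> multinom m -> R) y : 0 <= rho ->
  (forall i, bdd rho C (F i)) ->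
  bdd rho (\sum_(i <- r) C) (fun nu => \sum_(i <- r) F i nu) /\
  Ft (fun nu => \sum_(i <- r) F i nu) y = \sum_(i <- r) Ft (F i) y.
Proof.
move=> rho0 hF; elim: r => [|i r [ih1 ih2]].
  split; first by move=> nu; rewrite !big_nil mul0r normr0.
  by rewrite big_nil -[RHS](Ft_zero y); apply: (congr1 (Ft^~ y)); apply/funext => nu; rewrite big_nil.
have e : (fun nu => \sum_(k <- i :: r) F k nu) = (fun nu => F i nu + \sum_(k <- r) F k nu).
  by apply/funext => nu; rewrite big_cons.
by rewrite e !big_cons (FtD _ rho0 (hF i) ih1) ih2; split=> //; exact: bddD.
Qed.

Lemma bdd_lapf_Ft rho C lam y : 0 <= rho -> bdd rho C lam -> bdd rho (C * (m%:R * rho ^+ 2)) (lapf lam) /\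
  Ft (lapf lam) y = \sum_(j < m) Ft (mulf (lform (ej R j)) (mulf (lform (ej R j)) lam)) y.
Proof.
move=> rho0 hl.
have h j : bdd rho (C * rho ^+ 2) (mulf (lform (ej R j)) (mulf (lform (ej R j)) lam)).
  by have := bdd_lform (ej R j) (bdd_lform (ej R j) hl); rewrite n1_ej !mulr1 -mulrA.
have [h1 h2] := Ft_sum (index_enum 'I_m) y rho0 h; split=> //.
have <- : \sum_(j < m) C * rho ^+ 2 = C * (m%:R * rho ^+ 2).
  by rewrite sumr_const card_ord -mulr_natr; ring.
exact: h1.
Qed.

Lemma bdd_lapf rho C lam : 0 <= rho -> bdd rho C lam -> bdd rho (C * (m%:R * rho ^+ 2)) (lapf lam).
Proof. by move=> rho0 hl; exact: (bdd_lapf_Ft 0 rho0 hl).1. Qed.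

Lemma lap_Ft rho C lam : 0 <= rho -> bdd rho C lam -> lap (Ft lam) = fun y => - Ft (lapf lam) y.
Proof.
move=> rho0 hl; apply/funext => y; rewrite /lap (bdd_lapf_Ft y rho0 hl).2 -sumrN.
apply: eq_bigr => j _.
have -> : pd (Ft lam) j = fun y => IC 1 * Ft (mulf (lform (ej R j)) lam) y.
  by apply/funext => y'; apply: cvgC_lim; exact: Ft_pdquot rho0 hl.
have h : IC 1 * pdquot (Ft (mulf (lform (ej R j)) lam)) j y t @[t --> (0 : R)^'] -->
    IC 1 * (IC 1 * Ft (mulf (lform (ej R j)) (mulf (lform (ej R j)) lam)) y).
  by apply: cvgM; [exact: cvg_cst|exact: Ft_pdquot rho0 (bdd_lform (ej R j) hl)].
rewrite mulrA sqrIC1 mulN1r in h; apply: cvgC_lim; apply: cvg_trans h.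
apply: near_eq_cvg; apply: nearW => t; rewrite /pdquot.
by move: (Ft _ _) (Ft _ _) (RC t)^-1 => a b c; ring.
Qed.

Lemma bdd_iter_lapf rho C lam k : 0 <= rho -> bdd rho C lam ->
  bdd rho (C * (m%:R * rho ^+ 2) ^+ k) (iter k lapf lam).
Proof.
move=> rho0 hl; elim: k => [|k ih]; first by rewrite expr0 mulr1.
by rewrite exprSr mulrA /=; exact: bdd_lapf.
Qed.

Lemma iter_lap_Ft rho C lam k : 0 <= rho -> bdd rho C lam ->
  iter k (@lap R m) (Ft lam) = fun y => RC ((-1) ^+ k) * Ft (iter k lapf lam) y.
Proof.
move=> rho0 hl; elim: k => [|k ih]; first by apply/funext => y; rewrite /= expr0 mul1r.
rewrite iterS ih; have hk := bdd_iter_lapf k rho0 hl.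
have e : (fun y => RC ((-1) ^+ k) * Ft (iter k lapf lam) y) =
    Ft (fun nu => (-1) ^+ k * iter k lapf lam nu).
  by apply/funext => y; rewrite (FtZ _ y rho0 hk).
rewrite e (lap_Ft rho0 (bddZ ((-1) ^+ k) hk)); apply/funext => y.
rewrite exprS mulN1r RCN mulNr; congr (- _).
have hk1 := bdd_lapf rho0 hk; rewrite /= -(FtZ _ y rho0 hk1).
by rewrite lapfZ.
Qed.

(* [Kf lam = exp(-Delta/2) (Ft lam)]: on the transform side [-Delta] is [lapf], the
   multiplication of [lam] by [|X|^2]. *)
Definition Kf lam y : Cx R := csum (fun k => RC ((2 ^+ k * k`!%:R)^-1) * Ft (iter k lapf lam) y).

Lemma heat_op_Ft rho C lam y : 0 <= rho -> bdd rho C lam -> heat_op (Ft lam) y = Kf lam y.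
Proof.
move=> rho0 hl; rewrite /heat_op /Kf /csum.
apply: (congr1 (fun f : nat -> Cx R => limn f)).
(* The sign of the heat series cancels the sign [(-1)^k] of the iterated Laplacian. *)
apply/funext => N; apply: eq_bigr => k _; rewrite (iter_lap_Ft k rho0 hl) mulrA -RCM mulrAC.
by rewrite -expr2 sqrr_sign mul1r.
Qed.

Lemma dominated_Kf rho C lam y : 0 <= rho -> bdd rho C lam ->
  dominated (fun k => RC ((2 ^+ k * k`!%:R)^-1) * Ft (iter k lapf lam) y)
   (fun k => (C * expR (rho * n1 y)) * ((m%:R * rho ^+ 2 / 2) ^+ k / k`!%:R)).
Proof.
move=> rho0 hl; split; last exact: cvg_exp_weight.
move=> k; rewrite cabsM cabsRC ger0_norm ?invr_ge0 ?mulr_ge0 ?exprn_ge0//.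
have h := Ft_bound y rho0 (bdd_iter_lapf k rho0 hl).
apply: (le_trans (ler_wpM2l _ h)); first by rewrite ?invr_ge0 ?mulr_ge0 ?exprn_ge0.
rewrite le_eqVlt; apply/orP; left; apply/eqP; rewrite invfM [(_ / 2) ^+ k]exprMn exprVn; ring.
Qed.

Lemma Kf_bound rho C lam y : 0 <= rho -> bdd rho C lam ->
  cabs (Kf lam y) <= C * expR (rho * n1 y) * expR (m%:R * rho ^+ 2 / 2).
Proof. by move=> rho0 hl; have := cabs_csum (dominated_Kf y rho0 hl); rewrite limn_exp_weight. Qed.

Lemma Kf_cvg_line rho C lam x y : 0 <= rho -> bdd rho C lam ->
  Kf lam (y + t *: x) @[t --> (0 : R)] --> Kf lam y.
Proof.
move=> rho0 hl; have C0 := bdd_C_ge0 hl.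
apply: (@tannery R _ (nbhs (0 : R)) _ (fun k t => RC ((2 ^+ k * k`!%:R)^-1) * Ft (iter k lapf lam) (y + t *: x)) _
   (fun k => (C * expR (rho * (n1 y + n1 x))) * ((m%:R * rho ^+ 2 / 2) ^+ k / k`!%:R))); last exact: cvg_exp_weight.
  move=> k; apply: cvgM; first exact: cvg_cst.
  exact: Ft_cvg_line rho0 (bdd_iter_lapf k rho0 hl).
have h1 : \forall t \near (0 : R), `|t| <= 1 by exact: nbhs0_le.
apply: filterS h1 => t t1 k; apply: (le_trans ((dominated_Kf _ rho0 hl).1 k)).
rewrite ler_wpM2r ?divr_ge0 ?exprn_ge0 ?mulr_ge0 ?exprn_ge0 ?invr_ge0//.
rewrite ler_wpM2l// ler_expR ler_wpM2l// (le_trans (n1D _ _))// n1Z; have := n1_ge0 x; nra.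
Qed.

Lemma iter_lapfD lam1 lam2 k : iter k lapf (fun nu => lam1 nu + lam2 nu) =
  fun nu => iter k lapf lam1 nu + iter k lapf lam2 nu.
Proof. by elim: k => [//|k ih]; rewrite iterS ih lapfD. Qed.

Lemma iter_lapfZ lam c k : iter k lapf (fun nu => c * lam nu) = fun nu => c * iter k lapf lam nu.
Proof. by elim: k => [//|k ih]; rewrite iterS ih lapfZ. Qed.

Lemma KfD rho C1 C2 lam1 lam2 y : 0 <= rho -> bdd rho C1 lam1 -> bdd rho C2 lam2 ->
  Kf (fun nu => lam1 nu + lam2 nu) y = Kf lam1 y + Kf lam2 y.
Proof.
move=> rho0 h1 h2; rewrite /Kf -(csumD (dominated_Kf y rho0 h1) (dominated_Kf y rho0 h2)).
apply: (congr1 (@csum R)); apply/funext => k.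
by rewrite iter_lapfD (FtD y rho0 (bdd_iter_lapf k rho0 h1) (bdd_iter_lapf k rho0 h2)) mulrDr.
Qed.

Lemma KfZ rho C lam c y : 0 <= rho -> bdd rho C lam ->
  Kf (fun nu => c * lam nu) y = RC c * Kf lam y.
Proof.
move=> rho0 h1; rewrite /Kf -(csumZ _ (dominated_Kf y rho0 h1)).
apply: (congr1 (@csum R)); apply/funext => k.
by rewrite iter_lapfZ (FtZ c y rho0 (bdd_iter_lapf k rho0 h1)) mulrCA.
Qed.

Lemma expi_csum (t : R) : csum (fun n => RC (t ^+ n / n`!%:R) * IC 1 ^+ n) = expi t.
Proof.
have ic2 k : (IC 1 ^+ k.*2 : Cx R) = RC ((-1) ^+ k).
  by rewrite -muln2 mulnC exprM expr2 sqrIC1 RCX RCN RC1.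
apply: csum_eq; apply: cvgC_ReIm => /=.
- rewrite (_ : (fun _ => _) = series (cos_coeff t)); first by rewrite cos.unlock; exact: is_cvg_series_cos_coeff.
  apply/funext => N; rewrite seriesEord /psum Re_sum; apply: eq_bigr => n _.
  rewrite /cos_coeff /= -[in IC 1 ^+ n](odd_double_half n) exprD ic2.
  by case: (odd n); rewrite /= ?expr1 ?expr0 ?mul1r ?ReM /=; ring.
- rewrite (_ : (fun _ => _) = series (sin_coeff t)); first by rewrite sin.unlock; exact: is_cvg_series_sin_coeff.
  apply/funext => N; rewrite seriesEord /psum Im_sum; apply: eq_bigr => n _.
  rewrite /sin_coeff /= -[in IC 1 ^+ n](odd_double_half n) exprD ic2.
  case: (boolP (odd n)) => on; rewrite /= ?expr1 ?expr0 ?mul1r ?ImM /=; last by ring.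
  have -> : n.-1./2 = n./2 by rewrite -[in LHS](odd_double_half n) on /= doubleK.
  by ring.
Qed.

Definition evf x : multinom m -> R := fun nu => peval (mpolyX R nu) x.

Lemma Ft_ev x y : Ft (evf x) y = expi (dotv x y).
Proof.
rewrite -expi_csum; apply: (congr1 (@csum R)); apply/funext => n.
by rewrite Lam_ev pevalX_exp peval_lform.
Qed.

Lemma mulf_ev q x nu : mulf q (evf x) nu = peval q x * evf x nu.
Proof. by rewrite /mulf Lam_ev pevalM. Qed.

Lemma lapf_ev x k : iter k lapf (evf x) = fun nu => dotv x x ^+ k * evf x nu.
Proof.
have h q : mulf q (evf x) = fun nu => peval q x * evf x nu by apply/funext => nu; exact: mulf_ev.
elim: k => [|k ih]; first by apply/funext => nu; rewrite /= expr0 mul1r.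
rewrite iterS ih lapfZ; apply/funext => nu; rewrite exprSr -mulrA; congr (_ * _).
rewrite /lapf /dotv mulr_suml; apply: eq_bigr => j _.
by rewrite h mulfZ h lform_ej pevalXU mulrA.
Qed.

Lemma bdd_evf rho x : (forall i, `|x ord0 i| <= rho) -> bdd rho 1 (evf x).
Proof.
move=> hx nu; rewrite mul1r /evf /peval mevalX normr_prod.
rewrite mdegE -prodrXr; apply: ler_prod => i _; rewrite normrX exprn_ge0//=.
by rewrite lerXn2r ?nnegrE// ?(le_trans _ (hx i)).
Qed.

Lemma Kf_ev x y : Kf (evf x) y = RC (expR (dotv x x / 2)) * expi (dotv x y).
Proof.
have hb : bdd (vnorm x) 1 (evf x) by apply: bdd_evf; exact: coord_le_vnorm.
have v0 := vnorm_ge0 x.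
have -> : Kf (evf x) y = csum (fun k => expi (dotv x y) * RC (exp_coeff (dotv x x / 2) k)).
  apply: (congr1 (@csum R)); apply/funext => k.
  rewrite lapf_ev (FtZ _ y v0 hb) Ft_ev mulrA mulrC -RCM; congr (_ * RC _).
  by rewrite /exp_coeff /= invfM exprMn exprVn; ring.
have d : dominated (fun k => RC (exp_coeff (dotv x x / 2) k) : Cx R) (fun k => 1 * ((dotv x x / 2) ^+ k / k`!%:R)).
  split; last exact: cvg_exp_weight.
  by move=> k; rewrite cabsRC mul1r ger0_norm// divr_ge0// exprn_ge0// divr_ge0// dotv_ge0.
rewrite (csumZ _ d) mulrC; congr (_ * _); apply: csum_eq.
rewrite (_ : psum _ = fun N => RC (series (exp_coeff (dotv x x / 2)) N)); last first.
  by apply/funext => N; rewrite seriesEord RC_sum.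
apply: continuous_cvg; first exact: continuous_RC.
exact: is_cvg_series_exp_coeff.
Qed.

End FunctionalTransform.

(** * Gaussian integrals *)

Section GaussianWeights.
Variable R : realType.
Notation mu := (@lebesgue_measure R).

(** Negative [c] is allowed on purpose: [gw (- eps)] is the growing weight that dominates
    polynomials, and products of weights add their exponents. *)
Definition gw (c t : R) : R := expR (- (c * t ^+ 2)).

Lemma gw_ge0 c t : 0 <= gw c t. Proof. exact: expR_ge0. Qed.

Lemma gwM c d t : gw c t * gw d t = gw (c + d) t.
Proof. by rewrite /gw -expRD; congr expR; ring. Qed.

Lemma continuous_gw c : continuous (gw c).
Proof.
move=> t; rewrite /gw; apply: continuous_comp; last exact: continuous_expR.
apply: cvgN; apply: cvgM; first exact: cvg_cst.
exact: exprn_continuous.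
Qed.

Lemma gw_normal c : 0 < c -> gw c = fun t => Num.sqrt (pi / c) *
  normal_pdf 0 (Num.sqrt (2 * c)^-1) t.
Proof.
move=> c0; have s0 : Num.sqrt (2 * c)^-1 != 0 by rewrite gt_eqF// sqrtr_gt0 invr_gt0 mulr_gt0.
apply/funext => t; rewrite normal_pdfE// /normal_peak /normal_fun subr0 sqr_sqrtr; last first.
  by rewrite invr_ge0 mulr_ge0// ltW.
have -> : (2 * c)^-1 * pi *+ 2 = pi / c by rewrite -mulr_natr; field; rewrite gt_eqF.
rewrite mulVKf; last by rewrite gt_eqF// sqrtr_gt0 divr_gt0// pi_gt0.
by rewrite /gw; congr expR; rewrite -mulr_natr; field; rewrite gt_eqF.
Qed.

Lemma integrable_gw c : 0 < c -> mu.-integrable setT (EFin \o gw c).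
Proof.
move=> c0; rewrite gw_normal//.
rewrite (_ : EFin \o _ = (fun t => (Num.sqrt (pi / c))%:E *
  (normal_pdf 0 (Num.sqrt (2 * c)^-1) t)%:E)%E); last by apply/funext => t; rewrite /= EFinM.
apply: integrableZl => //; exact: integrable_normal_pdf.
Qed.

Lemma Rintegral_gw c : 0 < c -> Rintegral mu setT (gw c) = Num.sqrt (pi / c).
Proof.
move=> c0; rewrite gw_normal// RintegralZl//; last exact: integrable_normal_pdf.
by rewrite /Rintegral integral_normal_pdf mulr1.
Qed.

Lemma dominated_integrable (D : set R) (u : R -> R) A c : measurable D -> continuous u -> 0 < c ->
  (forall t, `|u t| <= A * gw c t) -> mu.-integrable D (EFin \o u).
Proof.
move=> mD cu c0 uA; apply: (@integrableS _ _ _ mu setT) => //.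
apply: (@le_integrable _ _ _ mu setT _ _ (EFin \o (fun t => A * gw c t))) => //.
- by apply/measurable_EFinP; apply: continuous_measurable_fun.
- by move=> t _ /=; rewrite lee_fin (le_trans (uA t))// ler_norm.
- rewrite (_ : EFin \o _ = (fun t => A%:E * (EFin \o gw c) t)%E); last by apply/funext => t; rewrite /= EFinM.
  by apply: integrableZl => //; exact: integrable_gw.
Qed.

Lemma expRN_le_half N : expR (- N%:R) <= (2 ^+ N)^-1 :> R.
Proof.
rewrite expRN lef_pV2 ?posrE ?expR_gt0 ?exprn_gt0//.
rewrite -[N%:R]mul1r expRM_natr lerXn2r ?nnegrE ?expR_ge0//.
by have := expR_ge1Dx (1 : R); rewrite -[1 + 1]/2.
Qed.

(** On [[-n, n]] the integral is a difference of small boundary values. Outside, the weight of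
    exponent 1/4 splits into two of exponent 1/8, one uniformly small and one integrable. *)
Lemma Rintegral_derivative_eq0 (F f : R -> R) A : 0 <= A -> continuous f ->
  (forall t : R, is_derive t (1 : R) F (f t)) -> (forall t, `|f t| <= A * gw (1 / 4) t) ->
  (forall t, `|F t| <= A * gw (1 / 4) t) -> Rintegral mu setT f = 0.
Proof.
move=> A0 cf hF fA FA.
have i4 D : measurable D -> mu.-integrable D (EFin \o f).
  by move=> mD; apply: (@dominated_integrable _ f A (1 / 4)) => //; lra.
apply/eqP; rewrite -normr_eq0 eq_le normr_ge0 andbT.
pose B := Rintegral mu setT (gw (1 / 8)).
have B0 : 0 <= B by apply: Rintegral_ge0 => t _; exact: gw_ge0.
apply: (@geometric_small R (2 * A + A * B)) => N.
(* Then [n^2 / 8 = 8 N^2 >= N], so the weight of exponent 1/8 is at most [2 ^- N] at [n]. *)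
pose n : R := (8 * N)%:R.
have n0 : 0 <= n by [].
have mI : measurable (`[- n, n]%classic : set R) by [].
have mC : measurable (~` `[- n, n]%classic : set R) by exact: measurableC.
rewrite -(setUv `[- n, n]%classic) Rintegral_setU//; [|by apply: i4; rewrite setUv|]; last first.
  by apply/disj_setPS => t [].
have hN : expR (- (1 / 8 * n ^+ 2)) <= (2 ^+ N)^-1.
  apply: le_trans (expRN_le_half N); rewrite ler_expR lerN2 /n natrM.
  case: (N) => [|k]; first by rewrite !mulr0 expr0n mulr0.
  have : (1 : R) <= k.+1%:R by rewrite ler1n.
  nra.
have h1 : `|Rintegral mu `[- n, n] f| <= 2 * A / 2 ^+ N.
  rewrite (@Rintegral_FTC _ F f)//; last lra.
  have h s : s ^+ 2 = n ^+ 2 -> `|F s| <= A / 2 ^+ N.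
    move=> sn; rewrite (le_trans (FA s))// ler_wpM2l// (le_trans _ hN)//.
    by rewrite /gw sn ler_expR lerN2 ler_wpM2r ?sqr_ge0//; lra.
  have := h n erefl; have := h (- n) (sqrrN _); have := ler_normB (F n) (F (- n)).
  by rewrite -mulrA; lra.
have h2 : `|Rintegral mu (~` `[- n, n]) f| <= A * B / 2 ^+ N.
  have ig : mu.-integrable (~` `[- n, n]%classic) (EFin \o (fun t => A / 2 ^+ N * gw (1 / 8) t)).
    have c8 : continuous (fun t => A / 2 ^+ N * gw (1 / 8) t).
      by move=> t; apply: cvgM; [exact: cvg_cst|exact: continuous_gw].
    apply: (dominated_integrable mC c8 (_ : 0 < 1 / 8)) => [|t]; first lra.
    by rewrite ger0_norm// mulr_ge0 ?gw_ge0// divr_ge0// exprn_ge0.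
  apply: (le_trans (@Rintegral_le_abs R _ f (fun t => A / 2 ^+ N * gw (1 / 8) t) mC (i4 _ mC) ig _)).
    move=> t /= /negP; rewrite in_itv /= -ler_norml -ltNge => nt.
    rewrite (le_trans (fA t))// -mulrA ler_wpM2l//.
    have -> : 1 / 4 = 1 / 8 + 1 / 8 :> R by lra.
    rewrite -gwM ler_wpM2r ?gw_ge0// (le_trans _ hN)// /gw ler_expR lerN2 ler_wpM2l//.
    by rewrite -[t ^+ 2]real_normK ?num_real// lerXn2r ?nnegrE// ltW.
  rewrite -mulrA [B / _]mulrC mulrA.
  rewrite RintegralZl//; last by apply: integrableS (integrable_gw _) => //; lra.
  apply: ler_wpM2l; first by rewrite divr_ge0// exprn_ge0.
  rewrite /B -(setUv `[- n, n]%classic) Rintegral_setU//; [|by rewrite setUv; apply: integrable_gw; lra|]; last first.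
    by apply/disj_setPS => t [].
  by rewrite lerDr; apply: Rintegral_ge0 => t _; exact: gw_ge0.
rewrite (le_trans (ler_normD _ _))// [(2 * A + A * B) / _]mulrDl lerD//.
Qed.

End GaussianWeights.

(** * One-dimensional Gaussian Fourier integrals *)

Section ComplexDerivative.
Variable R : realType.
Notation mu := (@lebesgue_measure R).
Implicit Types (F G : R -> Cx R) (d e : Cx R) (t y : R).

Definition cderiv F d t :=
  is_derive t (1 : R) (fun s => complex.Re (F s)) (complex.Re d) /\
  is_derive t (1 : R) (fun s => complex.Im (F s)) (complex.Im d).

Lemma cderivM F G d e t : cderiv F d t -> cderiv G e t ->
  cderiv (fun s => F s * G s) (d * G t + F t * e) t.
Proof.
move=> [F1 F2] [G1 G2]; split.
- rewrite (_ : (fun s => _) = (fun s => complex.Re (F s)) * (fun s => complex.Re (G s)) -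
      (fun s => complex.Im (F s)) * (fun s => complex.Im (G s))); last first.
    by apply/funext => s; rewrite ReM.
  apply: (is_derive_eq (is_deriveB (is_deriveM F1 G1) (is_deriveM F2 G2))); rewrite ReD !ReM /GRing.scale/=; ring.
- rewrite (_ : (fun s => _) = (fun s => complex.Re (F s)) * (fun s => complex.Im (G s)) +
      (fun s => complex.Im (F s)) * (fun s => complex.Re (G s))); last first.
    by apply/funext => s; rewrite ImM.
  apply: (is_derive_eq (is_deriveD (is_deriveM F1 G2) (is_deriveM F2 G1))); rewrite ImD !ImM /GRing.scale/=; ring.
Qed.

Lemma cderivD F G d e t : cderiv F d t -> cderiv G e t ->
  cderiv (fun s => F s + G s) (d + e) t.
Proof.
move=> [F1 F2] [G1 G2]; split.
- rewrite (_ : (fun s => _) = (fun s => complex.Re (F s)) + (fun s => complex.Re (G s))); last first.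
    by apply/funext => s; rewrite ReD.
  by rewrite ReD; exact: is_deriveD.
- rewrite (_ : (fun s => _) = (fun s => complex.Im (F s)) + (fun s => complex.Im (G s))); last first.
    by apply/funext => s; rewrite ImD.
  by rewrite ImD; exact: is_deriveD.
Qed.

Lemma cderiv_cst d t : cderiv (fun=> d) 0 t.
Proof. by split; exact: is_derive_cst. Qed.

Lemma cderiv_RC (u : R -> R) (du : R) t : is_derive t (1 : R) u du -> cderiv (fun s => RC (u s)) (RC du) t.
Proof. by move=> h; split => //=; exact: is_derive_cst. Qed.

Lemma cderiv_expi (c : R) t : cderiv (fun s => expi (c * s)) (IC c * expi (c * t)) t.
Proof.
split => /=.
- have -> : 0 * cos (c * t) - c * sin (c * t) = c * - sin (c * t) by ring.
  exact: (@is_derive_scale R cos (fun t => - sin t)).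
- have -> : 0 * sin (c * t) + c * cos (c * t) = c * cos (c * t) by ring.
  exact: (@is_derive_scale R sin cos).
Qed.

Lemma cderiv_poly (P : {poly Cx R}) t : cderiv (fun s => P.[RC s]) P^`().[RC t] t.
Proof.
elim/poly_ind: P => [|P c ih].
  rewrite deriv0 horner0 (_ : (fun s => _) = fun=> 0); first exact: cderiv_cst.
  by apply/funext => s; rewrite horner0.
rewrite (_ : (fun s => _) = fun s => P.[RC s] * RC s + c); last first.
  by apply/funext => s; rewrite hornerMXaddC.
rewrite derivD derivM derivX derivC addr0 mulr1 hornerD hornerM hornerX.
rewrite -[_ + _]addr0; apply: cderivD; last exact: cderiv_cst.
rewrite -[P.[RC t] in X in cderiv _ X _]mulr1 -RC1.
by apply: cderivM => //; apply: cderiv_RC; exact: is_derive_id.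
Qed.

Lemma cderiv_cvg F d t : cderiv F d t -> F s @[s --> t] --> F t.
Proof.
move=> [h1 h2]; apply: cvgC_ReIm.
- have : {for t, continuous (fun s => complex.Re (F s))}.
    by apply/differentiable_continuous/derivable1_diffP; exact: ex_derive.
  exact.
- have : {for t, continuous (fun s => complex.Im (F s))}.
    by apply/differentiable_continuous/derivable1_diffP; exact: ex_derive.
  exact.
Qed.

Lemma cintD_derivative_eq0 F f A : 0 <= A -> continuous f -> (forall t, cderiv F (f t) t) ->
  (forall t, cabs (f t) <= A * gw (1 / 4) t) -> (forall t, cabs (F t) <= A * gw (1 / 4) t) ->
  cintD setT f = 0.
Proof.
move=> A0 cf hF fA FA; apply: CxE => /=.
- apply: (@Rintegral_derivative_eq0 R (fun t => complex.Re (F t)) _ A) => //.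
  + exact: continuous_ReC.
  + by move=> t; case: (hF t).
  + by move=> t; exact: le_trans (Re_le_cabs _) (fA t).
  + by move=> t; exact: le_trans (Re_le_cabs _) (FA t).
- apply: (@Rintegral_derivative_eq0 R (fun t => complex.Im (F t)) _ A) => //.
  + exact: continuous_ImC.
  + by move=> t; case: (hF t).
  + by move=> t; exact: le_trans (Im_le_cabs _) (fA t).
  + by move=> t; exact: le_trans (Im_le_cabs _) (FA t).
Qed.

Lemma dominated_cintegrable (f : R -> Cx R) A c : continuous f -> 0 < c ->
  (forall t, cabs (f t) <= A * gw c t) -> cintegrable setT f.
Proof.
move=> cf c0 fA; split.
- apply: (@dominated_integrable R setT _ A c) => //; first exact: continuous_ReC.
  by move=> t; exact: le_trans (Re_le_cabs _) (fA t).
- apply: (@dominated_integrable R setT _ A c) => //; first exact: continuous_ImC.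
  by move=> t; exact: le_trans (Im_le_cabs _) (fA t).
Qed.

(** Each factor [X] costs half of the available exponent: [|t| <= (1 + 2 / eps) exp(eps t^2 / 2)],
    while the induction hypothesis is used with [eps / 2]. *)
Lemma poly_gw_bound (P : {poly Cx R}) (eps : R) : 0 < eps ->
  exists2 A, 0 <= A & forall t, cabs P.[RC t] <= A * gw (- eps) t.
Proof.
elim/poly_ind: P eps => [|P c ih] eps e0.
  by exists 0 => // t; rewrite horner0 cabs0 mul0r.
have e20 : 0 < eps / 2 by rewrite divr_gt0.
have [A A0 hA] := ih _ e20.
exists (A * (1 + 2 / eps) + cabs c).
  by rewrite addr_ge0 ?cabs_ge0// mulr_ge0// addr_ge0// divr_ge0// ltW.
move=> t; rewrite hornerMXaddC (le_trans (cabsD _ _))// cabsM cabsRC mulrDl lerD//; last first.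
  rewrite ler_peMr ?cabs_ge0// /gw mulNr opprK -expR0 ler_expR.
  by rewrite mulr_ge0 ?sqr_ge0// ltW.
have t1 : `|t| <= (1 + 2 / eps) * gw (- (eps / 2)) t.
  have h : 1 + eps / 2 * t ^+ 2 <= gw (- (eps / 2)) t.
    by rewrite /gw mulNr opprK expR_ge1Dx.
  have e2 : 0 < 2 / eps by rewrite divr_gt0.
  apply: (@le_trans _ _ ((1 + 2 / eps) * (1 + eps / 2 * t ^+ 2))); last by rewrite ler_wpM2l// addr_ge0// ltW.
  have -> : (1 + 2 / eps) * (1 + eps / 2 * t ^+ 2) = 1 + 2 / eps + eps / 2 * t ^+ 2 + t ^+ 2.
    by field; rewrite gt_eqF.
  have h3 : 0 <= eps / 2 * t ^+ 2 by rewrite mulr_ge0 ?sqr_ge0// ltW.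
  have h4 : `|t| <= 1 + t ^+ 2 by rewrite -[t ^+ 2]real_normK ?num_real//; nra.
  lra.
have := ler_pM (cabs_ge0 _) (normr_ge0 _) (hA t) t1.
have <- : gw (- (eps / 2)) t * gw (- (eps / 2)) t = gw (- eps) t.
  by rewrite gwM (_ : - (eps / 2) + - (eps / 2) = - eps)//; lra.
by move=> /le_trans; apply; rewrite le_eqVlt; apply/orP; left; apply/eqP; ring.
Qed.

Lemma is_derive_quadratic (u : R -> R) (d y K : R) :
  (forall h, `|u (y + h) - u y - h * d| <= K * h ^+ 2) -> is_derive y (1 : R) u d.
Proof.
move=> hu.
have K0 : 0 <= K by have := le_trans (normr_ge0 _) (hu 1); rewrite expr1n mulr1.
have hc : h^-1 *: (u (h *: (1 : R) + y) - u y) @[h --> (0 : R)^'] --> d.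
  apply/cvgrPdist_le => e e0; near=> h.
  have h0 : h != 0 by near: h; exact: nbhs_dnbhs_neq.
  have hK : `|h| <= e / (K + 1) by near: h; apply: dnbhs0_le; rewrite divr_gt0//; lra.
  have -> : d - h^-1 *: (u (h *: 1 + y) - u y) = - (h^-1 * (u (y + h) - u y - h * d)).
    rewrite /GRing.scale /= mulr1 [h + y]addrC; by field.
  rewrite normrN normrM normfV ler_pdivrMl ?normr_gt0// (le_trans (hu h))//.
  rewrite -[h ^+ 2]real_normK ?num_real//.
  rewrite ler_pdivlMr in hK; last lra.
  have := normr_ge0 h; nra.
split; first by apply/cvg_ex; exists d.
exact: cvg_lim hc.
Unshelve. all: by end_near.
Qed.

Lemma is_derive_gw (c t : R) : is_derive t (1 : R) (gw c) (- (2 * c * t) * gw c t).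
Proof.
have h1 : is_derive t (1 : R) (fun s => - (c * s ^+ 2)) (- (2 * c * t)).
  apply: (@is_derive_quadratic _ _ _ `|c|) => h.
  have -> : - (c * (t + h) ^+ 2) - - (c * t ^+ 2) - h * - (2 * c * t) = - (c * h ^+ 2) by ring.
  by rewrite normrN normrM (ger0_norm (sqr_ge0 h)).
have := @is_derive1_comp _ (@expR R) (fun s => - (c * s ^+ 2)) t _ _ (is_derive_expR _) h1.
by rewrite mulrC.
Qed.

Definition gpf (P : {poly Cx R}) y t : Cx R := expi (y * t) * P.[RC t] * RC (gw (1 / 2) t).

Lemma cderiv_gpf P y t : cderiv (gpf P y) (gpf (P^`() + IC y *: P - 'X * P) y t) t.
Proof.
have hg := is_derive_gw (1 / 2) t.
have h := cderivM (cderivM (cderiv_expi y t) (cderiv_poly P t)) (cderiv_RC hg).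
rewrite (_ : gpf _ y t = (IC y * expi (y * t) * P.[RC t] + expi (y * t) * P^`().[RC t]) * RC (gw (1 / 2) t) +
   expi (y * t) * P.[RC t] * RC (- (2 * (1 / 2) * t) * gw (1 / 2) t)) //.
rewrite /gpf hornerD hornerN hornerD hornerZ hornerM hornerX (_ : 2 * (1 / 2) * t = t); last lra.
rewrite RCM RCN; move: (RC (gw _ _)) P.[RC t] P^`().[RC t] (expi _) (IC y) (RC t).
by move=> a b c d e f; ring.
Qed.

Lemma continuous_gpf P y : continuous (gpf P y).
Proof. by move=> t; exact: cderiv_cvg (cderiv_gpf P y t). Qed.

Lemma gpf_bound P (c : R) : c < 1 / 2 ->
  exists2 A, 0 <= A & forall y t, cabs (gpf P y t) <= A * gw c t.
Proof.
move=> c12; have [|A A0 hA] := @poly_gw_bound P (1 / 2 - c); first lra.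
exists A => // y t; rewrite /gpf !cabsM cabs_expi mul1r cabsRC ger0_norm ?gw_ge0//.
have <- : gw (- (1 / 2 - c)) t * gw (1 / 2) t = gw c t.
  by rewrite gwM (_ : - (1 / 2 - c) + 1 / 2 = c)//; lra.
by rewrite mulrA ler_wpM2r ?gw_ge0.
Qed.

Lemma gpf_cintegrable P y : cintegrable setT (gpf P y).
Proof.
have [|A A0 hA] := @gpf_bound P (1 / 4); first lra.
by apply: (@dominated_cintegrable _ A (1 / 4)); [exact: continuous_gpf|lra|exact: hA].
Qed.

Definition Ig P y : Cx R := cintD setT (gpf P y).

Lemma IgD P Q y : Ig (P + Q) y = Ig P y + Ig Q y.
Proof.
rewrite /Ig -cintDD//; [|exact: gpf_cintegrable|exact: gpf_cintegrable].
by congr cintD; apply/funext => t; rewrite /gpf hornerD; ring.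
Qed.

Lemma IgZ c P y : Ig (c *: P) y = c * Ig P y.
Proof.
rewrite /Ig -cintDZ//; last exact: gpf_cintegrable.
by congr cintD; apply/funext => t; rewrite /gpf hornerZ; ring.
Qed.

(** Integration by parts: the derivative of [gpf P y] has integral zero, and the derivative of the
    Gaussian produces the factor [X]. *)
Lemma Ig_parts P y : Ig ('X * P) y = Ig P^`() y + IC y * Ig P y.
Proof.
have h : Ig (P^`() + IC y *: P - 'X * P) y = 0.
  have [|A A0 hA] := @gpf_bound P (1 / 4); first lra.
  have [|B B0 hB] := @gpf_bound (P^`() + IC y *: P - 'X * P) (1 / 4); first lra.
  apply: (@cintD_derivative_eq0 (gpf P y) _ (A + B)).
  - by rewrite addr_ge0.
  - exact: continuous_gpf.
  - by move=> t; exact: cderiv_gpf.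
  - by move=> t; rewrite (le_trans (hB y t))// ler_wpM2r ?gw_ge0// lerDr.
  - by move=> t; rewrite (le_trans (hA y t))// ler_wpM2r ?gw_ge0// lerDl.
by move/eqP: h; rewrite -scaleN1r !IgD !IgZ mulN1r subr_eq0 => /eqP.
Qed.

Lemma expi_taylor2 (x : R) : cabs (expi x - 1 - IC x) <= 4 * x ^+ 2.
Proof.
have hc (s : R) : `|cos s - 1| <= 2 * `|s|.
  have := expi_lipschitz s 0; rewrite subr0 => /(le_trans (Re_le_cabs _)).
  by rewrite expi0 ReD ReN /=.
suff h (y : R) : 0 <= y -> cabs (expi y - 1 - IC y) <= 4 * y ^+ 2.
  have [/h//|x0] := leP 0 x.
  have := h (- x); rewrite sqrrN oppr_ge0 => /(_ (ltW x0)); rewrite !cabsE.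
  by rewrite !ReD !ReN !ImD !ImN /= cosN sinN (_ : - sin x - 0 - - x = - (sin x - 0 - x)) ?sqrrN//; ring.
move=> y0; rewrite (le_trans (cabs_le_ReIm _))// !ReD !ReN !ImD !ImN /= !subr0.
have [->|y1] := eqVneq y 0; first by rewrite cos0 sin0 subrr subr0 normr0 expr0n mulr0 addr0.
have yp : 0 < y by rewrite lt_neqAle eq_sym y1.
have mvt (u du : R -> R) : (forall x : R, is_derive x (1 : R) u (du x)) ->
    (forall x, 0 <= x <= y -> `|du x| <= 2 * y) -> `|u y - u 0| <= 2 * y ^+ 2.
  move=> hu hd; have cu : continuous u.
    by move=> s; apply/differentiable_continuous/derivable1_diffP; exact: ex_derive.
  have [c] := MVT yp (fun s _ => hu s) (continuous_subspaceT cu).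
  rewrite in_itv /= => /andP[c1 c2] ->; rewrite subr0 normrM (ger0_norm y0) expr2 mulrA.
  by rewrite ler_wpM2r// hd// (ltW c1) ltW.
have h1 : `|cos y - 1| <= 2 * y ^+ 2.
  rewrite -[X in _ - X]cos0; apply: (mvt cos (fun s => - sin s)) => s /andP[s0 sy].
  rewrite normrN; have := expi_lipschitz s 0; rewrite subr0 => /(le_trans (Im_le_cabs _)).
  by rewrite expi0 ImD ImN /= subr0 (ger0_norm s0) => /le_trans; apply; rewrite ler_wpM2l.
have h2 : `|sin y - y| <= 2 * y ^+ 2.
  have hs (s : R) : is_derive s (1 : R) (fun s => sin s - s) (cos s - 1).
    exact: (is_deriveB (is_derive_sin s) (is_derive_id s (1 : R))).
  have := mvt _ _ hs; rewrite sin0 subr0 subr0; apply=> s /andP[s0 sy].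
  by rewrite (le_trans (hc s))// (ger0_norm s0) ler_wpM2l.
lra.
Qed.

(** Differentiation under the integral with a quadratic remainder:
    [|expi (h t) - 1 - i h t| <= 4 h^2 t^2], and [t^2] times the Gaussian is bounded by an
    integrable weight. *)
Lemma Ig1_derive y : cderiv (Ig 1) (IC 1 * Ig 'X y) y.
Proof.
have [|A A0 hA] := @gpf_bound ('X * 'X) (1 / 4); first lra.
pose K := 2 * Rintegral mu setT (fun t => (4 * A) * gw (1 / 4) t).
have hK (h : R) : cabs (Ig 1 (y + h) - Ig 1 y - RC h * (IC 1 * Ig 'X y)) <= K * h ^+ 2.
  rewrite mulrA /Ig -cintDB//; [|exact: gpf_cintegrable|exact: gpf_cintegrable].
  rewrite -cintDZ//; last exact: gpf_cintegrable.
  rewrite -cintDB//; [|by apply: cintegrableB; [|exact: gpf_cintegrable|exact: gpf_cintegrable]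
                      |by apply: cintegrableZ; [|exact: gpf_cintegrable]].
  have c4 : continuous (fun t => (4 * A) * gw (1 / 4) t).
    by move=> t; apply: cvgM; [exact: cvg_cst|exact: continuous_gw].
  have A40 : 0 <= 4 * A by rewrite mulr_ge0.
  have i4 : mu.-integrable setT (EFin \o (fun t => (4 * A) * gw (1 / 4) t)).
    apply: (@dominated_integrable R setT _ (4 * A) (1 / 4)) => // t.
    by rewrite ger0_norm// mulr_ge0// gw_ge0.
  apply: (@le_trans _ _ (2 * Rintegral mu setT (fun t => h ^+ 2 * ((4 * A) * gw (1 / 4) t)))).
    apply: cabs_cintD => //.
    - apply: cintegrableB => //.
        by apply: cintegrableB => //; exact: gpf_cintegrable.
      by apply: cintegrableZ => //; exact: gpf_cintegrable.
    - rewrite (_ : EFin \o _ = (fun t => ((h ^+ 2)%R)%:E * (EFin \o (fun t => ((4 * A) * gw (1 / 4) t)%R)) t)%E).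
        exact: integrableZl.
      by apply/funext => t; rewrite /= EFinM.
    - move=> t _; rewrite /gpf.
      have -> : expi ((y + h) * t) * (1 : {poly Cx R}).[RC t] * RC (gw (1 / 2) t) -
          expi (y * t) * (1 : {poly Cx R}).[RC t] * RC (gw (1 / 2) t) -
          RC h * IC 1 * (expi (y * t) * ('X : {poly Cx R}).[RC t] * RC (gw (1 / 2) t)) =
          expi (y * t) * RC (gw (1 / 2) t) * (expi (h * t) - 1 - IC (h * t)).
        by rewrite mulrDl expiD hornerX !hornerC [IC (h * t)]ICE RCM; ring.
      rewrite !cabsM cabs_expi mul1r; have := expi_taylor2 (h * t).
      have := hA 0 t; rewrite /gpf !cabsM cabs_expi mul1r hornerM hornerX cabsM !cabsRC.
      rewrite -expr2 real_normK ?num_real// (ger0_norm (gw_ge0 _ _)).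
      have := gw_ge0 (1 / 2) t; move: (gw (1 / 2) t) (gw (1 / 4) t) (cabs _) => g g4 c g0 h1 h2.
      have := ler_wpM2l g0 h2; rewrite exprMn; have := sqr_ge0 h; nra.
  rewrite RintegralZl// /K le_eqVlt; apply/orP; left; apply/eqP; ring.
split.
- apply: (@is_derive_quadratic _ _ _ K) => h.
  have := le_trans (Re_le_cabs _) (hK h); rewrite !ReD !ReN.
  rewrite (_ : complex.Re (RC h * _) = h * complex.Re (IC 1 * Ig 'X y))//.
  by move: (IC 1 * Ig 'X y) => z; rewrite ReM /= mul0r subr0.
- apply: (@is_derive_quadratic _ _ _ K) => h.
  have := le_trans (Im_le_cabs _) (hK h); rewrite !ImD !ImN.
  rewrite (_ : complex.Im (RC h * _) = h * complex.Im (IC 1 * Ig 'X y))//.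
  by move: (IC 1 * Ig 'X y) => z; rewrite ImM /= mul0r addr0.
Qed.

(** Integration by parts turns the derivative of [Ig 1] into [- y Ig 1], so [Ig 1 y] times
    [exp(y^2 / 2)] is constant; at 0 it is the Gaussian integral. *)
Lemma Ig1E y : Ig 1 y = RC (Num.sqrt (2 * pi) * gw (1 / 2) y).
Proof.
have hq s : cderiv (fun s => Ig 1 s * RC (gw (- (1 / 2)) s)) 0 s.
  have hg := is_derive_gw (- (1 / 2)) s.
  have h := cderivM (Ig1_derive s) (cderiv_RC hg).
  rewrite (_ : 0 = IC 1 * Ig 'X s * RC (gw (- (1 / 2)) s) +
     Ig 1 s * RC (- (2 * - (1 / 2) * s) * gw (- (1 / 2)) s))//.
  have -> : Ig 'X s = IC s * Ig 1 s.
    by rewrite -['X]mulr1 Ig_parts -[1 : {poly _}]/(1%:P) derivC -(scale0r 0) IgZ mul0r add0r.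
  rewrite (_ : - (2 * - (1 / 2) * s) = s); last lra.
  by rewrite mulrA [IC s]ICE mulrA sqrIC1 RCM; ring.
have h0 : Ig 1 y * RC (gw (- (1 / 2)) y) = Ig 1 0 * RC (gw (- (1 / 2)) 0).
  apply: CxE.
  - exact: (is_derive_0_is_cst y 0 (fun s => (hq s).1)).
  - exact: (is_derive_0_is_cst y 0 (fun s => (hq s).2)).
have e0 : Ig 1 0 = RC (Num.sqrt (2 * pi)).
  have hp : Num.sqrt (2 * pi) = Rintegral mu setT (gw (1 / 2)).
    rewrite Rintegral_gw; last lra.
    by congr Num.sqrt; lra.
  rewrite /Ig /cintD hp /RC; congr Complex.
    by apply: eq_Rintegral => t _; rewrite /gpf mul0r expi0 hornerC !mul1r.
  rewrite (_ : (fun t => _) = cst 0).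
    by rewrite Rintegral_cst//= mul0r.
  by apply/funext => t; rewrite /gpf mul0r expi0 hornerC !mul1r.
have e1 : gw (- (1 / 2)) 0 = 1 :> R by rewrite /gw expr0n mulr0 oppr0 expR0.
have e2 : gw (- (1 / 2)) y * gw (1 / 2) y = 1.
  by rewrite gwM addNr /gw mul0r oppr0 expR0.
have -> : Ig 1 y = Ig 1 y * RC (gw (- (1 / 2)) y * gw (1 / 2) y) by rewrite e2 RC1 mulr1.
by rewrite RCM mulrA h0 e0 e1 RC1 mulr1 -RCM.
Qed.

End ComplexDerivative.

(** * Hermite polynomials and the transforms of monomials *)

Section HermiteTransform.
Variable R : realType.
Implicit Types (s t y : R) (k : nat).

(* [(i d/dy)^k exp(-y^2/2) = herm k (y) exp(-y^2/2)]. *)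
Fixpoint herm k : {poly Cx R} :=
  if k is k'.+1 then IC 1 *: ((herm k')^`() - 'X * herm k') else 1.

Lemma herm_deriv k : (herm k)^`() = (- (IC 1 * k%:R)) *: herm k.-1.
Proof.
elim: k => [|k ih]; first by rewrite /= -[1]/(1%:P) derivC mulr0 oppr0 scale0r.
(* Hermite's differential equation. *)
have hX : (herm k)^`()^`() - 'X * (herm k)^`() = (- k%:R) *: herm k.
  rewrite ih derivZ -scalerAr -scalerBr; case: (k) => [|n]; first by rewrite mulr0 oppr0 !scale0r.
  rewrite [n.+1.-1]/= [in RHS]/= scalerA; congr (_ *: _).
  by ring.
rewrite /= derivZ derivB derivM derivX mul1r opprD addrCA hX addrC.
rewrite -[X in _ - X]scale1r -scalerBl scalerA; congr (_ *: _).
by rewrite -natr1; ring.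
Qed.

Lemma herm_rec k : herm k.+1 = k%:R *: herm k.-1 - IC 1 *: ('X * herm k).
Proof.
rewrite /= scalerBr herm_deriv scalerA; congr (_ *: _ - _).
by rewrite mulrN mulrA sqrIC1 mulN1r opprK.
Qed.

Definition psi k y : Cx R := (herm k).[RC y] * RC (gw (1 / 2) y).

Lemma Ig_monomial k y : Ig 'X^k (- y) = RC (Num.sqrt (2 * pi)) * psi k y.
Proof.
have h0 : Ig 'X^0 (- y) = RC (Num.sqrt (2 * pi)) * psi 0 y.
  rewrite expr0 Ig1E /psi /= hornerC [1 * RC _]mul1r RCM; congr (_ * RC _).
  by rewrite /gw sqrrN.
have hrec n : Ig 'X^(n.+1) (- y) = n%:R * Ig 'X^(n.-1) (- y) - IC y * Ig 'X^n (- y).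
  rewrite exprS Ig_parts derivXn -scaler_nat IgZ; congr (_ + _).
  by rewrite -mulNr; congr (_ * _); apply: CxE; rewrite ?ReN ?ImN /= ?oppr0.
have prec n : psi n.+1 y = n%:R * psi n.-1 y - IC y * psi n y.
  rewrite /psi herm_rec hornerD hornerN !hornerZ hornerM hornerX [IC y]ICE; ring.
suff : Ig 'X^k (- y) = RC (Num.sqrt (2 * pi)) * psi k y /\
       Ig 'X^(k.+1) (- y) = RC (Num.sqrt (2 * pi)) * psi k.+1 y by case.
elim: k => [|k [ih1 ih2]].
  by split=> //; rewrite hrec prec h0 mul0r !add0r; ring.
split=> //; rewrite hrec [psi k.+2 y]prec ih2 [k.+1.-1]/= ih1; ring.
Qed.

Lemma gpf_psi k s t : gpf (herm k) s t = expi (s * t) * psi k t.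
Proof. by rewrite /gpf /psi mulrA. Qed.

(** Fourier inversion for monomials times the Gaussian: under [Ig] the operator that builds
    [herm k.+1] from [herm k] becomes multiplication by [s], by integration by parts. *)
Lemma Ig_herm k s : Ig (herm k) s = RC (Num.sqrt (2 * pi) * (s ^+ k * gw (1 / 2) s)).
Proof.
elim: k => [|k ih]; first by rewrite /= Ig1E expr0 [1 * gw _ _]mul1r.
rewrite /= IgZ -scaleN1r IgD IgZ Ig_parts mulN1r opprD addrA subrr add0r ih.
rewrite mulrN mulrA [IC s]ICE mulrA sqrIC1 mulN1r mulNr opprK -RCM exprS; congr RC; ring.
Qed.

Lemma psi_bound k (c : R) : c < 1 / 2 -> exists2 A, 0 <= A & forall t, cabs (psi k t) <= A * gw c t.
Proof.
move=> /(@gpf_bound R (herm k))[A A0 hA]; exists A => // t.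
by have := hA 0 t; rewrite gpf_psi mul0r expi0 mul1r.
Qed.

Lemma continuous_psi k : continuous (psi k).
Proof.
have -> : psi k = gpf (herm k) 0 by apply/funext => t; rewrite gpf_psi mul0r expi0 mul1r.
exact: continuous_gpf.
Qed.

End HermiteTransform.

(** * Iterated integrals under Gaussian weights *)

Section IteratedIntegrals.
Variables (R : realType) (m : nat).
Notation mu := (@lebesgue_measure R).
Implicit Types (x y : 'rV[R]_m) (h : 'rV[R]_m -> R) (g : 'rV[R]_m -> Cx R).

Lemma updc_id x k s t : updc (updc x k s) k t = updc x k t.
Proof. by apply/rowP => i; rewrite !mxE; case: eqP. Qed.

Lemma updc_comm x k l s t : k != l -> updc (updc x l s) k t = updc (updc x k t) l s.
Proof.
move=> kl; apply/rowP => i; rewrite !mxE; case: eqVneq => [ik|//]; rewrite ik.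
by rewrite (negbTE kl).
Qed.

Definition sepcont h := forall x l, continuous (fun t => h (updc x l t)).

Definition gB : R := Rintegral mu setT (gw (1 / 4)).

Lemma gB_ge0 : 0 <= gB.
Proof. by apply: Rintegral_ge0 => t _; exact: gw_ge0. Qed.

Lemma prod_gw_updc k (km : (k < m)%N) x t :
  \prod_(i < m | (k <= i)%N) gw (1 / 4) (updc x k t ord0 i) =
  gw (1 / 4) t * \prod_(i < m | (k < i)%N) gw (1 / 4) (x ord0 i).
Proof.
rewrite (bigD1 (Ordinal km))//= mxE eqxx; congr (_ * _).
apply: eq_big => [i|i]; first by rewrite -val_eqE /= ltn_neqAle eq_sym andbC.
by rewrite -val_eqE /= => /andP[_ ik]; rewrite mxE (negbTE ik).
Qed.

Lemma prod_gw_le1 (P : pred 'I_m) x : \prod_(i < m | P i) gw (1 / 4) (x ord0 i) <= 1.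
Proof.
apply: prodr_ile1 => i _; rewrite gw_ge0 /= -expR0 ler_expR oppr_le0 mulr_ge0 ?sqr_ge0//; lra.
Qed.

(** All partial integrals must stay in one class for the next integration to make sense. Each
    integration trades the weight of its coordinate for the constant [gB], and continuity in the
    other coordinates survives by domination, the remaining weights being at most 1. *)
Lemma iint_class h A k : 0 <= A -> (k <= m)%N -> sepcont h ->
  (forall x, `|h x| <= A * \prod_(i < m) gw (1 / 4) (x ord0 i)) ->
  sepcont (iint k h) /\
  forall x, `|iint k h x| <= A * gB ^+ k * \prod_(i < m | (k <= i)%N) gw (1 / 4) (x ord0 i).
Proof.
move=> A0 + hc hA; elim: k => [|k ih] km.
  by split=> // x; rewrite expr0 mulr1; exact: hA.
have [ih1 ih2] := ih (ltnW km).
have AB : 0 <= A * gB ^+ k by rewrite mulr_ge0// exprn_ge0// gB_ge0.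
have bd x t : `|iint k h (updc x k t)| <=
    A * gB ^+ k * (\prod_(i < m | (k < i)%N) gw (1 / 4) (x ord0 i)) * gw (1 / 4) t.
  by rewrite (le_trans (ih2 _))// prod_gw_updc// mulrA mulrAC.
have bd1 x t : `|iint k h (updc x k t)| <= A * gB ^+ k * gw (1 / 4) t.
  by rewrite (le_trans (bd x t))// ler_wpM2r ?gw_ge0// ler_piMr// prod_gw_le1.
have ii x : mu.-integrable setT (EFin \o (fun t => iint k h (updc x k t))).
  by apply: (@dominated_integrable R setT _ (A * gB ^+ k) (1 / 4)) => //; exact: ih1.
have ig c : mu.-integrable setT (EFin \o (fun t => c * gw (1 / 4) t)).
  apply: (@dominated_integrable R setT _ `|c| (1 / 4)) => //.
    by move=> t; apply: cvgM; [exact: cvg_cst|exact: continuous_gw].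
  by move=> t; rewrite normrM [`|gw _ _|]ger0_norm ?gw_ge0.
split.
- move=> x l; have [->|lk] := eqVneq l k.
    rewrite (_ : (fun t => _) = fun=> iint k.+1 h x); first exact: cst_continuous.
    by apply/funext => s; rewrite /=; apply: eq_Rintegral => t _; rewrite updc_id.
  move=> a; rewrite /=.
  have hcf : {ae mu, forall t, [set: R] t ->
      {in `]a - 1, a + 1[%classic, continuous (fun s => iint k h (updc (updc x l s) k t))}}.
    apply: aeW => t _ s _; rewrite (_ : (fun s => _) = fun s => iint k h (updc (updc x k t) l s)).
      exact: ih1.
    by apply/funext => s'; rewrite updc_comm// eq_sym.
  have hub s : `]a - 1, a + 1[%classic s ->
      {ae mu, forall t, [set: R] t -> `|iint k h (updc (updc x l s) k t)| <= A * gB ^+ k * gw (1 / 4) t}.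
    by move=> _; apply: aeW => t _; exact: bd1.
  apply: (@continuity_under_integral R _ _ mu (fun s t => iint k h (updc (updc x l s) k t)) setT
    measurableT (a - 1) (a + 1) (fun s _ => ii _) hcf (fun t => A * gB ^+ k * gw (1 / 4) t) (ig _) hub).
  by rewrite inE /= in_itv /=; apply/andP; split; lra.
- move=> x /=.
  apply: (le_trans (Rintegral_le_abs measurableT (ii x) (ig _) (fun t _ => bd x t))).
  rewrite RintegralZl//; last by apply: integrable_gw; lra.
  by rewrite -/gB exprSr le_eqVlt; apply/orP; left; apply/eqP; ring.
Qed.

Lemma iint_lin h1 h2 A1 A2 p q k x : 0 <= A1 -> 0 <= A2 -> (k <= m)%N ->
  sepcont h1 -> (forall x, `|h1 x| <= A1 * \prod_(i < m) gw (1 / 4) (x ord0 i)) ->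
  sepcont h2 -> (forall x, `|h2 x| <= A2 * \prod_(i < m) gw (1 / 4) (x ord0 i)) ->
  iint k (fun x => p * h1 x + q * h2 x) x = p * iint k h1 x + q * iint k h2 x.
Proof.
move=> A10 A20 + c1 b1 c2 b2; elim: k x => [//|k ih] x km /=.
have ii h A : 0 <= A -> sepcont h -> (forall x, `|h x| <= A * \prod_(i < m) gw (1 / 4) (x ord0 i)) ->
    mu.-integrable setT (EFin \o (fun t => iint k h (updc x k t))).
  move=> A0 ch bh; have [h3 h4] := iint_class A0 (ltnW km) ch bh.
  apply: (@dominated_integrable R setT _ (A * gB ^+ k) (1 / 4) measurableT (h3 x k)) => [|t]; first lra.
   rewrite (le_trans (h4 _))// prod_gw_updc// ler_wpM2l//.
    by rewrite mulr_ge0// exprn_ge0// gB_ge0.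
  by rewrite ler_piMr ?gw_ge0// prod_gw_le1.
rewrite -Rintegral_lin//; [|exact: ii A10 c1 b1|exact: ii A20 c2 b2].
by apply: eq_Rintegral => t _; rewrite ih// ltnW.
Qed.

Definition gcls A g := [/\ 0 <= A,
  (forall x l, continuous (fun t => g (updc x l t))) &
  forall x, cabs (g x) <= A * \prod_(i < m) gw (1 / 4) (x ord0 i)].

Lemma gcls_Re A g : gcls A g -> sepcont (fun x => complex.Re (g x)) /\
  forall x, `|complex.Re (g x)| <= A * \prod_(i < m) gw (1 / 4) (x ord0 i).
Proof.
move=> [A0 cg bg]; split; first by move=> x l; apply: continuous_ReC; exact: cg.
by move=> x; exact: le_trans (Re_le_cabs _) (bg x).
Qed.

Lemma gcls_Im A g : gcls A g -> sepcont (fun x => complex.Im (g x)) /\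
  forall x, `|complex.Im (g x)| <= A * \prod_(i < m) gw (1 / 4) (x ord0 i).
Proof.
move=> [A0 cg bg]; split; first by move=> x l; apply: continuous_ImC; exact: cg.
by move=> x; exact: le_trans (Im_le_cabs _) (bg x).
Qed.

Lemma cint_lin A1 A2 g1 g2 (c : Cx R) : gcls A1 g1 -> gcls A2 g2 ->
  cint (fun x => c * g1 x + g2 x) = c * cint g1 + cint g2.
Proof.
move=> h1 h2; have [A10 _ _] := h1; have [A20 _ _] := h2.
have [r1 br1] := gcls_Re h1; have [r2 br2] := gcls_Re h2.
have [i1 bi1] := gcls_Im h1; have [i2 bi2] := gcls_Im h2.
have clin p q A3 A4 u v : 0 <= A3 -> 0 <= A4 -> sepcont u -> sepcont v ->
    (forall x, `|u x| <= A3 * \prod_(i < m) gw (1 / 4) (x ord0 i)) ->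
    (forall x, `|v x| <= A4 * \prod_(i < m) gw (1 / 4) (x ord0 i)) ->
    sepcont (fun x => p * u x + q * v x) /\
    (forall x, `|p * u x + q * v x| <= (`|p| * A3 + `|q| * A4) * \prod_(i < m) gw (1 / 4) (x ord0 i)).
  move=> A30 A40 cu cv bu bv; split.
    move=> x l t; apply: cvgD; (apply: cvgM; first exact: cvg_cst).
      exact: (cu x l t).
    exact: (cv x l t).
  move=> x; rewrite (le_trans (ler_normD _ _))// !normrM mulrDl -!mulrA lerD// ler_wpM2l//.
pose c1 := complex.Re c; pose c2 := complex.Im c.
have [L1 B1] := clin c1 (- c2) _ _ _ _ A10 A10 r1 i1 br1 bi1.
have [L2 B2] := clin c1 c2 _ _ _ _ A10 A10 i1 r1 bi1 br1.
have P1 : 0 <= `|c1| * A1 + `|- c2| * A1 by rewrite addr_ge0// mulr_ge0.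
have P2 : 0 <= `|c1| * A1 + `|c2| * A1 by rewrite addr_ge0// mulr_ge0.
apply: CxE; rewrite ?ReD ?ImD ?ReM ?ImM /= /rint -/c1 -/c2.
- rewrite (_ : (fun x => _) = fun x => 1 * (c1 * complex.Re (g1 x) + - c2 * complex.Im (g1 x)) +
     1 * complex.Re (g2 x)); last by apply/funext => x; rewrite ReD ReM !mul1r mulNr.
  rewrite (iint_lin _ _ _ P1 A20 (leqnn m) L1 B1 r2 br2) !mul1r.
  by rewrite (iint_lin _ _ _ A10 A10 (leqnn m) r1 br1 i1 bi1) mulNr.
- rewrite (_ : (fun x => _) = fun x => 1 * (c1 * complex.Im (g1 x) + c2 * complex.Re (g1 x)) +
     1 * complex.Im (g2 x)); last by apply/funext => x; rewrite ImD ImM !mul1r.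
  rewrite (iint_lin _ _ _ P2 A20 (leqnn m) L2 B2 i2 bi2) !mul1r.
  by rewrite (iint_lin _ _ _ A10 A10 (leqnn m) i1 bi1 r1 br1).
Qed.

Lemma cabs_cint A g : gcls A g -> cabs (cint g) <= 2 * (A * gB ^+ m).
Proof.
move=> hg; have [A0 _ _] := hg.
have [r1 br1] := gcls_Re hg; have [i1 bi1] := gcls_Im hg.
have [_ hr] := iint_class A0 (leqnn m) r1 br1.
have [_ hi] := iint_class A0 (leqnn m) i1 bi1.
have p1 : \prod_(i < m | (m <= i)%N) gw (1 / 4) ((0 : 'rV[R]_m) ord0 i) = 1.
  by rewrite big1// => i; rewrite leqNgt ltn_ord.
rewrite (le_trans (cabs_le_ReIm _))//= mulrDl mul1r /rint.
by have := hr 0; have := hi 0; rewrite p1 mulr1; lra.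
Qed.

Definition ciint k g x : Cx R :=
  Complex (iint k (fun x => complex.Re (g x)) x) (iint k (fun x => complex.Im (g x)) x).

Lemma cint_prod (f : 'I_m -> R -> Cx R) : (forall i, cintegrable setT (f i)) ->
  cint (fun x => \prod_(i < m) f i (x ord0 i)) = \prod_(i < m) cintD setT (f i).
Proof.
move=> fi; pose g x := \prod_(i < m) f i (x ord0 i).
suff h k x : (k <= m)%N -> ciint k g x =
    \prod_(i < m) (if (i < k)%N then cintD setT (f i) else f i (x ord0 i)).
  have := h m 0 (leqnn m); rewrite -[ciint m g 0]/(cint g) => ->.
  by apply: eq_bigr => i _; rewrite ltn_ord.
elim: k x => [|k ih] x km; first by apply: CxE.
have -> : ciint k.+1 g x = cintD setT (fun t => ciint k g (updc x k t)) by [].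
pose o := Ordinal km.
pose c := \prod_(i < m | i != o) (if (i < k.+1)%N then cintD setT (f i) else f i (x ord0 i)).
rewrite (_ : (fun t => _) = fun t => c * f o t); last first.
  apply/funext => t; rewrite ih ?(ltnW km)// (bigD1 o)//= ltnn mxE eqxx mulrC; congr (_ * _).
  apply: eq_bigr => i io; have ik : (i : nat) != k by [].
  by rewrite ltnS [(i <= k)%N]leq_eqVlt (negbTE ik) /= mxE (negbTE ik).
by rewrite cintDZ// (bigD1 o)//= ltnSn mulrC.
Qed.

(** Continuity along lines is what the series bounds give for [Kf]; it is stable under products and
    contains continuity in each coordinate. *)
Definition lcont g := forall x y, g (y + t *: x) @[t --> (0 : R)] --> g y.

Lemma lcont_updc g : lcont g -> forall x l, continuous (fun t => g (updc x l t)).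
Proof.
move=> hg x l t0.
have [lm|lm] := ltnP l m; last first.
  rewrite (_ : (fun t => _) = fun=> g x); first exact: cst_continuous.
  apply/funext => t; congr g; apply/rowP => i; rewrite mxE.
  by rewrite (ltn_eqF (leq_trans (ltn_ord i) lm)).
have e t : updc x l t = updc x l t0 + (t - t0) *: ej R (Ordinal lm).
  apply/rowP => i; rewrite !mxE -val_eqE /=; case: eqVneq => _; last by rewrite mulr0 addr0.
  by rewrite mulr1 addrC subrK.
have h := hg (ej R (Ordinal lm)) (updc x l t0).
have c0 : (t - t0) @[t --> t0] --> (0 : R).
  by apply/subr_cvg0; exact: cvg_id.
have := cvg_comp _ _ c0 h; rewrite (_ : _ \o _ = fun t => g (updc x l t)); first by [].
by apply/funext => t /=; rewrite -e.
Qed.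

Lemma lcontM g1 g2 : lcont g1 -> lcont g2 -> lcont (fun x => g1 x * g2 x).
Proof. by move=> h1 h2 x y; apply: cvgM; [exact: h1|exact: h2]. Qed.

Lemma lcontD g1 g2 : lcont g1 -> lcont g2 -> lcont (fun x => g1 x + g2 x).
Proof. by move=> h1 h2 x y; apply: cvgD; [exact: h1|exact: h2]. Qed.

Lemma lcont_cst (c : Cx R) : lcont (fun=> c).
Proof. by move=> x y; exact: cvg_cst. Qed.

Lemma lcont_coord (f : R -> Cx R) i : continuous f -> lcont (fun x => f (x ord0 i)).
Proof.
move=> cf x y; apply: continuous_cvg; first exact: cf.
under eq_fun do rewrite !mxE.
have h : y ord0 i + t * x ord0 i @[t --> (0 : R)] --> y ord0 i + 0 * x ord0 i.
  by apply: cvgD; [exact: cvg_cst|apply: cvgM; [exact: cvg_id|exact: cvg_cst]].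
by rewrite mul0r addr0 in h.
Qed.

Lemma lcont_prod (I : Type) (r : seq I) (G : I -> 'rV[R]_m -> Cx R) : (forall i, lcont (G i)) ->
  lcont (fun x => \prod_(i <- r) G i x).
Proof.
move=> hG; elim: r => [|i r ih].
  have -> : (fun x => \prod_(j <- [::]) G j x) = fun=> 1 by apply/funext => x; rewrite big_nil.
  exact: lcont_cst.
have -> : (fun x => \prod_(j <- i :: r) G j x) = fun x => G i x * \prod_(j <- r) G j x.
  by apply/funext => x; rewrite big_cons.
exact: lcontM (hG i) ih.
Qed.

Lemma gcls_prod (f : 'I_m -> R -> Cx R) (A : 'I_m -> R) : (forall i, continuous (f i)) ->
  (forall i, 0 <= A i) -> (forall i t, cabs (f i t) <= A i * gw (1 / 4) t) ->
  gcls (\prod_(i < m) A i) (fun x => \prod_(i < m) f i (x ord0 i)).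
Proof.
move=> cf A0 hA; split; first by apply: prodr_ge0.
  have hl : lcont (fun x => \prod_(i < m) f i (x ord0 i)).
    by apply: (@lcont_prod _ _ (fun i x => f i (x ord0 i))) => i; exact: lcont_coord.
  exact: lcont_updc hl.
move=> x; rewrite -big_split /=.
have -> : cabs (\prod_(i < m) f i (x ord0 i)) = \prod_(i < m) cabs (f i (x ord0 i)).
  by apply: (big_morph _ (@cabsM R) (@cabs1 R)).
by apply: ler_prod => i _; rewrite cabs_ge0 hA.
Qed.

Lemma gclsD A1 A2 g1 g2 (c : Cx R) : gcls A1 g1 -> gcls A2 g2 ->
  gcls (cabs c * A1 + A2) (fun x => c * g1 x + g2 x).
Proof.
move=> [A10 c1 b1] [A20 c2 b2]; split.
- by rewrite addr_ge0// mulr_ge0// cabs_ge0.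
- move=> x l t; apply: cvgD; last exact: (c2 x l t).
  by apply: cvgM; [exact: cvg_cst|exact: (c1 x l t)].
- move=> x; rewrite (le_trans (cabsD _ _))// cabsM mulrDl -mulrA lerD// ler_wpM2l// cabs_ge0//.
Qed.

Lemma gcls0 : gcls 0 (fun=> 0).
Proof.
split=> //; first by move=> x l; exact: cst_continuous.
by move=> x; rewrite cabs0 mul0r.
Qed.

Lemma cint0 : cint (fun _ : 'rV[R]_m => 0) = 0.
Proof.
apply: cabs_eq0; apply/eqP; rewrite eq_le cabs_ge0 andbT.
by have := cabs_cint gcls0; rewrite mul0r mulr0.
Qed.

Lemma cint_sum (I : Type) (r : seq I) (c : I -> Cx R) (G : I -> 'rV[R]_m -> Cx R) (A : I -> R) :
  (forall i, gcls (A i) (G i)) ->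
  gcls (\sum_(i <- r) cabs (c i) * A i) (fun x => \sum_(i <- r) c i * G i x) /\
  cint (fun x => \sum_(i <- r) c i * G i x) = \sum_(i <- r) c i * cint (G i).
Proof.
move=> hG; elim: r => [|i r [ih1 ih2]].
  have -> : (fun x => \sum_(j <- [::]) c j * G j x) = fun=> 0 by apply/funext => x; rewrite big_nil.
  by rewrite !big_nil; split; [exact: gcls0|exact: cint0].
have -> : (fun x => \sum_(j <- i :: r) c j * G j x) = fun x => c i * G i x + \sum_(j <- r) c j * G j x.
  by apply/funext => x; rewrite big_cons.
rewrite !big_cons; split; first exact: gclsD.
by rewrite (cint_lin _ (hG i) ih1) ih2.
Qed.

End IteratedIntegrals.

(** * Fourier inversion for functionals *)

Section DensityOfEvaluations.
Variables (R : realType) (m : nat).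
Implicit Types (lam : multinom m -> R) (nu : multinom m) (x : 'rV[R]_m) (rho C : R).
Variable J : (multinom m -> R) -> Cx R.
Hypothesis J_lin : forall rho C1 C2 lam1 lam2 (c : R), 0 <= rho -> bdd rho C1 lam1 ->
  bdd rho C2 lam2 -> J (fun nu => c * lam1 nu + lam2 nu) = RC c * J lam1 + J lam2.
Hypothesis J_bound : forall rho, 0 <= rho -> exists2 A, 0 <= A & forall C lam,
  bdd rho C lam -> cabs (J lam) <= A * C.
Hypothesis J_ev : forall x, J (evf x) = 0.

Let lo N lam nu := if (mdeg nu < N)%N then lam nu else 0.
Let hi N lam nu := if (mdeg nu < N)%N then 0 else lam nu.
Let gr n lam nu := if mdeg nu == n then lam nu else 0.
Let delta nu nu' : R := (nu' == nu)%:R.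

Let bdd_lo rho C N lam : 0 <= rho -> bdd rho C lam -> bdd rho C (lo N lam).
Proof.
move=> rho0 hl nu; rewrite /lo; case: ifP => _; first exact: hl.
by rewrite normr0 mulr_ge0 ?exprn_ge0// (bdd_C_ge0 hl).
Qed.

Let bdd_gr rho C n lam : 0 <= rho -> bdd rho C lam -> bdd rho C (gr n lam).
Proof.
move=> rho0 hl nu; rewrite /gr; case: ifP => _; first exact: hl.
by rewrite normr0 mulr_ge0 ?exprn_ge0// (bdd_C_ge0 hl).
Qed.

Let bdd_double rho C lam : 0 <= rho -> bdd rho C lam -> bdd (2 * rho) C lam.
Proof.
move=> rho0 hl nu; apply: (le_trans (hl nu)); rewrite ler_wpM2l ?(bdd_C_ge0 hl)//.
by apply: lerXn2r; rewrite ?nnegrE//; lra.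
Qed.

(** Doubling the growth ratio buys the factor [2 ^- N] on degrees at least [N], which makes tails
    small for a map bounded on every class [bdd rho]. *)
Let bdd_hi rho C N lam : 0 <= rho -> bdd rho C lam -> bdd (2 * rho) (C / 2 ^+ N) (hi N lam).
Proof.
move=> rho0 hl nu; have C0 := bdd_C_ge0 hl.
rewrite /hi; case: ltnP => hN.
  by rewrite normr0 mulr_ge0 ?divr_ge0 ?exprn_ge0// mulr_ge0.
apply: (le_trans (hl nu)); rewrite -mulrA ler_wpM2l// exprMn mulrA ler_peMl ?exprn_ge0//.
rewrite ler_pdivlMl ?exprn_gt0// mulr1; apply: ler_weXn2l => //; lra.
Qed.

Let J0 : J (fun=> 0) = 0.
Proof.
have [A A0 hA] := J_bound ler01.
apply: cabs_eq0; apply/eqP; rewrite eq_le cabs_ge0 andbT.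
have h0 : @bdd R m 1 0 (fun=> 0) by move=> nu; rewrite normr0 mul0r.
by have := hA _ _ h0; rewrite mulr0.
Qed.

Let J_sum (I : Type) (r : seq I) rho C (c : I -> R) (F : I -> multinom m -> R) : 0 <= rho ->
  (forall i, bdd rho C (F i)) ->
  (exists C', bdd rho C' (fun nu => \sum_(i <- r) c i * F i nu)) /\
  J (fun nu => \sum_(i <- r) c i * F i nu) = \sum_(i <- r) RC (c i) * J (F i).
Proof.
move=> rho0 hF; elim: r => [|i r [[C' hC'] ih]].
  have -> : (fun nu => \sum_(i <- [::]) c i * F i nu) = fun=> 0 by apply/funext => nu; rewrite big_nil.
  by rewrite big_nil J0; split=> //; exists 0 => nu; rewrite normr0 mul0r.
have -> : (fun nu => \sum_(k <- i :: r) c k * F k nu) = (fun nu => c i * F i nu + \sum_(k <- r) c k * F k nu).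
  by apply/funext => nu; rewrite big_cons.
rewrite big_cons (J_lin _ rho0 (hF i) hC') ih; split=> //.
by exists (`|c i| * C + C'); apply: bddD => //; exact: bddZ.
Qed.

Let gr_delta n lam : gr n lam = fun nu' => \sum_(b : bmultinom m n.+1) gr n lam b * delta b nu'.
Proof.
apply/funext => nu'; rewrite /delta.
have [h|h] := ltnP (mdeg nu') n.+1.
  rewrite (bigD1 (BMultinom h))//= eqxx mulr1 big1 ?addr0// => nu hnu.
  rewrite (_ : (nu' == nu) = false) ?mulr0//.
  by apply/negbTE; apply: contraNneq hnu => e; apply/eqP/val_inj.
rewrite big1; first by rewrite /gr gtn_eqF.
move=> nu _; rewrite (_ : (nu' == nu) = false) ?mulr0//.
by apply/negbTE; apply: contraTneq h => ->; rewrite -ltnNge; exact: bmdeg.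
Qed.

Let bdd_delta nu : bdd 1 1 (delta nu).
Proof. by move=> nu'; rewrite expr1n mulr1 /delta; case: eqP; rewrite ?normr1 ?normr0 ?ler01. Qed.

Let J_gr n lam : J (gr n lam) = \sum_(b : bmultinom m n.+1) RC (gr n lam b) * J (delta b).
Proof.
rewrite {1}gr_delta.
by have [_ ->] := @J_sum _ (index_enum (bmultinom m n.+1)) 1 1 (fun b => gr n lam b) (fun b => delta b) ler01 (fun b => @bdd_delta b).
Qed.

Let J_lo rho C N lam : 0 <= rho -> bdd rho C lam -> J (lo N lam) = \sum_(n < N) J (gr n lam).
Proof.
move=> rho0 hl; elim: N => [|N ih]; first by rewrite big_ord0 -[RHS]J0.
rewrite big_ord_recr /= -ih addrC.
have -> : lo N.+1 lam = fun nu => 1 * gr N lam nu + lo N lam nu.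
  apply/funext => nu; rewrite mul1r /lo /gr ltnS leq_eqVlt; case: eqP => /= [->|_].
    by rewrite ltnn addr0.
  by rewrite add0r.
by rewrite (J_lin _ rho0 (bdd_gr N rho0 hl) (bdd_lo N rho0 hl)) RC1 mul1r.
Qed.

Let J_split rho C N lam : 0 <= rho -> bdd rho C lam -> J lam = J (lo N lam) + J (hi N lam).
Proof.
move=> rho0 hl; have r20 : 0 <= 2 * rho by rewrite mulr_ge0.
rewrite -[J (lo N lam)]mul1r -RC1 -(J_lin _ r20 (bdd_double rho0 (bdd_lo N rho0 hl)) (bdd_hi N rho0 hl)).
congr J; apply/funext => nu; rewrite mul1r /lo /hi; case: ifP => _; by rewrite ?addr0 ?add0r.
Qed.

Let J_gr_ev n x : J (gr n (evf x)) = 0.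
Proof.
have v0 := vnorm_ge0 x.
have hb : bdd (vnorm x) 1 (evf x) by apply: bdd_evf; exact: coord_le_vnorm.
have [A A0 hA] := J_bound v0.
apply: (@power_series_eq0 R (fun n => J (gr n (evf x))) (A * 1)).
  by move=> k; apply: hA; exact: bdd_gr.
move=> s s12.
have s0 : 0 <= s by lra.
have hs nu : evf (s *: x) nu = s ^+ mdeg nu * evf x nu.
  rewrite /evf /peval !mevalX mdegE -prodrXr -big_split; apply: eq_bigr => i _ /=.
  by rewrite mxE exprMn.
have hbs : bdd (vnorm x) 1 (evf (s *: x)).
  apply: bdd_evf => i; rewrite mxE normrM (ger0_norm s0).
  by have := coord_le_vnorm x i; have := normr_ge0 (x ord0 i); nra.
have hgr k : J (gr k (evf (s *: x))) = J (gr k (evf x)) * RC s ^+ k.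
  have -> : gr k (evf (s *: x)) = fun nu => s ^+ k * gr k (evf x) nu + 0.
    apply/funext => nu; rewrite addr0 /gr; case: eqP => [<-|_]; last by rewrite mulr0.
    exact: hs.
  have h0 : @bdd R m (vnorm x) 0 (fun=> 0) by move=> nu; rewrite normr0 mul0r.
  by rewrite (J_lin _ v0 (bdd_gr k v0 hb) h0) J0 addr0 RCX mulrC.
have [B B0 hB] := J_bound (mulr_ge0 (ler0n R 2) v0).
apply: csum_eq; apply/cvgC_cabs.
apply: (@squeeze_cvgr _ _ _ _ (fun=> 0) (fun N => B * 1 / 2 ^+ N)).
- apply: nearW => N; rewrite cabs_ge0 subr0 /=.
  (* As [J] vanishes on evaluations, each partial sum is minus the value of [J] on a tail. *)
  have -> : psum (fun n => J (gr n (evf x)) * RC s ^+ n) N = - J (hi N (evf (s *: x))).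
    have := J_split N v0 hbs; rewrite J_ev (J_lo N v0 hbs) => /eqP.
    rewrite eq_sym addr_eq0 => /eqP <-; apply: eq_bigr => k _; by rewrite hgr.
  by rewrite cabsN -mulrA; apply: hB; exact: bdd_hi.
- exact: cvg_cst.
- exact: cvg_geometric_half.
Qed.

(** For [r] the real or the imaginary part, the numbers [r (J (delta mu))] with [|mu| = n] are the
    coefficients of a homogeneous polynomial in [x] whose values are [r (J (gr n (evf x))) = 0]. *)
Let J_delta nu : J (delta nu) = 0.
Proof.
pose n := mdeg nu.
have key (r : Cx R -> R) : (forall c z, r (RC c * z) = c * r z) ->
   (forall (I : Type) (s : seq I) (F : I -> Cx R), r (\sum_(i <- s) F i) = \sum_(i <- s) r (F i)) ->
   r 0 = 0 -> r (J (delta nu)) = 0.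
  move=> rZ rS r0.
  pose Q : mpoly m R := \sum_(mu : bmultinom m n.+1)
     (if mdeg mu == n then r (J (delta mu)) else 0) *: mpolyX R mu.
  have Q0 : Q = 0.
    apply: peval_eq0 => x; rewrite /Q peval_sum.
    have := congr1 r (J_gr_ev n x); rewrite J_gr rS r0 => e; rewrite -[RHS]e.
    apply: eq_bigr => mu _; rewrite pevalZ rZ /gr; case: eqP => _; last by rewrite !mul0r.
    by rewrite mulrC.
  have : mcoeff nu Q = 0 by rewrite Q0 mcoeff0.
  have hn : (mdeg nu < n.+1)%N by [].
  rewrite /Q raddf_sum /= (bigD1 (BMultinom hn))//= eqxx mcoeffZ mcoeffX eqxx mulr1 big1 ?addr0//.
  move=> mu hmu; rewrite mcoeffZ mcoeffX (_ : ((mu : multinom m) == nu) = false) ?mulr0//.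
  by apply/negbTE; apply: contraNneq hmu => e; apply/eqP/val_inj.
apply: CxE.
- apply: (key (@complex.Re R)) => //; first by move=> c z; rewrite ReM /= mul0r subr0.
  by move=> I s F; exact: Re_sum.
- apply: (key (@complex.Im R)) => //; first by move=> c z; rewrite ImM /= mul0r addr0.
  by move=> I s F; exact: Im_sum.
Qed.

(* The coefficients in [s] of [J (evf (s *: x))] isolate the homogeneous parts of the
   functional, those in [x] the single monomials, and tails are geometrically small. *)
Lemma vanish_on_evaluations rho C lam : 0 <= rho -> bdd rho C lam -> J lam = 0.
Proof.
move=> rho0 hl; apply: cabs_eq0; apply/eqP; rewrite eq_le cabs_ge0 andbT.
have [B B0 hB] := J_bound (mulr_ge0 (ler0n R 2) rho0).
apply: (@geometric_small R (B * C)) => N.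
rewrite (J_split N rho0 hl) (J_lo N rho0 hl) big1 ?add0r; last first.
  by move=> n _; rewrite J_gr big1// => nu _; rewrite J_delta mulr0.
by rewrite -mulrA; apply: hB; exact: bdd_hi.
Qed.

End DensityOfEvaluations.

(** * The inversion formula for functionals *)

Section GaussianTransform.
Variables (R : realType) (m : nat) (p : mpoly m R).
Implicit Types (x y : 'rV[R]_m) (lam : multinom m -> R) (rho C : R).

Let sq : R := Num.sqrt (2 * pi).

Let fnorm_sq : fnorm R m * sq ^+ m = 1.
Proof. by rewrite /fnorm mulVf// expf_neq0// gt_eqF// sqrtr_gt0 mulr_gt0// pi_gt0. Qed.

Definition Psi y : Cx R := \sum_(nu <- msupp p) RC (mcoeff nu p) * \prod_(i < m) psi (nu i) (y ord0 i).

Let exp_dotv x : expR (- dotv x x / 2) = \prod_(i < m) gw (1 / 2) (x ord0 i).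
Proof.
rewrite /dotv mulNr mulr_suml -sumrN expR_sum; apply: eq_bigr => i _.
by rewrite /gw; congr expR; field.
Qed.

Lemma fourier_pgauss y : fourier (pgauss p) y = Psi y.
Proof.
rewrite /fourier.
have -> : (fun x => expi (- dotv x y) * pgauss p x) = (fun x => \sum_(nu <- msupp p) RC (mcoeff nu p) *
    \prod_(i < m) gpf 'X^(nu i) (- y ord0 i) (x ord0 i)).
  apply/funext => x; rewrite /pgauss /peval mevalE exp_dotv mulr_suml RC_sum mulr_sumr.
  apply: eq_bigr => nu _; rewrite !RCM !RC_prod.
  have -> : expi (- dotv x y) = \prod_(i < m) expi (- y ord0 i * x ord0 i).
    rewrite -expi_sum /dotv -sumrN; apply: (congr1 (@expi R)); apply: eq_bigr => i _.
    by rewrite mulNr mulrC.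
  rewrite -[X in _ * X]mulrA mulrCA -!big_split; congr (_ * _); apply: eq_bigr => i _ /=.
  by rewrite /gpf hornerXn RCX mulrA.
have hb (i : 'I_m) (k : nat) : exists A, 0 <= A /\ forall t, cabs (gpf 'X^k (- y ord0 i) t) <= A * gw (1 / 4) t.
  by have [|A A0 hA] := @gpf_bound R 'X^k (1 / 4); [lra|exists A; split].
have [A hA] := choice (fun ik : 'I_m * nat => hb ik.1 ik.2).
have [_ ->] := @cint_sum R m _ (msupp p) (fun nu => RC (mcoeff nu p))
   (fun (nu : multinom m) x => \prod_(i < m) gpf 'X^(nu i) (- y ord0 i) (x ord0 i))
   (fun nu => \prod_(i < m) A (i, nu i))
   (fun nu => @gcls_prod R m (fun i => gpf 'X^(nu i) (- y ord0 i)) (fun i => A (i, nu i))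
      (fun i => @continuous_gpf R _ _) (fun i => (hA (i, nu i)).1) (fun i => (hA (i, nu i)).2)).
rewrite mulr_sumr; apply: eq_bigr => nu _.
rewrite (@cint_prod R m (fun i => gpf 'X^(nu i) (- y ord0 i))); last by move=> i; exact: gpf_cintegrable.
rewrite (eq_bigr (fun i => RC sq * psi (nu i) (y ord0 i))); last by move=> i _; exact: Ig_monomial.
have e : RC (fnorm R m) * RC sq ^+ m = 1 by rewrite -RCX -RCM fnorm_sq.
rewrite big_split /= prodr_const card_ord.
transitivity (RC (fnorm R m) * RC sq ^+ m *
   (RC (mcoeff nu p) * \prod_(i < m) psi (nu i) (y ord0 i))); first by ring.
by rewrite e mul1r.
Qed.

(** The exponent 3/8 lies between the 1/2 of the Gaussian and the 1/4 of the integrable class: the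
    first gap absorbs the Hermite polynomials, the second the exponential growth of [Kf]. *)
Lemma Psi_bound : exists2 D, 0 <= D & forall y, cabs (Psi y) <= D * \prod_(i < m) gw (3 / 8) (y ord0 i).
Proof.
have hb (k : nat) : exists A, 0 <= A /\ forall t : R, cabs (psi k t) <= A * gw (3 / 8) t.
  by have [|A A0 hA] := @psi_bound R k (3 / 8); [lra|exists A; split].
have /choice[A hA] := hb.
exists (\sum_(nu <- msupp p) `|mcoeff nu p| * \prod_(i < m) A (nu i)).
  by apply: sumr_ge0 => nu _; rewrite mulr_ge0// prodr_ge0// => i _; case: (hA (nu i)).
move=> y; rewrite (le_trans (cabs_sum _ _ _))// mulr_suml; apply: ler_sum => nu _.
rewrite cabsM cabsRC -mulrA ler_wpM2l// -big_split /=.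
rewrite (big_morph _ (@cabsM R) (@cabs1 R)).
by apply: ler_prod => i _; rewrite cabs_ge0 (hA _).2.
Qed.

Lemma lcont_Psi : lcont Psi.
Proof.
rewrite /Psi; elim: (msupp p) => [|nu r ih].
  have -> : (fun y => \sum_(nu <- [::]) RC (mcoeff nu p) * \prod_(i < m) psi (nu i) (y ord0 i)) = fun=> 0.
    by apply/funext => y; rewrite big_nil.
  exact: lcont_cst.
have -> : (fun y => \sum_(mu <- nu :: r) RC (mcoeff mu p) * \prod_(i < m) psi (mu i) (y ord0 i)) =
    fun y => RC (mcoeff nu p) * \prod_(i < m) psi (nu i) (y ord0 i) +
     \sum_(mu <- r) RC (mcoeff mu p) * \prod_(i < m) psi (mu i) (y ord0 i).
  by apply/funext => y; rewrite big_cons.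
apply: lcontD ih; apply: lcontM; first exact: lcont_cst.
by apply: (@lcont_prod R m _ _ (fun i y => psi (nu i) (y ord0 i))) => i; apply: lcont_coord; exact: continuous_psi.
Qed.

Lemma gcls_Kf_Psi rho : 0 <= rho -> exists2 A, 0 <= A & forall C lam, bdd rho C lam ->
  gcls (A * C) (fun y => Kf lam y * Psi y).
Proof.
move=> rho0; have [D D0 hD] := Psi_bound.
exists (expR (m%:R * rho ^+ 2 / 2) * D * expR (2 * rho ^+ 2) ^+ m).
  by rewrite !mulr_ge0 ?expR_ge0// exprn_ge0// expR_ge0.
move=> C lam hl; have C0 := bdd_C_ge0 hl; split.
- by rewrite !mulr_ge0 ?expR_ge0// exprn_ge0// expR_ge0.
- have hc : lcont (fun y => Kf lam y * Psi y).
    apply: lcontM; last exact: lcont_Psi.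
    by move=> x y; exact: Kf_cvg_line rho0 hl.
  exact: lcont_updc hc.
- move=> y; rewrite cabsM.
  apply: (le_trans (ler_pM (cabs_ge0 _) (cabs_ge0 _) (Kf_bound y rho0 hl) (hD y))).
  (* Completing the square in each coordinate: [2 rho^2 - rho t + t^2 / 8 = (t - 4 rho)^2 / 8]. *)
  have h : expR (rho * n1 y) * \prod_(i < m) gw (3 / 8) (y ord0 i) <=
      expR (2 * rho ^+ 2) ^+ m * \prod_(i < m) gw (1 / 4) (y ord0 i).
    rewrite /n1 mulr_sumr expR_sum -big_split /=.
    have -> : expR (2 * rho ^+ 2) ^+ m = \prod_(i < m) expR (2 * rho ^+ 2) by rewrite prodr_const card_ord.
    rewrite -big_split /=; apply: ler_prod => i _; rewrite mulr_ge0 ?expR_ge0//=.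
    rewrite /gw -!expRD ler_expR -[y ord0 i ^+ 2]real_normK ?num_real//.
    by move: `|_| => t; have := sqr_ge0 (t - 4 * rho); nra.
  have q0 : 0 <= C * expR (m%:R * rho ^+ 2 / 2) * D by rewrite !mulr_ge0// expR_ge0.
  apply: (le_trans _ (le_trans (ler_wpM2l q0 h) _)).
    by rewrite le_eqVlt; apply/orP; left; apply/eqP; ring.
  by rewrite le_eqVlt; apply/orP; left; apply/eqP; ring.
Qed.

(** The defect of the inversion formula as a function of the functional, so that
    [vanish_on_evaluations] applies to it. *)
Let J lam : Cx R := RC (fnorm R m) * cint (fun y => Kf lam y * Psi y) - RC (Lam lam p).

Let J_lin rho C1 C2 lam1 lam2 (c : R) : 0 <= rho -> bdd rho C1 lam1 ->
  bdd rho C2 lam2 -> J (fun nu => c * lam1 nu + lam2 nu) = RC c * J lam1 + J lam2.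
Proof.
move=> rho0 h1 h2; have [A A0 hA] := gcls_Kf_Psi rho0.
have hK : cint (fun y => Kf (fun nu => c * lam1 nu + lam2 nu) y * Psi y) =
    RC c * cint (fun y => Kf lam1 y * Psi y) + cint (fun y => Kf lam2 y * Psi y).
  rewrite -(cint_lin _ (hA _ _ h1) (hA _ _ h2)); congr cint; apply/funext => y.
  by rewrite (KfD y rho0 (bddZ c h1) h2) (KfZ c y rho0 h1) mulrDl mulrA.
rewrite /J hK Lam_add Lam_scale RCD RCM mulrDr [RC (fnorm R m) * (RC c * _)]mulrCA.
by rewrite opprD addrACA -mulrBr.
Qed.

Let J_bound rho : 0 <= rho -> exists2 A, 0 <= A & forall C lam,
  bdd rho C lam -> cabs (J lam) <= A * C.
Proof.
move=> rho0; have [A A0 hA] := gcls_Kf_Psi rho0.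
have f0 : 0 <= fnorm R m by rewrite invr_ge0 exprn_ge0// sqrtr_ge0.
pose L := \sum_(nu <- msupp p) `|mcoeff nu p| * rho ^+ mdeg nu.
have L0 : 0 <= L by apply: sumr_ge0 => nu _; rewrite mulr_ge0// exprn_ge0.
exists (fnorm R m * (2 * (A * gB R ^+ m)) + L).
  by rewrite addr_ge0// !mulr_ge0// exprn_ge0// gB_ge0.
move=> C lam hl; rewrite (le_trans (cabsB _ _))// mulrDl lerD//.
  rewrite cabsM cabsRC ger0_norm// -mulrA ler_wpM2l//.
  rewrite (le_trans (cabs_cint (hA _ _ hl)))//.
  by rewrite le_eqVlt; apply/orP; left; apply/eqP; ring.
rewrite cabsRC LamE (le_trans (ler_norm_sum _ _ _))// /L mulr_suml; apply: ler_sum => nu _.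
by rewrite normrM -mulrA ler_wpM2l// mulrC.
Qed.

(** The factor [exp(|x|^2 / 2)] of [Kf (evf x)] cancels the Gaussians produced by [Ig_herm], and
    [fnorm] cancels the powers of [sqrt (2 pi)]; what remains is the value of [p] at [x]. *)
Let J_ev x : J (evf x) = 0.
Proof.
rewrite /J Lam_ev.
have -> : (fun y => Kf (evf x) y * Psi y) = (fun y => \sum_(nu <- msupp p)
   RC (expR (dotv x x / 2) * mcoeff nu p) * \prod_(i < m) gpf (herm R (nu i)) (x ord0 i) (y ord0 i)).
  apply/funext => y; rewrite Kf_ev /Psi mulr_sumr; apply: eq_bigr => nu _.
  have -> : \prod_(i < m) gpf (herm R (nu i)) (x ord0 i) (y ord0 i) =
      expi (dotv x y) * \prod_(i < m) psi (nu i) (y ord0 i).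
    rewrite /dotv expi_sum -big_split; apply: eq_bigr => i _; exact: gpf_psi.
  by rewrite RCM; ring.
have hb (k : nat) : exists A, 0 <= A /\ forall s t : R, cabs (gpf (herm R k) s t) <= A * gw (1 / 4) t.
  by have [|A A0 hA] := @gpf_bound R (herm R k) (1 / 4); [lra|exists A; split].
have /choice[A hA] := hb.
have [_ ->] := @cint_sum R m _ (msupp p) (fun nu => RC (expR (dotv x x / 2) * mcoeff nu p))
   (fun (nu : multinom m) y => \prod_(i < m) gpf (herm R (nu i)) (x ord0 i) (y ord0 i))
   (fun nu => \prod_(i < m) A (nu i))
   (fun nu => @gcls_prod R m (fun i => gpf (herm R (nu i)) (x ord0 i)) (fun i => A (nu i))
      (fun i => @continuous_gpf R _ _) (fun i => (hA (nu i)).1) (fun i => (hA (nu i)).2 (x ord0 i))).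
apply/eqP; rewrite subr_eq0; apply/eqP.
rewrite /peval mevalE mulr_sumr RC_sum; apply: eq_bigr => nu _.
rewrite (@cint_prod R m (fun i => gpf (herm R (nu i)) (x ord0 i))); last by move=> i; exact: gpf_cintegrable.
rewrite (eq_bigr (fun i => RC (sq * (x ord0 i ^+ nu i * gw (1 / 2) (x ord0 i))))); last first.
  by move=> i _; exact: Ig_herm.
rewrite -RC_prod -!RCM; congr RC; rewrite big_split /= prodr_const card_ord big_split /= -exp_dotv.
rewrite mulNr expRN.
transitivity (fnorm R m * sq ^+ m * (expR (dotv x x / 2) / expR (dotv x x / 2)) *
   (mcoeff nu p * \prod_(i < m) x ord0 i ^+ nu i)); first by ring.
by rewrite fnorm_sq divff ?mul1r// gt_eqF// expR_gt0.
Qed.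

Theorem Kf_gauss_integral rho C lam : 0 <= rho -> bdd rho C lam ->
  RC (fnorm R m) * cint (fun y => Kf lam y * fourier (pgauss p) y) = RC (Lam lam p).
Proof.
move=> rho0 hl.
have := @vanish_on_evaluations R m J J_lin J_bound J_ev rho C lam rho0 hl.
rewrite /J => /eqP; rewrite subr_eq0 => /eqP <-; congr (_ * cint _).
by apply/funext => y; rewrite fourier_pgauss.
Qed.

End GaussianTransform.

(** The argument [i y] is the point [s = i] of the complex ray through the real vector [y], within
    reach because the expansion of the kernel holds on the closed unit disc. Symmetry then lets [z]
    be the evaluation point and [y] the linear form, so [E] becomes [Ft] of the values of the
    intertwiner at [z], a functional of growth [|z|]. *)
Lemma Vop_V (R : realType) (m : nat) (Rt : seq 'rV[R]_m) (beta : 'rV[R]_m)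
    (kappa : 'rV[R]_m -> R) (E : 'rV[Cx R]_m -> 'rV[Cx R]_m -> Cx R) :
  root_system Rt -> regular_vector Rt beta -> G_invariant Rt kappa ->
  (forall a, a \in Rt -> 0 <= kappa a) -> is_Dunkl_kernel Rt beta kappa E ->
  forall p : mpoly m R, Vop E p = fun z => RC (peval (intertwiner Rt beta kappa p) z).
Proof.
move=> HR Hb Hk k0 HE p; apply/funext => z.
have Rt0 a : a \in Rt -> dotv a a != 0 := root_neq0 HR (a := a).
pose lam nu := peval (vnu Rt beta kappa nu) z.
have hl : bdd (vnorm z) 1 lam by apply: (@V_bdd R m Rt beta kappa Rt0 k0); exact: lexx.
have v0 := vnorm_ge0 z.
rewrite V_eval -/lam -(Kf_gauss_integral p v0 hl) /Vop; congr (_ * cint _); apply/funext => y.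
congr (_ * _); rewrite -(heat_op_Ft y v0 hl) /Kker; congr (heat_op _ y); apply/funext => y'.
have -> : map_mx (@IC R) y' = (IC 1 : Cx R) *: map_mx (@RC R) y'.
  by apply/rowP => i; rewrite !mxE ICE.
rewrite (kernel_expansion HR Hb Hk k0 HE) ?cabsIC ?normr1//.
apply: (congr1 (@csum R)); apply/funext => n; rewrite (W_symmetric HR Hb Hk k0).
by rewrite /kernel_coef V_eval.
Qed.

Theorem mainTheorem4 (R : realType) (m : nat) (Rt : seq 'rV[R]_m) (beta : 'rV[R]_m)
    (kappa : 'rV[R]_m -> R) (E : 'rV[Cx R]_m -> 'rV[Cx R]_m -> Cx R) :
  root_system Rt ->
  regular_vector Rt beta ->
  G_invariant Rt kappa ->
  (forall a, a \in Rt -> 0 <= kappa a) ->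
  is_Dunkl_kernel Rt beta kappa E ->
  forall (p : mpoly.mpoly m R) (j : 'I_m) (z : 'rV[R]_m),
    has_pd (Vop E p) j z /\
    Vop E (mpoly.mderiv j p) z = dunkl Rt beta kappa j (Vop E p) z.
Proof.
move=> HR Hb Hk k0 HE p j z.
have Rt0 a : a \in Rt -> dotv a a != 0 := root_neq0 HR (a := a).
rewrite !(Vop_V HR Hb Hk k0 HE); split; first exact: (pd_peval _ j z).1.
by rewrite dunkl_peval// (pdunkl_V HR Hb Hk k0 HE).
Qed.
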